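(* There exists a field $K$ for which the following assertions hold true: (i) finite extensions of $K$ are strictly primarily quasilocal fields; (ii) the absolute Galois group $G_K$ is not pronilpotent; (iii) every finite extension $R$ of $K$ is subject to the following alternative: either ($\alpha$) $R$ is an intermediate field of a finite Galois extension $M(R)/K$ with a nilpotent Galois group; or ($\beta$) $N(R/K)$ does not equal the norm group $N(L/K)$ of any finite abelian extension $L$ of $K$.
   Context: For a finite extension $R/E$, $N(R/E)\subseteq E^{\ast}$ is the norm group (the image of $R^{\ast}$ under the norm map). ${\rm Br}(E)_p$ is the $p$-component of the Brauer group ${\rm Br}(E)$. For a field $E$, $P(E)$ is the set of primes $p$ for which there exists at least one cyclic extension of $E$ of degree $p$. For a prime $p$, $E$ is called $p$-quasilocal if at least one of the following holds: (1) ${\rm Br}(E)_p=\{0\}$ or $p\notin P(E)$; (2) every cyclic extension of $E$ of degree $p$ embeds as an $E$-subalgebra in each central division $E$-algebra of Schur index $p$. A $p$-quasilocal field $E$ is called strictly $p$-quasilocal if ${\rm Br}(E)_p\neq\{0\}$ or $p\notin P(E)$. $E$ is called strictly primarily quasilocal (strictly PQL) if it is strictly $p$-quasilocal for every prime $p$. *)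

(* Defs.v *)
From HB Require Import structures.
From mathcomp Require Import all_boot all_order all_algebra all_fingroup.
From mathcomp Require Import all_solvable all_field.
From mathcomp Require Import boolp classical_sets.

Set Implicit Arguments.
Unset Strict Implicit.
Unset Printing Implicit Defensive.

Import GRing.Theory.
Local Open Scope classical_set_scope.
Local Open Scope ring_scope.

(* Norm of a (possibly inseparable) finite extension: the determinant of
   multiplication by x, seen as an E-linear endomorphism of R. *)
Definition ext_norm (E : fieldType) (R : fieldExtType E) (x : R) : E :=
  \det (passmx.mxof (vbasis {:R}) (vbasis {:R}) (amull x)).

Definition norm_group (E : fieldType) (R : fieldExtType E) : set E :=
  [set ext_norm x | x in [set x : R | x != 0]].

(* As an A-module, A ⊗_E B is the free module A^n = ⊕_k A ⊗ b_k, where (b_k)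
   is a basis of B; the product is given by the structure constants of B. *)
Definition tensor (E : fieldType) (A B : falgType E) : Type :=
  {ffun 'I_(\dim {:B}) -> A}.

Section Tensor.
Variables (E : fieldType) (A B : falgType E).
Local Notation n := (\dim {:B}).
Local Notation T := (tensor A B).
Local Notation b := (vbasis {:B}).

HB.instance Definition _ := Vector.copy T {ffun 'I_n -> A}.

Definition pure_tensor (a : A) (x : B) : T := [ffun k => coord b k x *: a].

Definition tensor_mul (u v : T) : T :=
  [ffun k => \sum_(i < n) \sum_(j < n) coord b k (b`_i * b`_j) *: (u i * v j)].

Let coord_sum (x : B) : x = \sum_(i < n) coord b i x *: b`_i.
Proof. by rewrite -coord_vbasis ?memvf. Qed.

Fact pure_tensorM (a a' : A) (x x' : B) :
  tensor_mul (pure_tensor a x) (pure_tensor a' x')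
    = pure_tensor (a * a') (x * x').
Proof.
apply/ffunP=> k; rewrite !ffunE [in RHS](coord_sum x) [in RHS](coord_sum x').
rewrite mulr_suml linear_sum scaler_suml; apply: eq_bigr => i _ /=.
rewrite mulr_sumr linear_sum scaler_suml; apply: eq_bigr => j _ /=.
rewrite !ffunE -!scalerAl -!scalerAr !linearZ /= !scalerA.
by congr (_ *: _); rewrite mulrA.
Qed.

Fact pure_tensor_span (u : T) : u = \sum_(i < n) pure_tensor (u i) b`_i.
Proof.
apply/ffunP=> k; rewrite sum_ffunE (bigD1 k) //= big1 => [|i ik].
  by rewrite ffunE coord_free ?(basis_free (vbasisP _)) // eqxx scale1r addr0.
by rewrite ffunE coord_free ?(basis_free (vbasisP _)) // (negPf ik)
  scale0r.
Qed.

Fact tensor_mulDl : left_distributive tensor_mul +%R.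
Proof.
move=> u v w; apply/ffunP=> k; rewrite !ffunE -big_split; apply: eq_bigr => i _.
rewrite -big_split; apply: eq_bigr => j _ /=.
by rewrite ffunE mulrDl scalerDr.
Qed.

Fact tensor_mulDr : right_distributive tensor_mul +%R.
Proof.
move=> u v w; apply/ffunP=> k; rewrite !ffunE -big_split; apply: eq_bigr => i _.
rewrite -big_split; apply: eq_bigr => j _ /=.
by rewrite ffunE mulrDr scalerDr.
Qed.

Let tensor_mul_suml m (F : 'I_m -> T) v :
  tensor_mul (\sum_i F i) v = \sum_i tensor_mul (F i) v.
Proof.
apply: (big_morph (tensor_mul^~ v)) => [u w|]; first exact: tensor_mulDl.
by apply: (addrI (tensor_mul 0 v)); rewrite -tensor_mulDl !addr0.
Qed.

Let tensor_mul_sumr m (F : 'I_m -> T) v :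
  tensor_mul v (\sum_i F i) = \sum_i tensor_mul v (F i).
Proof.
apply: (big_morph (tensor_mul v)) => [u w|]; first exact: tensor_mulDr.
by apply: (addrI (tensor_mul v 0)); rewrite -tensor_mulDr !addr0.
Qed.

Fact tensor_mulA : associative tensor_mul.
Proof.
move=> u v w; rewrite (pure_tensor_span u) (pure_tensor_span v).
rewrite (pure_tensor_span w) !tensor_mul_suml; apply: eq_bigr => i _.
rewrite !tensor_mul_sumr [RHS](eq_bigr _ (fun k _ => tensor_mul_suml _ _)).
rewrite exchange_big; apply: eq_bigr => j _ /=; rewrite !tensor_mul_sumr.
by apply: eq_bigr => k _; rewrite !pure_tensorM !mulrA.
Qed.

Fact tensor_mul1l : left_id (pure_tensor 1 1) tensor_mul.
Proof.
move=> u; rewrite (pure_tensor_span u) tensor_mul_sumr.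
by apply: eq_bigr => i _; rewrite pure_tensorM !mul1r.
Qed.

Fact tensor_mul1r : right_id (pure_tensor 1 1) tensor_mul.
Proof.
move=> u; rewrite (pure_tensor_span u) tensor_mul_suml.
by apply: eq_bigr => i _; rewrite pure_tensorM !mulr1.
Qed.

Fact tensor_one_neq0 : pure_tensor 1 1 != 0.
Proof.
apply/eqP=> /ffunP t0; case/eqP: (oner_neq0 B).
rewrite (coord_sum 1) big1 // => i _; have /eqP := t0 i.
by rewrite !ffunE scaler_eq0 oner_eq0 orbF => /eqP->; rewrite scale0r.
Qed.

HB.instance Definition _ := GRing.Zmodule_isNzRing.Build T
  tensor_mulA tensor_mul1l tensor_mul1r tensor_mulDl tensor_mulDr
  tensor_one_neq0.

Fact tensor_scaleAl (c : E) (u v : T) : c *: (u * v) = (c *: u) * v.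
Proof.
apply/ffunP=> k; rewrite !ffunE scaler_sumr; apply: eq_bigr => i _.
rewrite scaler_sumr; apply: eq_bigr => j _.
by rewrite ffunE -scalerAl !scalerA mulrC.
Qed.

Fact tensor_scaleAr (c : E) (u v : T) : c *: (u * v) = u * (c *: v).
Proof.
apply/ffunP=> k; rewrite !ffunE scaler_sumr; apply: eq_bigr => i _.
rewrite scaler_sumr; apply: eq_bigr => j _.
by rewrite ffunE -scalerAr !scalerA mulrC.
Qed.

HB.instance Definition _ := GRing.Lmodule_isLalgebra.Build E T tensor_scaleAl.
HB.instance Definition _ := GRing.Lalgebra_isAlgebra.Build E T tensor_scaleAr.
HB.instance Definition _ := Algebra_isFalgebra.Build E T.

End Tensor.

Section Algebras.
Variable E : fieldType.
Implicit Types A B D : falgType E.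

Fixpoint tensor_pow A m : falgType E :=
  if m is m'.+1 then tensor (tensor_pow A m') A else E^o.

Definition central A : Prop := 'Z({:A})%VS = 1%VS.

(* Two-sided ideals of a unital E-algebra are E-subspaces. *)
Definition simple_alg A : Prop :=
  forall U : {vspace A}, ({:A} * U <= U)%VS -> (U * {:A} <= U)%VS ->
    U = 0%VS \/ U = {:A}%VS.

Definition central_simple A : Prop := central A /\ simple_alg A.

Definition central_division D : Prop :=
  central D /\ forall x : D, x != 0 -> x \is a GRing.unit.

(* M_m(A) ≅ M_n(B) as E-algebras for some m, n > 0; 'M[A]_m.+1 is only an
   A-module in the library, so E acts on it through k |-> k *: 1 in A. *)
Definition brauer_equiv A B : Prop :=
  exists (m n : nat) (f : {rmorphism 'M[A]_m.+1 -> 'M[B]_n.+1}),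
    bijective f /\
    forall (k : E) (x : 'M[A]_m.+1), f (k%:A *: x) = k%:A *: f x.

(* Br(E)_p = 0, where Br(E) is the group of Brauer classes of central simple
   E-algebras under the tensor product, with unit the class of E: every class
   whose p^r-th power is trivial for some r is itself trivial. *)
Definition Br_p_trivial (p : nat) : Prop :=
  forall A, central_simple A ->
    (exists r : nat, brauer_equiv (tensor_pow A (p ^ r)) E^o) ->
    brauer_equiv A E^o.

Definition cyclic_ext_of_degree (L : splittingFieldType E) (p : nat) : Prop :=
  [/\ galois 1 {:L}, cyclic 'Gal({:L} / 1) & \dim {:L} = p].

Definition cyclic_primes : set nat :=
  [set p | prime p /\
     exists L : splittingFieldType E, cyclic_ext_of_degree L p].

(* The Schur index of a central division algebra D is the square root of
   its dimension. An algebra homomorphism L -> D preserves 1, so it is injective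
   because L is a field. *)
Definition cyclic_exts_embed (p : nat) : Prop :=
  forall L : splittingFieldType E, cyclic_ext_of_degree L p ->
  forall D, central_division D -> \dim {:D} = (p ^ 2)%N ->
    inhabited 'AHom(L, D).

Definition quasilocal (p : nat) : Prop :=
  (Br_p_trivial p \/ ~ cyclic_primes p) \/ cyclic_exts_embed p.

Definition strictly_quasilocal (p : nat) : Prop :=
  quasilocal p /\ (~ Br_p_trivial p \/ ~ cyclic_primes p).

Definition strictly_PQL : Prop :=
  forall p : nat, prime p -> strictly_quasilocal p.

End Algebras.

Definition separable_closure (K Ks : fieldType) (i : {rmorphism K -> Ks}) :
    Prop :=
  (forall x : Ks, exists q : {poly K},
     separable_poly q /\ root (map_poly i q) x) /\
  (forall q : {poly Ks}, separable_poly q -> (1 < size q)%N ->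
     exists x : Ks, root q x).

Definition is_aut (K Ks : fieldType) (i : {rmorphism K -> Ks}) (s : Ks -> Ks) :
    Prop :=
  [/\ {morph s : x y / x + y}, {morph s : x y / x * y}, bijective s
    & forall a : K, s (i a) = i a].

Record gal_group (K Ks : fieldType) (i : {rmorphism K -> Ks}) : Type := GalAut {
  gal_fun :> Ks -> Ks;
  gal_funP : is_aut i gal_fun
}.

Section GalGroup.
Variables (K Ks : fieldType) (i : {rmorphism K -> Ks}).
Local Notation G := (gal_group i).

Fact gal_group_inj (s t : G) : s =1 t -> s = t.
Proof.
case: s t => s sP [t tP] /= /funext st; move: sP tP; rewrite st => sP tP.
by rewrite (Prop_irrelevance sP tP).
Qed.

Fact is_aut_id : is_aut i id.
Proof. by split=> //; exists id. Qed.

Fact is_aut_comp (s t : G) : is_aut i (s \o t).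
Proof.
case: s t => s [sD sM sB sK] [t [tD tM tB tK]] /=.
split=> [x y|x y||a] /=; rewrite ?tD ?tM ?tK //.
exact: bij_comp.
Qed.

Fact gal_inv_subproof (s : G) : exists t : G, cancel s t /\ cancel t s.
Proof.
case: s => s [sD sM [t stK tsK] sK] /=.
have tP : is_aut i t.
  split=> [x y|x y||a]; first by apply: (can_inj stK); rewrite sD !tsK.
  - by apply: (can_inj stK); rewrite sM !tsK.
  - by exists s.
  - by rewrite -[in LHS](sK a) stK.
by exists (GalAut tP).
Qed.

Definition gal_one : G := GalAut is_aut_id.
Definition gal_mul (s t : G) : G := GalAut (is_aut_comp s t).
Definition gal_inv (s : G) : G := sval (cid (gal_inv_subproof s)).

Fact gal_mulA : associative gal_mul.
Proof. by move=> s t u; apply: gal_group_inj. Qed.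
Fact gal_mul1l : left_id gal_one gal_mul.
Proof. by move=> s; apply: gal_group_inj. Qed.
Fact gal_mul1r : right_id gal_one gal_mul.
Proof. by move=> s; apply: gal_group_inj. Qed.
Fact gal_mulVl : left_inverse gal_one gal_inv gal_mul.
Proof.
move=> s; apply: gal_group_inj => x /=.
by rewrite /gal_inv; case: cid => t [] /= ->.
Qed.
Fact gal_mulVr : right_inverse gal_one gal_inv gal_mul.
Proof.
move=> s; apply: gal_group_inj => x /=.
by rewrite /gal_inv; case: cid => t [] /= _ ->.
Qed.

HB.instance Definition _ := gen_eqMixin G.
HB.instance Definition _ := gen_choiceMixin G.
HB.instance Definition _ :=
  isGroup.Build G gal_mulA gal_mul1l gal_mul1r gal_mulVl gal_mulVr.

(* Basic neighborhoods of s: the automorphisms that agree with s on a finite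
   set, equivalently on a finite subextension. *)
Definition krull_open : set (set G) :=
  [set U : set G | forall s : G, U s -> exists X : seq Ks,
     forall t : G, {in X, t =1 s} -> U t].

End GalGroup.

(* The topological group (G, op) is, through the maps pr j, the inverse limit
   of the inverse system (N, phi) of finite discrete groups over the directed
   preordered set (J, le). Since le is directed, the fibres of the maps pr j
   form a basis of the inverse limit topology. *)
Record is_inverse_limit (G : groupType) (op : set (set G)) (J : Type)
    (le : J -> J -> Prop) (N : J -> finGroupType)
    (phi : forall j k, le j k -> {multiplicative N k -> N j})
    (pr : forall j, {multiplicative G -> N j}) : Prop := IsInverseLimit {
  il_refl : forall j, le j j;
  il_trans : forall j k l, le j k -> le k l -> le j l;
  il_directed : forall j k, exists l, le j l /\ le k l;
  il_inhab : inhabited J;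
  il_id : forall j (jj : le j j) x, phi j j jj x = x;
  il_comp : forall j k l (jk : le j k) (kl : le k l) (jl : le j l) x,
    phi j k jk (phi k l kl x) = phi j l jl x;
  il_compat : forall j k (jk : le j k) g, phi j k jk (pr k g) = pr j g;
  il_bij : forall x : (forall j, N j),
    (forall j k (jk : le j k), phi j k jk (x k) = x j) ->
    exists! g : G, forall j, pr j g = x j;
  il_open : forall U : set G, op U <->
    (forall g, U g -> exists j, forall h, pr j h = pr j g -> U h)
}.

Definition pronilpotent (G : groupType) (op : set (set G)) : Prop :=
  exists (J : Type) (le : J -> J -> Prop) (N : J -> finGroupType)
    (phi : forall j k, le j k -> {multiplicative N k -> N j})
    (pr : forall j, {multiplicative G -> N j}),
    is_inverse_limit op phi pr /\ forall j, nilpotent [set: N j]%G.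

Definition in_nilpotent_ext (K : fieldType) (R : fieldExtType K) : Prop :=
  exists M : splittingFieldType K,
    [/\ galois 1 {:M}, nilpotent 'Gal({:M} / 1) & inhabited 'AHom(R, M)].

(* Main.v *)
(* Let Om be the field of Levi-Civita series with algebraic complex coefficients and exponents in Q^2,
   ordered through (a, b) |-> a + b sqrt 2; it is algebraically closed.  Complex conjugation of the
   coefficients and the characters of Q^2 that are trivial on Z_(3)^2, acting by
   t^g |-> chi(g) t^g, generate a group Z_3^2 x| Z/2, with Z/2 acting by inversion.  K is its fixed
   field and Ks the algebraic closure of K in Om, so that G_K is this group.
   - A finite extension E of K either contains i, and then G_E is isomorphic to Z_3^2, or is formally
     real with E^* = E^*2 u -E^*2.  In the first case only the prime 3 matters: cyclic cubic extensions
     and central division algebras of degree 3 are of Kummer type, E^*/E^*3 is detected by the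
     valuation and has rank at most 2, so that every cubic extension embeds in every such algebra, and
     a symbol algebra (a, b) with independent values is a division algebra.  In the second case only 2
     matters: E(i) embeds in every central division algebra of degree 2, and (-1, -1) is one.
   - In a nilpotent quotient of G_K, a 3-element inverted by conjugation is trivial.
   - A finite extension R of degree d has d | 2 3^m.  If d <= 2 it is Galois with nilpotent group.
     Otherwise N(R/K) is not the norm group of an abelian extension: abelian extensions have degree at
     most 2, so their norm groups contain K^*2; but if N(R/K) contained K^*2, then elements of R of
     value 2g/d, g in Z^2, would give 9^m > d elements of R linearly independent over K, where
     3^m is the 3-part of d. *)
Require Import Defs.
From HB Require Import structures.
From mathcomp Require Import all_boot all_order all_algebra all_fingroup.
From mathcomp Require Import all_solvable all_field.
From mathcomp Require Import boolp classical_sets.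
From mathcomp Require Import realalg ring lra zify.

Set Implicit Arguments.
Unset Strict Implicit.
Unset Printing Implicit Defensive.

Import Order.TTheory GRing.Theory Num.Theory.
Local Open Scope ring_scope.

(** * Series with exponents in Q^2 *)

(** Rank 2 matters twice. With one copy of Q, an extension containing i would have absolute Galois
    group Z_3, hence cubic extensions but no 3-torsion in its Brauer group, against strictness; and
    3^m elements would not outnumber the degree d in the norm argument. The order through a + b sqrt
    2 makes this value group of rational rank 2 archimedean, so that limits of sequences are enough
    for Hensel's lemma. The prime must be odd: Z_2^2 extended by inversion is a pro-2 group. Finite
    extensions are studied through embeddings into Om: each one is the fixed field of its
    stabiliser, orbits of algebraic elements are finite, and degrees, restrictions to Galois
    extensions and Kummer generators are read off from orbits. That Br(E)_p is nonzero requires a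
    nontrivial class killed by a power of p. The p-th tensor power of a symbol algebra of degree p
    is split by explicit monomial matrices; the algebra itself is not split, since it has no zero
    divisors and its dimension exceeds 1. *)

Notation expo := (rat * rat)%type.

Definition sqrt2 : realalg := Num.sqrt 2%:R.
Definition ht (g : expo) : realalg := ratr g.1 + ratr g.2 * sqrt2.

Lemma htD (g h : expo) : ht (g + h) = ht g + ht h.
Proof. by rewrite /ht /= !rmorphD mulrDl addrACA. Qed.

Lemma ht0 : ht 0 = 0.
Proof. by rewrite /ht /= !rmorph0 mul0r addr0. Qed.

Lemma htN (g : expo) : ht (- g) = - ht g.
Proof. by rewrite /ht /= !rmorphN mulNr opprD. Qed.

Lemma htB (g h : expo) : ht (g - h) = ht g - ht h.
Proof. by rewrite htD htN. Qed.

Definition scale_expo (r : rat) (g : expo) : expo := (r * g.1, r * g.2).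

Lemma htZ (r : rat) (g : expo) : ht (scale_expo r g) = ratr r * ht g.
Proof. by rewrite /ht /= !rmorphM mulrDr mulrA. Qed.

Lemma htMn (g : expo) n : ht (g *+ n) = ht g *+ n.
Proof. by elim: n => [|n IHn]; rewrite ?mulr0n ?ht0 // !mulrS htD IHn. Qed.

(** The exponent of 2 is even on one side and odd on the other. *)
Lemma sqr_neq_double (p q : nat) : (0 < q -> p ^ 2 <> 2 * q ^ 2)%N.
Proof.
move=> q0 e.
have := congr1 (logn 2) e; rewrite lognM ?expn_gt0 ?q0 // !lognX (logn_prime 2 (isT : prime 2)).
by move=> /(congr1 odd); rewrite oddD !oddM.
Qed.

Lemma ht_eq0 (g : expo) : ht g = 0 -> g = 0.
Proof.
case: g => a b; rewrite /ht /= => e.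
have [b0|b0] := eqVneq b 0.
  move: e; rewrite b0 rmorph0 mul0r addr0 => /eqP; rewrite fmorph_eq0 => /eqP-> //.
have e2 : sqrt2 = ratr (- a / b).
  rewrite fmorph_div rmorphN; apply: (canRL (mulfK _)); first by rewrite fmorph_eq0.
  by apply/eqP; rewrite -addr_eq0 mulrC addrC e.
have : (sqrt2 ^+ 2) = 2%:R by rewrite sqr_sqrtr // ler0n.
rewrite e2; set r := _ / _ => er.
have e3 : r ^+ 2 = 2%:R.
  by apply: (fmorph_inj (@ratr realalg)); rewrite !expr2 rmorphM -expr2 er rmorph_nat.
have dn0 : (denq r != 0)%R by rewrite denq_neq0.
have e4 : (numq r ^+ 2 = 2 * denq r ^+ 2 :> int)%R.
  apply: (@intr_inj rat); rewrite !expr2 !intrM -!expr2 -[2%:~R]/(2%:R : rat) -e3.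
  by rewrite -[X in X ^+ 2 * _](divq_num_den r) expr_div_n divfK // expf_neq0 // intr_eq0.
have := congr1 absz e4; rewrite abszM !abszX => /sqr_neq_double [].
by rewrite absz_gt0.
Qed.

Lemma ht_inj : injective ht.
Proof. by move=> g h e; apply/eqP; rewrite -subr_eq0; apply/eqP/ht_eq0; rewrite htB e subrr. Qed.

Section Series.
Variable k : fieldType.
Implicit Types (r s : realalg) (g h : expo).

Definition left_finite (f : expo -> k) : Prop :=
  forall r, exists s : seq expo, forall g, f g != 0 -> ht g < r -> g \in s.

Record series := Series { cf :> expo -> k; _ : left_finite cf }.

Lemma seriesP (f : series) : left_finite f. Proof. by case: f. Qed.

Lemma series_ext (f f' : series) : f =1 f' -> f = f'.
Proof.
case: f f' => f fP [f' fP'] /= /funext e; move: fP fP'; rewrite e => fP fP'.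
by rewrite (Prop_irrelevance fP fP').
Qed.

HB.instance Definition _ := gen_eqMixin series.
HB.instance Definition _ := gen_choiceMixin series.

Lemma lf0 : left_finite (fun=> 0).
Proof. by exists [::] => g; rewrite eqxx. Qed.

Lemma lfD (f f' : series) : left_finite (fun g => f g + f' g).
Proof.
move=> r; have [s sP] := seriesP f r; have [s' sP'] := seriesP f' r.
exists (s ++ s') => g fg gr; rewrite mem_cat.
have [f0|f0] := eqVneq (f g) 0; last by rewrite sP.
by rewrite sP' ?orbT //; move: fg; rewrite f0 add0r.
Qed.

Lemma lfN (f : series) : left_finite (fun g => - f g).
Proof.
by move=> r; have [s sP] := seriesP f r; exists s => g; rewrite oppr_eq0; apply: sP.
Qed.

Definition szero := Series lf0.
Definition sadd f f' := Series (lfD f f').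
Definition sopp f := Series (lfN f).

Fact saddA : associative sadd.
Proof. by move=> a b c; apply: series_ext => g /=; rewrite addrA. Qed.
Fact saddC : commutative sadd.
Proof. by move=> a b; apply: series_ext => g /=; rewrite addrC. Qed.
Fact sadd0 : left_id szero sadd.
Proof. by move=> a; apply: series_ext => g /=; rewrite add0r. Qed.
Fact saddN : left_inverse szero sopp sadd.
Proof. by move=> a; apply: series_ext => g /=; rewrite addNr. Qed.

HB.instance Definition _ := GRing.isZmodule.Build series saddA saddC sadd0 saddN.

Lemma cfD (f f' : series) g : (f + f') g = f g + f' g. Proof. by []. Qed.
Lemma cfN (f : series) g : (- f) g = - f g. Proof. by []. Qed.
Lemma cfB (f f' : series) g : (f - f') g = f g - f' g. Proof. by []. Qed.
Lemma cf0 g : (0 : series) g = 0. Proof. by []. Qed.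

Lemma seq_min (s : seq expo) g : exists2 m, m \in g :: s & forall h, h \in g :: s -> ht m <= ht h.
Proof.
elim: s g => [|a s IHs] g; first by exists g; rewrite ?inE // => h; rewrite inE => /eqP->.
have [m ms mP] := IHs a; have [gm|mg] := leP (ht g) (ht m).
  exists g; rewrite ?inE ?eqxx // => h; rewrite inE => /orP[/eqP->//|/mP].
  exact: le_trans.
exists m; first by rewrite inE ms orbT.
by move=> h; rewrite inE => /orP[/eqP->|/mP//]; apply: ltW.
Qed.

Lemma series_min (f : series) : f != 0 ->
  exists2 m, f m != 0 & forall h, f h != 0 -> ht m <= ht h.
Proof.
move=> f0; have [g fg] : exists g, f g != 0.
  apply: contrapT => nex; case/eqP: f0; apply: series_ext => g /=.
  by apply/eqP; apply: contra_notT nex => fg; exists g.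
have [s sP] := seriesP f (ht g + 1).
have [m ms mP] := seq_min [seq h <- s | f h != 0] g.
have mem h : f h != 0 -> ht h < ht g + 1 -> h \in g :: [seq h <- s | f h != 0].
  by move=> fh hg; rewrite inE mem_filter fh sP ?orbT.
exists m.
  by move: ms; rewrite inE => /orP[/eqP->//|]; rewrite mem_filter => /andP[].
move=> h fh; have [hg|gh] := ltP (ht h) (ht g + 1); first exact: mP (mem _ fh hg).
apply: le_trans (mP g _) _; first by rewrite inE eqxx.
by apply: le_trans gh; rewrite lerDl.
Qed.

(** The value of [f] is at least [r], phrased so that 0 qualifies for every [r]. *)
Definition small r (f : series) : Prop := forall g, ht g < r -> f g = 0.

Lemma series_bound (f : series) : exists r, small r f.
Proof.
have [->|/series_min[m _ mP]] := eqVneq f 0; first by exists 0.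
by exists (ht m) => g gm; apply/eqP; apply: contraTT gm => /mP; rewrite leNgt.
Qed.

(* The coefficient of a product is a sum over finitely many exponents; any duplicate-free list
   containing the relevant ones may be used to compute it (convE). *)
Lemma conv_supp (f f' : series) g : exists s : seq expo,
  uniq s /\ forall a, f a != 0 -> f' (g - a) != 0 -> a \in s.
Proof.
have [r rP] := series_bound f'; have [s sP] := seriesP f (ht g - r + 1).
exists (undup s); split=> [|a fa fga]; first exact: undup_uniq.
rewrite mem_undup sP // -subr_gt0; have : r <= ht (g - a).
  by rewrite leNgt; apply: contra fga => /rP->.
rewrite htB; lra.
Qed.

Definition conv (f f' : series) g : k :=
  \sum_(a <- sval (cid (conv_supp f f' g))) f a * f' (g - a).

Lemma sum_seq_eq (F : expo -> k) (s s' : seq expo) : uniq s -> uniq s' ->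
  (forall a, F a != 0 -> (a \in s) && (a \in s')) ->
  \sum_(a <- s) F a = \sum_(a <- s') F a.
Proof.
move=> us us' sP; rewrite (bigID (fun a => F a == 0)) [RHS](bigID (fun a => F a == 0)) /=.
have z (t : seq expo) : \sum_(a <- t | F a == 0) F a = 0 by apply: big1 => a /eqP.
rewrite !z !add0r.
rewrite -[LHS]big_filter -[RHS]big_filter; apply: perm_big; apply: uniq_perm; rewrite ?filter_uniq //.
move=> a; rewrite !mem_filter; apply: andb_id2l => /sP.
by case/andP=> -> ->.
Qed.

Lemma convE (f f' : series) g (s : seq expo) : uniq s ->
  (forall a, f a != 0 -> f' (g - a) != 0 -> a \in s) ->
  conv f f' g = \sum_(a <- s) f a * f' (g - a).
Proof.
move=> us sP; rewrite /conv; case: cid => s' [us' sP'] /=; apply: sum_seq_eq => // a.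
by rewrite mulf_eq0 negb_or => /andP[fa fga]; rewrite sP ?sP'.
Qed.

Lemma conv_neq0 (f f' : series) g : conv f f' g != 0 ->
  exists a, f a != 0 /\ f' (g - a) != 0.
Proof.
move=> c0; apply: contrapT => nex; case/eqP: c0; rewrite (@convE _ _ _ [::]) ?big_nil //.
by move=> a fa fga; case: nex; exists a.
Qed.

Lemma lf_conv (f f' : series) : left_finite (conv f f').
Proof.
have [r rP] := series_bound f; have [r' rP'] := series_bound f' => b.
have [s sP] := seriesP f (b - r'); have [s' sP'] := seriesP f' (b - r).
exists [seq a + a' | a <- s, a' <- s'] => g /conv_neq0 [a [fa fga]] gb.
have ra : r <= ht a by rewrite leNgt; apply: contra fa => /rP->.
have ra' : r' <= ht (g - a) by rewrite leNgt; apply: contra fga => /rP'->.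
apply/allpairsP; exists (a, g - a); split=> /=; last by rewrite addrC subrK.
- by apply: sP => //; move: ra'; rewrite htB; lra.
- by apply: sP' => //; rewrite htB; lra.
Qed.

Definition smul f f' := Series (lf_conv f f').

Lemma lf1 : left_finite (fun g => (g == 0)%:R).
Proof. by exists [:: 0] => g; rewrite inE; case: (g =P 0) => // _; rewrite eqxx. Qed.
Definition sone := Series lf1.

Fact smulC : commutative smul.
Proof.
move=> a b; apply: series_ext => g /=; have [s [us sP]] := conv_supp a b g.
rewrite (convE us sP) (@convE b a g [seq g - x | x <- s]).
- rewrite big_map; apply: eq_bigr => x _; rewrite mulrC; congr (_ * _); congr (a _).
  by rewrite opprB addrC subrK.
- by rewrite map_inj_uniq // => x y /addrI/oppr_inj.
move=> x bx ax; apply/mapP; exists (g - x); last by rewrite opprB addrC subrK.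
by apply: sP => //; rewrite opprB addrC subrK.
Qed.

(** In this form both sides become one double sum over exponents of [a] and [b], up to the order of
    summation; associativity then follows from [smulC]. *)
Fact smulCA : left_commutative smul.
Proof.
move=> a b c; apply: series_ext => g /=.
have [ra raP] := series_bound a; have [rb rbP] := series_bound b.
have [rc rcP] := series_bound c.
have ge (f : series) r x : small r f -> f x != 0 -> r <= ht x.
  by move=> rP fx; rewrite leNgt; apply: contra fx => /rP->.
(* If [a x], [b z] and [c (g - x - z)] are all nonzero, then [ht x <= ht g - rb - rc]; the margin 1
   makes the inequality strict. *)
have [s sP] := seriesP a (ht g - rb - rc + 1).
have [t tP] := seriesP b (ht g - ra - rc + 1).
have gs x z : b z != 0 -> c (g - x - z) != 0 -> ht x < ht g - rb - rc + 1.
  by move=> /(ge _ _ _ rbP) bz /(ge _ _ _ rcP); rewrite !htB; lra.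
have gt x z : a x != 0 -> c (g - x - z) != 0 -> ht z < ht g - ra - rc + 1.
  by move=> /(ge _ _ _ raP) bz /(ge _ _ _ rcP); rewrite !htB; lra.
rewrite (@convE _ _ _ (undup s)) ?undup_uniq //; last first.
  move=> x ax /= /conv_neq0 [z [bz cz]]; rewrite mem_undup; apply: sP => //.
  exact: gs bz cz.
rewrite (@convE _ _ _ (undup t)) ?undup_uniq //; last first.
  move=> z bz /= /conv_neq0 [x [ax cz]]; rewrite mem_undup; apply: tP => //.
  by apply: gt ax _; rewrite addrAC; exact: cz.
have -> : \sum_(x <- undup s) a x * smul b c (g - x) =
  \sum_(x <- undup s) \sum_(z <- undup t) a x * (b z * c (g - x - z)).
  apply: eq_bigr => x _; have [->|ax] := eqVneq (a x) 0.
    by rewrite mul0r big1 // => z _; rewrite mul0r.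
  rewrite -mulr_sumr; congr (_ * _); apply: convE; rewrite ?undup_uniq // => z bz cz.
  by rewrite mem_undup tP //; exact: gt ax cz.
rewrite exchange_big; apply: eq_bigr => z _ /=; have [->|bz] := eqVneq (b z) 0.
  by rewrite mul0r big1 // => x _; rewrite mul0r mulr0.
rewrite (eq_bigr (fun x => b z * (a x * c (g - z - x)))) => [|x _]; last first.
  by rewrite mulrCA addrAC.
rewrite -mulr_sumr; congr (_ * _); symmetry; apply: convE; rewrite ?undup_uniq // => x ax cz.
by rewrite mem_undup sP //; apply: gs bz _; rewrite addrAC; exact: cz.
Qed.

Fact smulA : associative smul.
Proof. by move=> a b c; rewrite (smulC b c) smulCA (smulC _ c). Qed.

Fact smul1 : left_id sone smul.
Proof.
move=> a; apply: series_ext => g /=; rewrite (@convE _ _ _ [:: 0]) //.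
  by rewrite big_seq1 /= mul1r subr0.
by move=> x /=; rewrite inE; case: (x =P 0) => // _; rewrite eqxx.
Qed.

Fact smulDl : left_distributive smul sadd.
Proof.
move=> a b c; apply: series_ext => g /=.
have [s [us sP]] := conv_supp a c g; have [t [ut tP]] := conv_supp b c g.
rewrite !(@convE _ _ _ (undup (s ++ t))) ?undup_uniq //.
- by rewrite -big_split; apply: eq_bigr => x _; rewrite mulrDl.
- by move=> x bx cx; rewrite mem_undup mem_cat tP ?orbT.
- by move=> x bx cx; rewrite mem_undup mem_cat sP.
move=> x abx cx; rewrite mem_undup mem_cat.
have [a0|ax] := eqVneq (a x) 0; last by rewrite sP.
by move: abx; rewrite /= a0 add0r => bx; rewrite tP ?orbT.
Qed.

Fact sone_neq0 : sone != 0 :> series.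
Proof. by apply/eqP=> /(congr1 (fun f : series => f 0)) /= /eqP; rewrite oner_eq0. Qed.

HB.instance Definition _ :=
  GRing.Zmodule_isComNzRing.Build series smulA smulC smul1 smulDl sone_neq0.

Lemma cfM (f f' : series) g (s : seq expo) : uniq s ->
  (forall a, f a != 0 -> f' (g - a) != 0 -> a \in s) ->
  (f * f') g = \sum_(a <- s) f a * f' (g - a).
Proof. exact: convE. Qed.

Lemma cfM_neq0 (f f' : series) g : (f * f') g != 0 ->
  exists a, f a != 0 /\ f' (g - a) != 0.
Proof. exact: conv_neq0. Qed.

Lemma cf1 g : (1 : series) g = (g == 0)%:R. Proof. by []. Qed.

Lemma small0 r : small r 0. Proof. by []. Qed.

Lemma smallD r f f' : small r f -> small r f' -> small r (f + f').
Proof. by move=> fr fr' g gr; rewrite cfD fr // fr' // addr0. Qed.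

Lemma smallN r f : small r f -> small r (- f).
Proof. by move=> fr g gr; rewrite cfN fr // oppr0. Qed.

Lemma smallB r f f' : small r f -> small r f' -> small r (f - f').
Proof. by move=> fr fr'; apply: smallD => //; apply: smallN. Qed.

Lemma small_le r s f : s <= r -> small r f -> small s f.
Proof. by move=> sr fr g gs; apply: fr; apply: lt_le_trans sr. Qed.

Lemma smallM r s f f' : small r f -> small s f' -> small (r + s) (f * f').
Proof.
move=> fr fs g gr; apply/eqP; apply: contraTT gr => /cfM_neq0 [a [fa fga]].
have ra : r <= ht a by rewrite leNgt; apply: contra fa => /fr->.
have ra' : s <= ht (g - a) by rewrite leNgt; apply: contra fga => /fs->.
by move: ra'; rewrite htB -leNgt; lra.
Qed.

Lemma small_sum r (I : Type) (t : seq I) (P : pred I) (F : I -> series) :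
  (forall i, P i -> small r (F i)) -> small r (\sum_(i <- t | P i) F i).
Proof. by move=> FP; apply: (big_ind (small r)) => // x y; apply: smallD. Qed.

(** The heights are archimedean, so a nonzero series cannot have arbitrarily large value. Equations
    between limits are proved through this. *)
Lemma small_all f : (forall n : nat, small n%:R f) -> f = 0.
Proof.
move=> fP; apply: series_ext => g; rewrite cf0.
have := archi_boundP (normr_ge0 (ht g)) => gb.
by apply: (fP (Num.bound `|ht g|)); apply: le_lt_trans gb; rewrite ler_norm.
Qed.

(* Completeness: a sequence whose successive differences have valuation >= n e
   stabilises coefficientwise. *)
Lemma series_lim (e : realalg) (x : nat -> series) : 0 < e ->
  (forall n, small (n%:R * e) (x n.+1 - x n)) ->
  exists y, forall n, small (n%:R * e) (y - x n).
Proof.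
move=> e0 xP.
have xE n m g : (n <= m)%N -> ht g < n%:R * e -> x m g = x n g.
  move=> nm gn; rewrite -(subnKC nm); elim: (m - n)%N => [|j IHj]; first by rewrite addn0.
  rewrite addnS -IHj; apply/eqP; rewrite -subr_eq0 -cfB xP //.
  by apply: lt_le_trans gn _; rewrite ler_pM2r // ler_nat leq_addr.
(* An index from which the coefficient at [g] no longer changes; the limit reads it there. *)
pose N g := Num.bound `|ht g / e|.
have NP g : ht g < (N g)%:R * e.
  by rewrite -ltr_pdivrMr //; apply: le_lt_trans (ler_norm _) (archi_boundP (normr_ge0 _)).
have yE n g : ht g < n%:R * e -> x (N g) g = x n g.
  move=> gn; have [Nn|/ltnW nN] := leqP (N g) n; first by rewrite (xE (N g) n).
  by rewrite (xE n (N g)).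
have yP : left_finite (fun g => x (N g) g).
  move=> r; pose n := Num.bound `|r / e|.
  have nP : r < n%:R * e.
    by rewrite -ltr_pdivrMr //; apply: le_lt_trans (ler_norm _) (archi_boundP (normr_ge0 _)).
  have [s sP] := seriesP (x n) r; exists s => g gx gr; apply: sP => //.
  by rewrite -(@yE n) //; apply: lt_trans nP.
by exists (Series yP) => n g gn; rewrite cfB /= (@yE n) // subrr.
Qed.

(** * The valuation, monomials and inverses *)

Implicit Types f : series.

(** The valuation takes its values in Q^2 rather than in the reals, so that divisibility by 3 and
    membership in Z_(3)^2 can be read off; the value at 0 is a default. *)
Definition vl (f : series) : expo :=
  if pselect (f != 0) is left f0 then s2val (cid2 (series_min f0)) else 0.

Lemma vlP f : f != 0 -> f (vl f) != 0 /\ forall h, f h != 0 -> ht (vl f) <= ht h.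
Proof. by rewrite /vl => f0; case: pselect => // f0'; case: cid2. Qed.

Lemma vl_lead f : f != 0 -> f (vl f) != 0. Proof. by case/vlP. Qed.
Lemma vl_min f h : f h != 0 -> ht (vl f) <= ht h.
Proof.
move=> fh; have /vlP[_] : f != 0 by apply: contra_neq fh => ->.
by apply.
Qed.
Lemma small_vl f : small (ht (vl f)) f.
Proof. by move=> g; apply: contraTeq => /vl_min; rewrite leNgt. Qed.

Lemma vl_uniq f m : f m != 0 -> (forall h, f h != 0 -> ht m <= ht h) -> vl f = m.
Proof.
move=> fm mP; have f0 : f != 0 by apply: contra_neq fm => ->.
by apply: ht_inj; apply/eqP; rewrite eq_le vl_min //= mP // vl_lead.
Qed.

Lemma cfM_vl f f' : f != 0 -> f' != 0 ->
  (f * f') (vl f + vl f') = f (vl f) * f' (vl f').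
Proof.
move=> f0 f0'; rewrite (@cfM _ _ _ [:: vl f]) //.
  by rewrite big_seq1 addrC addKr.
move=> a /vl_min fa /vl_min; rewrite htB htD inE => fa'.
by apply/eqP/ht_inj/eqP; rewrite eq_le fa andbT; move: fa'; lra.
Qed.

Lemma vlM f f' : f != 0 -> f' != 0 -> vl (f * f') = vl f + vl f'.
Proof.
move=> f0 f0'; apply: vl_uniq; first by rewrite cfM_vl // mulf_neq0 // vl_lead.
move=> h /cfM_neq0 [a [/vl_min fa /vl_min]]; rewrite htB htD; lra.
Qed.

Lemma lf_mono (c : k) g : left_finite (fun h => if h == g then c else 0).
Proof. by exists [:: g] => h; rewrite inE; case: (h =P g) => // _; rewrite eqxx. Qed.
Definition mono c g : series := Series (lf_mono c g).

Lemma monoE c g h : mono c g h = if h == g then c else 0. Proof. by []. Qed.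

Lemma cf_monoM c g f h : (mono c g * f) h = c * f (h - g).
Proof.
rewrite (@cfM _ _ _ [:: g]) //; first by rewrite big_seq1 monoE eqxx.
by move=> x; rewrite monoE inE; case: (x =P g) => // _; rewrite eqxx.
Qed.

Lemma monoM c d g h : mono c g * mono d h = mono (c * d) (g + h).
Proof.
apply: series_ext => x; rewrite cf_monoM !monoE subr_eq (addrC h g).
by case: eqP; rewrite ?mulr0.
Qed.

Lemma mono1 : mono 1 0 = 1.
Proof. by apply: series_ext => x; rewrite monoE cf1; case: eqP. Qed.

Lemma mono_neq0 c g : c != 0 -> mono c g != 0.
Proof. by move=> c0; apply: contra_neq c0 => /(congr1 (fun f : series => f g)); rewrite monoE eqxx. Qed.

Lemma vl_mono c g : c != 0 -> vl (mono c g) = g.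
Proof.
move=> c0; apply: vl_uniq => [|h]; first by rewrite monoE eqxx.
by rewrite monoE; case: (h =P g) => [->|_]; rewrite ?eqxx.
Qed.

Lemma vl_gt0_small f : (forall h, f h != 0 -> 0 < ht h) -> exists2 e, 0 < e & small e f.
Proof.
move=> fP; have [->|f0] := eqVneq f 0; first by exists 1.
by exists (ht (vl f)); [apply/fP/vl_lead | apply: small_vl].
Qed.

(** The geometric series of [m], obtained as the fixed point of a contraction because [m] has
    positive value. *)
Lemma geometric (m : series) : (forall h, m h != 0 -> 0 < ht h) -> exists x, x = 1 + m * x.
Proof.
move=> mP; have [e e0 me] := vl_gt0_small mP.
pose x := fix x n := if n is n'.+1 then 1 + m * x n' else 0.
have xP n : small (n%:R * e) (x n.+1 - x n).
  elim: n => [|n IHn] /=.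
    rewrite mul0r mulr0 addr0 subr0 => g g0; rewrite cf1; case: eqP => // gz.
    by move: g0; rewrite gz ht0 ltxx.
  rewrite opprD addrACA subrr add0r -mulrBr mulrS mulrDl mul1r; exact: smallM.
have [y yP] := series_lim e0 xP; exists y; apply/eqP; rewrite -subr_eq0; apply/eqP.
apply: small_all => n; have [j jn] : exists j, n%:R <= j%:R * e.
  exists (Num.bound `|n%:R / e|); rewrite -ler_pdivrMr //; apply: ltW.
  by apply: le_lt_trans (ler_norm _) (archi_boundP (normr_ge0 _)).
apply: small_le jn _.
have -> : y - (1 + m * y) = (y - x j.+1) - m * (y - x j).
  by rewrite /=; ring.
apply: smallB.
  by apply: small_le (yP j.+1); rewrite ler_pM2r // ler_nat.
have : small (e + j%:R * e) (m * (y - x j)) by apply: smallM.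
by apply: small_le; rewrite lerDr ltW.
Qed.

(** Multiplication by the inverse [c] of the leading monomial turns [f] into [1 - m] with [m] of
    positive value. *)
Lemma series_inv f : exists f', f <> 0 -> f' * f = 1.
Proof.
have [f0|f0] := eqVneq f 0; first by exists 0.
pose c := mono (f (vl f))^-1 (- vl f).
pose m := 1 - c * f.
have mP h : m h != 0 -> 0 < ht h.
  rewrite /m cfB cf1 cf_monoM opprK; have [->|h0] := eqVneq h 0.
    by rewrite add0r mulVf ?subrr ?eqxx // vl_lead.
  rewrite sub0r oppr_eq0 mulf_eq0 negb_or => /andP[_ /vl_min]; rewrite htD => hv.
  rewrite lt_def; apply/andP; split; last by move: hv; lra.
  by apply: contra_neq h0; apply: ht_eq0.
have [x xE] := geometric mP; exists (x * c) => _; rewrite -mulrA mulrC.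
have : x * (1 - m) = 1 by rewrite mulrBr mulr1 [in X in X - _]xE mulrC addrK.
by rewrite mulrC /m opprB addrC subrK.
Qed.

Definition sinv (f : series) : series :=
  if f == 0 then 0 else sval (cid (series_inv f)).

Fact smulVf f : f != 0 -> sinv f * f = 1.
Proof. by move=> f0; rewrite /sinv (negPf f0); case: cid => g /=; apply; apply/eqP. Qed.

Fact sinv0 : sinv 0 = 0.
Proof. by rewrite /sinv eqxx. Qed.

HB.instance Definition _ := GRing.ComNzRing_isField.Build series smulVf sinv0.

End Series.

(** * The series field is algebraically closed *)

Section Constants.
Variable k : fieldType.
Implicit Types (f : series k) (r s : realalg) (p q : {poly series k}).

Lemma vl1 : vl (1 : series k) = 0.
Proof. by rewrite -mono1 vl_mono ?oner_eq0. Qed.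

Lemma vlX f n : f != 0 -> vl (f ^+ n) = vl f *+ n.
Proof.
move=> f0; elim: n => [|n IHn]; first by rewrite expr0 vl1.
by rewrite exprS vlM ?expf_neq0 // IHn mulrS.
Qed.

Lemma vlV f : f != 0 -> vl f^-1 = - vl f.
Proof.
move=> f0; apply/eqP; rewrite eq_sym eqr_oppLR -subr_eq0 opprK.
by rewrite addrC -vlM ?invr_eq0 // mulVf // vl1.
Qed.

Definition cst (c : k) : series k := mono c 0.

Lemma cstE c g : cst c g = if g == 0 then c else 0. Proof. by []. Qed.

Fact cst_additive : zmod_morphism cst.
Proof.
by move=> a b; apply: series_ext => g; rewrite cfB !cstE; case: eqP => _; rewrite ?subr0.
Qed.
Fact cst_multiplicative : monoid_morphism cst.
Proof. by split=> [|a b]; rewrite /cst ?mono1 // monoM addr0. Qed.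
HB.instance Definition _ := GRing.isZmodMorphism.Build _ _ cst cst_additive.
HB.instance Definition _ := GRing.isMonoidMorphism.Build _ _ cst cst_multiplicative.

Lemma small_cst c : small 0 (cst c).
Proof. by move=> g g0; rewrite cstE; case: eqP g0 => // ->; rewrite ht0 ltxx. Qed.

(** The residue field of the valuation ring [small 0] is the field of constants, and the coefficient
    at 0 is the residue. *)
Lemma small_residue f : small 0 f -> exists2 e, 0 < e & small e (f - cst (f 0)).
Proof.
move=> f0; apply: vl_gt0_small => h; rewrite cfB cstE.
case: (h =P 0) => [->|h0]; first by rewrite subrr eqxx.
rewrite subr0 lt_def => fh; apply/andP; split.
  by apply/eqP => /ht_eq0.
by rewrite leNgt; apply: contra fh => /f0->.
Qed.

(** The Gauss valuation of [p] is at least [r]. *)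
Definition psmall r p := forall i, small r p`_i.

Lemma psmallD r p q : psmall r p -> psmall r q -> psmall r (p + q).
Proof. by move=> pr qr i; rewrite coefD; apply: smallD. Qed.
Lemma psmallB r p q : psmall r p -> psmall r q -> psmall r (p - q).
Proof. by move=> pr qr i; rewrite coefB; apply: smallB. Qed.
Lemma psmall_le r s p : s <= r -> psmall r p -> psmall s p.
Proof. by move=> sr pr i; apply: small_le sr _. Qed.
Lemma psmallM r s p q : psmall r p -> psmall s q -> psmall (r + s) (p * q).
Proof. by move=> pr qs i; rewrite coefM; apply: small_sum => j _; apply: smallM. Qed.
Lemma psmall_cst (p : {poly k}) : psmall 0 (map_poly cst p).
Proof. by move=> i; rewrite coef_map; apply: small_cst. Qed.
Lemma psmallMr r p (q : {poly k}) : psmall r p -> psmall r (p * map_poly cst q).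
Proof. by move=> pr; rewrite -[r]addr0; apply: psmallM => //; apply: psmall_cst. Qed.
Lemma psmall_all p : (forall n : nat, psmall n%:R p) -> p = 0.
Proof. by move=> pP; apply/polyP => i; rewrite coef0; apply: small_all => n; apply: pP. Qed.

(** Division by [g] is linear, and the quotients of the powers of X by [g] have constant
    coefficients. *)
Lemma psmall_divp r p (g : {poly k}) : psmall r p -> psmall r (p %/ map_poly cst g).
Proof.
move=> pr; rewrite -[p]coefK poly_def => i.
rewrite (big_morph (fun q => q %/ _) (divpD _) (div0p _)) coef_sum.
apply: small_sum => j _; rewrite divpZl -(map_polyXn (@cst)) -map_divp coefZ coef_map /=.
by rewrite -[r]addr0; apply: smallM => //; apply: small_cst.
Qed.

Lemma psmall_uniform p : (forall i, exists2 e, 0 < e & small e p`_i) ->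
  exists2 e, 0 < e & psmall e p.
Proof.
move=> pP; suff H N : exists2 e, 0 < e & forall i, (i < N)%N -> small e p`_i.
  have [e e0 eP] := H (size p); exists e => // i.
  by have [/eP//|ip] := ltnP i (size p); rewrite nth_default //; apply: small0.
elim: N => [|N [e e0 eP]]; first by exists 1.
have [e' e0' eP'] := pP N; exists (Num.min e e'); first by rewrite lt_min e0.
move=> i; rewrite ltnS leq_eqVlt => /orP[/eqP->|/eP iN].
  by apply: small_le eP'; rewrite ge_min lexx orbT.
by apply: small_le iN; rewrite ge_min lexx.
Qed.

Lemma poly_lim (e : realalg) (m : nat) (x : nat -> {poly series k}) : 0 < e ->
  (forall n, size (x n) <= m)%N ->
  (forall n, psmall (n%:R * e) (x n.+1 - x n)) ->
  exists y : {poly series k}, (size y <= m)%N /\ forall n, psmall (n%:R * e) (y - x n).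
Proof.
move=> e0 sx xP.
have lim i : exists y : series k, forall n, small (n%:R * e) (y - (x n)`_i).
  by apply: series_lim => // n; rewrite -coefB; apply: xP.
pose F i := sval (cid (lim i)); exists (\poly_(i < m) F i).
split=> [|n i]; first exact: size_poly.
rewrite coefB coef_poly; case: ltnP => im; first by rewrite /F; case: cid.
by rewrite nth_default ?subrr //; apply: leq_trans im.
Qed.

Lemma archi_mul (e : realalg) (n : nat) : 0 < e -> exists j, n%:R <= j%:R * e.
Proof.
move=> e0; exists (Num.bound `|n%:R / e|); rewrite -ler_pdivrMr //; apply: ltW.
by apply: le_lt_trans (ler_norm _) (archi_boundP (normr_ge0 _)).
Qed.

(* The corrections (a, b) to the constant factorisation solve a h0 + b g0 = e - a b; the left-hand
   side is inverted by a Bezout relation, and the right-hand side is a contraction. *)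
Lemma hensel (g0 h0 : {poly k}) (e : {poly series k}) (eps : realalg) :
  g0 \is monic -> h0 \is monic -> coprimep g0 h0 -> 0 < eps -> psmall eps e ->
  (size e <= (size g0).-1 + (size h0).-1)%N ->
  exists a b : {poly series k}, [/\ (size a < size g0)%N, (size b < size h0)%N &
    (map_poly cst g0 + a) * (map_poly cst h0 + b) = map_poly cst (g0 * h0) + e].
Proof.
move=> mg mh /Bezout_eq1_coprimepP[[u v] /= uv] eps0 es se.
have sg0 : (0 < size g0)%N by rewrite lt0n size_poly_eq0 monic_neq0.
have sh0 : (0 < size h0)%N by rewrite lt0n size_poly_eq0 monic_neq0.
pose i := map_poly cst.
have mig : i g0 \is monic by rewrite map_monic.
have UV : i u * i g0 + i v * i h0 = 1 by rewrite -!rmorphM -rmorphD /= uv rmorph1.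
(* [A w] is [w * i v] reduced modulo [i g0], hence of lower degree; [B w] takes up the quotient, so
   that [A w * i h0 + B w * i g0 = w] is kept. *)
pose Q (w : {poly series k}) : {poly series k} := (w * i v) %/ i g0.
pose A (w : {poly series k}) : {poly series k} := w * i v - Q w * i g0.
pose B (w : {poly series k}) : {poly series k} := w * i u + Q w * i h0.
have AE w : A w = (w * i v) %% i g0.
  by rewrite /A {1}(divp_eq (w * i v) (i g0)) addrC addKr.
have QB w w' : Q (w - w') = Q w - Q w' by rewrite /Q mulrBl divpD divpN.
have AB w w' : A (w - w') = A w - A w' by rewrite /A QB; ring.
have BB w w' : B (w - w') = B w - B w' by rewrite /B QB; ring.
have Qs r w : psmall r w -> psmall r (Q w).
  by move=> wr; apply: psmall_divp; apply: psmallMr.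
have As r w : psmall r w -> psmall r (A w).
  by move=> wr; apply: psmallB; apply: psmallMr => //; apply: Qs.
have Bs r w : psmall r w -> psmall r (B w).
  by move=> wr; apply: psmallD; apply: psmallMr => //; apply: Qs.
have ABE w : A w * i h0 + B w * i g0 = w.
  by rewrite -[RHS]mulr1 -UV /A /B; ring.
have sA w : (size (A w) <= (size g0).-1)%N.
  by rewrite AE -ltnS prednK // -(size_map_poly cst) ltn_modp monic_neq0.
have sB (w : {poly series k}) : (size w <= (size g0).-1 + (size h0).-1)%N -> (size (B w) <= (size h0).-1)%N.
  move=> sw; have [->|B0] := eqVneq (B w) 0; first by rewrite size_poly0.
  have : (size (B w * i g0)%R <= (size g0).-1 + (size h0).-1)%N.
    rewrite (_ : B w * i g0 = w - A w * i h0); last by rewrite -{2}(ABE w) addrC addKr.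
    rewrite (leq_trans (size_polyD _ _)) // size_polyN geq_max sw.
    have [->|A0] := eqVneq (A w) 0; first by rewrite mul0r size_poly0.
    rewrite size_Mmonic ?map_monic // size_map_poly -(prednK sh0) addnS /=.
    by rewrite leq_add2r.
  rewrite size_Mmonic // size_map_poly -(prednK sg0) addnS /= addnC.
  by rewrite leq_add2l.
pose x := fix x n := if n is n'.+1 then
   (A (e - (x n').1 * (x n').2), B (e - (x n').1 * (x n').2)) else (0, 0).
pose a n := (x n).1; pose b n := (x n).2.
have aS n : a n.+1 = A (e - a n * b n) by [].
have bS n : b n.+1 = B (e - a n * b n) by [].
have ab0 r : psmall r (0 : {poly series k}) by move=> j; rewrite coef0; apply: small0.
have xs n : psmall eps (a n) /\ psmall eps (b n).
  elim: n => [|n [an bn]]; first by split.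
  have : psmall eps (e - a n * b n).
    by apply: psmallB => //; apply: psmall_le (psmallM an bn); rewrite lerDl ltW.
  by rewrite aS bS; split; [apply: As | apply: Bs].
have sx n : (size (a n) <= (size g0).-1)%N /\ (size (b n) <= (size h0).-1)%N.
  elim: n => [|n [an bn]]; first by rewrite /a /b /= size_poly0.
  rewrite aS bS; split; [exact: sA | apply: sB].
  rewrite (leq_trans (size_polyD _ _)) // size_polyN geq_max se.
  apply: (leq_trans (size_polyMleq _ _)); rewrite -subn1 leq_subLR.
  by rewrite (leq_trans (leq_add an bn)) // leqDr.
have dx n : psmall (n%:R * eps) (a n.+1 - a n) /\ psmall (n%:R * eps) (b n.+1 - b n).
  elim: n => [|n [da db]].
    rewrite mul0r /a /b [x 0%N]/= !subr0; split; apply: psmall_le (ltW eps0) _.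
      by have [] := xs 1%N. by have [] := xs 1%N.
  have : psmall (n.+1%:R * eps) ((e - a n.+1 * b n.+1) - (e - a n * b n)).
    have -> : (e - a n.+1 * b n.+1) - (e - a n * b n) =
      0 - ((a n.+1 - a n) * b n.+1 + a n * (b n.+1 - b n)) by ring.
    apply: psmallB => //; rewrite mulrS mulrDl mul1r; apply: psmallD.
      by rewrite addrC; apply: psmallM => //; have [] := xs n.+1.
    by apply: psmallM => //; have [] := xs n.
  by move=> d; rewrite (aS n.+1) (bS n.+1) (aS n) (bS n) -AB -BB; split; [apply: As|apply: Bs].
have [a' [sa aP]] := poly_lim eps0 (fun n => (sx n).1) (fun n => (dx n).1).
have [b' [sb bP]] := poly_lim eps0 (fun n => (sx n).2) (fun n => (dx n).2).
exists a', b'; split.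
- by rewrite -ltnS prednK in sa.
- by rewrite -ltnS prednK in sb.
apply/eqP; rewrite -subr_eq0; apply/eqP; apply: psmall_all => n.
have [j jn] := archi_mul n eps0; apply: psmall_le jn _.
rewrite rmorphM /= -/i.
(* The linear terms use the iterate [j.+1] and the product the iterate [j], because the former
   solves the linear equation whose right-hand side contains the latter. *)
have -> : (i g0 + a') * (i h0 + b') - (i g0 * i h0 + e) =
   (a' - a j.+1) * i h0 + (b' - b j.+1) * i g0 + ((a' - a j) * b' + a j * (b' - b j)).
  have := ABE (e - a j * b j); rewrite -aS -bS => E.
  have -> : e = a j * b j + (a j.+1 * i h0 + b j.+1 * i g0) by rewrite E addrC subrK.
  by ring.
have jj : j%:R * eps <= j.+1%:R * eps by rewrite ler_pM2r // ler_nat.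
apply: psmallD; apply: psmallD.
- by apply: psmallMr; apply: psmall_le jj _.
- by apply: psmallMr; apply: psmall_le jj _.
- rewrite -[X in psmall X]addr0; apply: psmallM => //.
  rewrite -[b'](subrK (b 0%N)) subrK -[b']subr0; have := bP 0%N; rewrite mul0r; exact.
rewrite -[X in psmall X]add0r; apply: psmallM => //.
by apply: psmall_le (ltW eps0) _; have [] := xs j.
Qed.

End Constants.

Section Closed.
Variable k : numClosedFieldType.

Lemma coef_XsubC_exp (F : fieldType) (c : F) n : (('X - c%:P) ^+ n.+1)`_n = - c *+ n.+1.
Proof.
elim: n => [|n IHn]; first by rewrite expr1 coefB coefX coefC sub0r.
rewrite exprS mulrBl coefB coefXM coefCM /= IHn.
have /monicP : ('X - c%:P) ^+ n.+1 \is monic by rewrite monic_exp ?monicXsubC.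
by rewrite lead_coefE size_exp_XsubC /= => ->; rewrite mulr1 [RHS]mulrSr.
Qed.

Lemma coef_shift (F : fieldType) (p : {poly F}) (c : F) n : p \is monic -> size p = n.+2 ->
  (p \Po ('X - c%:P))`_n = p`_n - c *+ n.+1.
Proof.
move=> mp sp; have lp : p`_n.+1 = 1 by move/monicP: mp; rewrite lead_coefE sp.
rewrite coef_comp_poly sp !big_ord_recr /= big1 => [|i _]; last first.
  have -> : (('X - c%:P) ^+ i)`_n = 0 by rewrite nth_default // size_exp_XsubC ltn_ord.
  by rewrite mulr0.
rewrite coef_XsubC_exp lp add0r mul1r mulNrn.
have /monicP : ('X - c%:P) ^+ n \is monic by rewrite monic_exp ?monicXsubC.
by rewrite lead_coefE size_exp_XsubC /= => ->; rewrite mulr1.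
Qed.

(** Newton-Puiseux argument by induction on the degree: once the subleading coefficient is killed
    and the variable rescaled, the residue polynomial has two distinct roots, so it is a product of
    coprime factors that lift by [hensel]. *)
Lemma series_root_monic n (p : {poly series k}) : p \is monic -> size p = n.+2 ->
  exists x, root p x.
Proof.
elim/ltn_ind: n p => -[_|n IHn] p mp sp.
  exists (- p`_0); rewrite /root horner_coef sp !big_ord_recl big_ord0 /= expr0 mulr1 addr0.
  by move/monicP: mp; rewrite lead_coefE sp /= => ->; rewrite mul1r expr1 subrr.
(* Tschirnhaus shift: in characteristic 0 it removes the subleading coefficient. *)
pose c := p`_n.+1 / n.+2%:R; pose q := p \Po ('X - c%:P).
have n0 : n.+2%:R != 0 :> series k.
  by rewrite -(rmorph_nat (@cst k)) fmorph_eq0 pnatr_eq0.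
suff [x qx] : exists x, root q x.
  by exists (x - c); move: qx; rewrite /root horner_comp !hornerE.
have sq : size q = n.+3 by rewrite size_comp_poly2 ?size_XsubC.
have mq : q \is monic.
  by apply/monicP; rewrite lead_coef_comp ?size_XsubC // lead_coefXsubC expr1n (monicP mp) mulr1.
have qn1 : q`_n.+1 = 0.
  by rewrite coef_shift // -mulr_natr divfK // subrr.
have lq : q`_n.+2 = 1 by move/monicP: mq; rewrite lead_coefE sq.
have [/existsP[i0 qi0]|/existsPn q0] := boolP [exists i : 'I_n.+1, q`_i != 0]; last first.
  exists 0; rewrite /root horner_coef0; have := q0 ord0; rewrite negbK //.
(* Slopes from the point [i] of the Newton polygon to its leading end. For the least slope [d],
   rescaling by [t] gives every coefficient value at least 0, with equality at [j0]. *)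
pose sl i := scale_expo (n.+2 - i)%:R^-1 (vl q`_i).
have [d] := seq_min [seq sl i | i <- iota 0 n.+1 & q`_i != 0] (sl i0).
rewrite inE => dI dmin.
have {dI} [j0 [jn qj dE]] : exists j, [/\ (j < n.+1)%N, q`_j != 0 & d = sl j].
  case/orP: dI => [/eqP->|/mapP[j]]; first by exists i0.
  by rewrite mem_filter mem_iota add0n => /andP[qj jn] ->; exists j.
have {}dmin i : (i < n.+1)%N -> q`_i != 0 -> ht d <= ht (sl i).
  move=> ni qi; apply: dmin; rewrite inE; apply/orP; right; apply/mapP; exists i => //.
  by rewrite mem_filter qi mem_iota.
have htsl i : (i < n.+2)%N -> (n.+2 - i)%:R * ht (sl i) = ht (vl q`_i).
  move=> ni; rewrite htZ fmorphV rmorph_nat mulrA mulfV ?mul1r //.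
  by rewrite pnatr_eq0 subn_eq0 -ltnNge.
pose t : series k := mono 1 d; have t0 : t != 0 by apply: mono_neq0; apply: oner_neq0.
have vt : vl t = d by rewrite vl_mono ?oner_neq0.
pose r := \poly_(i < n.+3) (q`_i * t ^+ i / t ^+ n.+2).
have rE i : (i < n.+3)%N -> r`_i = q`_i * t ^+ i / t ^+ n.+2 by move=> ni; rewrite coef_poly ni.
have vr i : (i < n.+3)%N -> q`_i != 0 ->
    ht (vl r`_i) = ht (vl q`_i) - (n.+2 - i)%:R * ht d.
  move=> ni qi; rewrite rE // !vlM ?mulf_neq0 ?invr_eq0 ?expf_neq0 // vlV ?expf_neq0 //.
  rewrite !vlX // vt htB htD !htMn natrB // -!(mulr_natl (ht d)); ring.
have lr : r`_n.+2 = 1 by rewrite rE // lq mul1r mulfV // expf_neq0.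
have sr : size r = n.+3.
  apply/eqP; rewrite eqn_leq size_poly ltnNge; apply/negP => sr.
  by have /eqP := oner_neq0 (series k); rewrite -lr nth_default // => /(_ erefl).
have rs i : small 0 r`_i.
  have [ni|ni] := ltnP i n.+3; last by rewrite nth_default ?sr //; apply: small0.
  have [qi|qi] := eqVneq q`_i 0; first by rewrite rE // qi !mul0r; apply: small0.
  apply: small_le (@small_vl _ _); rewrite vr //.
  move: ni; rewrite ltnS leq_eqVlt => /orP[/eqP->|]; first by rewrite lq vl1 ht0 subnn mul0r subr0.
  rewrite ltnS leq_eqVlt => /orP[/eqP iE|ni]; first by rewrite iE qn1 eqxx in qi.
  by rewrite -(htsl _ (ltnW ni : (i < n.+2)%N)) subr_ge0 ler_wpM2l ?ler0n ?dmin.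
suff [y ry] : exists y, root r y.
  exists (t * y); move: ry; rewrite /root horner_poly horner_coef sq => /eqP ry.
  have -> : \sum_(i < n.+3) q`_i * (t * y) ^+ i =
      t ^+ n.+2 * \sum_(i < n.+3) q`_i * t ^+ i / t ^+ n.+2 * y ^+ i.
    rewrite mulr_sumr; apply: eq_bigr => i _; rewrite exprMn.
    by field; exact: expf_neq0.
  by rewrite ry mulr0.
pose rb := \poly_(i < n.+3) (r`_i 0).
have rbE i : rb`_i = r`_i 0.
  rewrite coef_poly; case: ltnP => // ni; by rewrite nth_default ?sr.
have lrb : rb`_n.+2 = 1 by rewrite rbE lr.
have srb : size rb = n.+3.
  apply/eqP; rewrite eqn_leq size_poly ltnNge; apply/negP => srb.
  by have /eqP := oner_neq0 k; rewrite -lrb nth_default // => /(_ erefl).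
have mrb : rb \is monic by apply/monicP; rewrite lead_coefE srb.
have rbn1 : rb`_n.+1 = 0 by rewrite rbE rE // qn1 !mul0r.
have rbj : rb`_j0 != 0.
  have jn3 : (j0 < n.+3)%N by apply: leq_trans jn _; rewrite -addn2 leq_addr.
  rewrite rbE; have <- : vl r`_j0 = 0.
    by apply: ht_eq0; rewrite vr // dE (htsl _ (ltnW jn : (j0 < n.+2)%N)) subrr.
  by apply: vl_lead; rewrite rE // !mulf_neq0 ?invr_eq0 ?expf_neq0.
have [c' rbc] : exists x, root rb x by apply/closed_rootP; rewrite srb.
have [m [h hc rbh]] := multiplicity_XsubC rb c'.
move: hc; rewrite (monic_neq0 mrb) /= => hc.
pose g0 := ('X - c'%:P) ^+ m.
have mg0 : g0 \is monic by rewrite monic_exp ?monicXsubC.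
have mh : h \is monic by rewrite -(monicMr _ mg0) -rbh.
have m0 : (0 < m)%N.
  rewrite lt0n; apply/eqP => mE; move: rbc hc; rewrite rbh mE expr0 mulr1 => -> //.
have smh : (size h + m = n.+3)%N.
  by rewrite -srb rbh size_Mmonic ?monic_neq0 // size_exp_XsubC addnS.
(* Otherwise [rb] is a power of ['X - c'%:P]; its subleading coefficient is 0, so [c' = 0], and then
   the coefficient at [j0] vanishes too, which is false. *)
have mn : (m < n.+2)%N.
  have mle : (m <= n.+2)%N.
    by rewrite -ltnS -smh -[X in (X < _)%N]add0n ltn_add2r lt0n size_poly_eq0 monic_neq0.
  rewrite ltn_neqAle mle andbT.
  apply/eqP => mE; have h1 : h = 1.
    have sh : size h = 1%N by apply/eqP; rewrite -(eqn_add2r m) smh mE.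
    by rewrite [h]size1_polyC ?sh //; move/monicP: mh; rewrite lead_coefE sh /= => ->.
  move: rbn1; rewrite rbh h1 mul1r mE coef_XsubC_exp => /eqP.
  rewrite -mulr_natr mulf_eq0 pnatr_eq0 orbF oppr_eq0 => /eqP c0.
  move: rbj; rewrite rbh h1 mul1r c0 subr0 coefXn mE ltn_eqF ?eqxx //.
  by apply: leq_trans jn _; rewrite leqnSn.
have cop : coprimep g0 h.
  by rewrite coprimep_expl // coprimep_sym coprimep_XsubC.
pose e := r - map_poly (@cst k) rb.
have eE i : e`_i = r`_i - cst (r`_i 0) by rewrite coefB coef_map /= rbE.
have [eps eps0 es] : exists2 eps, 0 < eps & psmall eps e.
  by apply: psmall_uniform => i; rewrite eE; apply: small_residue.
have [a [b [sa sb ab]]] : exists a b : {poly series k}, [/\ (size a < size g0)%N, (size b < size h)%N &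
    (map_poly (@cst k) g0 + a) * (map_poly (@cst k) h + b) = map_poly (@cst k) (g0 * h) + e].
  apply: hensel es _ => //.
  rewrite size_exp_XsubC /= addnC; have -> : ((size h).-1 + m = n.+2)%N.
    apply/eqP; rewrite -eqSS -addSn prednK ?smh //.
    by rewrite lt0n size_poly_eq0 monic_neq0.
  apply/leq_sizeP => j; rewrite leq_eqVlt => /orP[/eqP<-|nj].
    by rewrite eE lr cf1 eqxx rmorph1 subrr.
  by rewrite eE nth_default ?sr // cf0 rmorph0 subrr.
have mga : map_poly (@cst k) g0 + a \is monic.
  by apply/monicP; rewrite lead_coefDl ?size_map_poly // lead_coef_map (monicP mg0) rmorph1.
have sga : size (map_poly (@cst k) g0 + a) = m.+1.
  by rewrite size_polyDl ?size_map_poly // size_exp_XsubC.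
have rab : r = (map_poly (@cst k) g0 + a) * (map_poly (@cst k) h + b).
  by rewrite ab [g0 * h]mulrC -rbh addrC subrK.
have [m' mE] : exists m', m = m'.+1 by case: (m) m0 => // m'; exists m'.
have mn' : (m' < n.+1)%N by rewrite -ltnS -mE.
have [x gx] := IHn m' mn' _ mga (etrans sga (congr1 S mE)).
by exists x; rewrite rab rootM gx.
Qed.

Lemma series_root (p : {poly series k}) : (1 < size p)%N -> exists x, root p x.
Proof.
move=> sp; have p0 : p != 0 by rewrite -size_poly_gt0 ltnW.
have lp : lead_coef p != 0 by rewrite lead_coef_eq0.
have mp : (lead_coef p)^-1 *: p \is monic by apply/monicP; rewrite lead_coefZ mulVf.
have [|x px] := @series_root_monic (size p).-2 _ mp.
  by rewrite size_scale ?invr_eq0 //; case: (size p) sp => [|[]].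
by exists x; move: px; rewrite rootZ ?invr_eq0.
Qed.

End Closed.

(** * The group of automorphisms and its fixed field *)

Definition loc3 (q : rat) : Prop :=
  exists d : nat, ~~ (3 %| d)%N /\ exists m : int, q * d%:R = m%:~R.

Lemma loc3_int (m : int) : loc3 m%:~R.
Proof. by exists 1%N; split=> //; exists m; rewrite mulr1. Qed.

Lemma loc3D p q : loc3 p -> loc3 q -> loc3 (p + q).
Proof.
move=> [d [d3 [m mE]]] [e [e3 [n nE]]]; exists (d * e)%N.
split; first by rewrite Euclid_dvdM // negb_or d3.
exists (m * e%:Z + n * d%:Z); rewrite intrD !intrM -mE -nE natrM /=; ring.
Qed.

Lemma loc3N p : loc3 p -> loc3 (- p).
Proof. by move=> [d [d3 [m mE]]]; exists d; split=> //; exists (- m); rewrite intrN -mE mulNr. Qed.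

Lemma loc3B p q : loc3 p -> loc3 q -> loc3 (p - q).
Proof. by move=> pl ql; apply/loc3D/loc3N. Qed.

Lemma loc3Z p (m : int) : loc3 p -> loc3 (m%:~R * p).
Proof.
move=> [d [d3 [n nE]]]; exists d; split=> //; exists (m * n).
by rewrite intrM -nE mulrA.
Qed.

Lemma loc3_div p (d : nat) : ~~ (3 %| d)%N -> loc3 (d%:R * p) -> loc3 p.
Proof.
move=> d3 [e [e3 [m mE]]]; exists (d * e)%N; split; first by rewrite Euclid_dvdM // negb_or d3.
by exists m; rewrite -mE natrM; ring.
Qed.

Lemma rat_loc3 (q : rat) : exists n (u : nat) (a : int), ~~ (3 %| u)%N /\ q = a%:~R / (3 ^+ n * u%:R).
Proof.
have d0 : (0 < `|denq q|)%N by rewrite absz_gt0 denq_neq0.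
have [u cu dE] := @pfactor_coprime 3 _ isT d0.
exists (logn 3 `|denq q|), u, (numq q); split; first by rewrite -prime_coprime.
rewrite -natrX -natrM mulnC -dE -[LHS]divq_num_den; congr (_ / _).
by rewrite -[in LHS](absz_denq q).
Qed.

(** Q/Z_(3) is a 3-primary torsion group; this is why characters take only roots of unity of 3-power
    order as values. *)
Lemma loc3_pow (q : rat) : exists n, loc3 (3 ^+ n * q).
Proof.
have [n [u [a [u3 ->]]]] := rat_loc3 q; exists n; exists u; split=> //; exists a.
have u0 : u%:R != 0 :> rat by rewrite pnatr_eq0; case: u u3.
by field; rewrite u0 expf_neq0.
Qed.

Lemma loc3_pow_int n (m : int) : loc3 (m%:~R / 3 ^+ n) -> (3 ^+ n %| m)%Z.
Proof.
move=> [d [d3 [a]]] /(congr1 (fun x => x * 3 ^+ n)); rewrite mulrAC divfK ?expf_neq0 // => E.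
have E' : m * d%:Z = a * 3 ^+ n.
  by apply: (@intr_inj rat); rewrite !intrM E; congr (_ * _); rewrite rmorphXn.
have c : coprimez (3 ^+ n) d%:Z.
  by rewrite coprimezE abszX /= coprimeXl // prime_coprime.
by rewrite -(Gauss_dvdzl _ c) E' dvdz_mull.
Qed.

(** A compatible system of 3-power roots of unity. The condition on the first term alone forces the
    [n]-th one to have exact order [3 ^ n]. *)
Lemma root3_seq : exists z : nat -> algC, z 0%N = 1 /\ (forall n, z n.+1 ^+ 3 = z n) /\ z 1%N != 1.
Proof.
have [w wP] := @C_prim_root_exists 3 isT.
exists (fun n => if n is m.+1 then iter m (fun x => 3.-root x) w else 1); split=> //; split=> [[|n]|] /=.
- exact: prim_expr_order wP.
- by rewrite rootCK.
- by rewrite -[w]expr1 -(prim_order_dvd wP).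
Qed.

Definition z3 : nat -> algC := sval (cid root3_seq).

Lemma z3_pow n r : z3 (n + r) ^+ (3 ^ r) = z3 n.
Proof.
rewrite /z3; case: cid => z [_ [zS _]] /=; elim: r => [|r IHr]; first by rewrite addn0 expr1.
by rewrite addnS expnS exprM zS.
Qed.

Lemma z3_prim n : (3 ^ n).-primitive_root (z3 n).
Proof.
have z0 : z3 0 = 1 by rewrite /z3; case: cid => z [? ?].
have z1 : z3 1 != 1 by rewrite /z3; case: cid => z [? [? ?]].
have zn : z3 n ^+ (3 ^ n) = 1 by rewrite -z0 -(z3_pow 0 n).
have n0 : (0 < 3 ^ n)%N by rewrite expn_gt0.
have [m mP] := prim_order_exists n0 zn.
move=> /(@dvdn_pfactor 3 m n isT)[i]; rewrite leq_eqVlt => /orP[/eqP-> mE|].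
  by rewrite -mE.
move=> i_n mE; have nE : (1 + n.-1 = n)%N by rewrite add1n prednK // (leq_ltn_trans _ i_n).
case/eqP: z1; rewrite -(z3_pow 1 n.-1) nE; apply/eqP.
by rewrite -(prim_order_dvd mP) mE dvdn_exp2l // -ltnS prednK // (leq_ltn_trans _ i_n).
Qed.

Lemma z3_neq0 n : z3 n != 0.
Proof.
apply/eqP => e; have := prim_expr_order (z3_prim n).
by rewrite e expr0n expn_eq0 /= => /esym/eqP; rewrite oner_eq0.
Qed.

Lemma z3_exp_eq1 n (m : int) : (z3 n ^ m == 1) = (3 ^+ n %| m)%Z.
Proof.
have H (k : nat) : (3 ^ n %| k)%N = (z3 n ^+ k == 1) := prim_order_dvd (z3_prim n) k.
by rewrite dvdzE abszX /=; case: m => k; rewrite H //= invr_eq1.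
Qed.

(* [chr0 q] is exp(2 pi i r), where r is the 3-primary part of q in Q/Z = sum_p Q_p/Z_p. *)
Lemma chr0_rep (q : rat) : exists nj : nat * int, loc3 (q - nj.2%:~R / 3 ^+ nj.1).
Proof.
have [n [u [a [u3 ->]]]] := rat_loc3 q.
have u0 : u%:R != 0 :> rat by rewrite pnatr_eq0; case: u u3.
have n0 : 3 ^+ n != 0 :> rat by apply: expf_neq0.
(* Partial fractions: [a / (3 ^ n u) = a x / 3 ^ n + a y / u], where the last term is in Z_(3). *)
have [x [y xy]] := Bezoutz u%:Z (3 ^+ n).
have g1 : gcdz u%:Z (3 ^+ n) = 1.
  by apply/eqP; rewrite -/(coprimez _ _) coprimezE abszX /= coprime_sym coprimeXl // prime_coprime.
exists (n, a * x); exists u; split=> //; exists (a * y) => /=.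
have E : y%:~R * 3 ^+ n = 1 - x%:~R * u%:R :> rat.
  apply/eqP; rewrite eq_sym subr_eq addrC; apply/eqP.
  by have := congr1 (fun m : int => m%:~R : rat) xy; rewrite g1 intrD !intrM rmorphXn => ->.
apply: (mulIf n0); rewrite !intrM -[RHS]mulrA E; field.
by rewrite u0 n0.
Qed.

Lemma chr0_uniq n m (i j : int) : loc3 (i%:~R / 3 ^+ n - j%:~R / 3 ^+ m) -> z3 n ^ i = z3 m ^ j.
Proof.
wlog nm : n m i j / (n <= m)%N.
  move=> H; have [|/ltnW mn] := leqP n m; first exact: H.
  by move=> l; symmetry; apply: H => //; rewrite -opprB; apply: loc3N.
rewrite -(subnKC nm); set r := (m - n)%N => l.
have : loc3 ((3 ^+ r * i - j)%:~R / 3 ^+ (n + r)).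
  rewrite intrB intrM rmorphXn.
  rewrite (_ : _ / _ = i%:~R / 3 ^+ n - j%:~R / 3 ^+ (n + r)) //.
  by rewrite exprD; field; rewrite !expf_neq0.
move=> /loc3_pow_int; rewrite -z3_exp_eq1 expfzDr ?z3_neq0 // => /eqP E.
have E' : z3 (n + r) ^ (3 ^+ r * i) = z3 n ^ i
  by rewrite -exprz_exp -(z3_pow n r) (_ : 3 ^+ r = Posz (3 ^ r)) // -natz natrX.
rewrite -E' -[RHS]mul1r -E -mulrA -expfzDr ?z3_neq0 // addNr mulr1.
by [].
Qed.

Definition chr0 (q : rat) : algC :=
  let nj := sval (cid (chr0_rep q)) in z3 nj.1 ^ nj.2.

Lemma chr0E q n (j : int) : loc3 (q - j%:~R / 3 ^+ n) -> chr0 q = z3 n ^ j.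
Proof.
rewrite /chr0; case: cid => -[m i] /= l l'; apply: chr0_uniq.
by have := loc3B l' l; congr loc3; ring.
Qed.

Lemma chr0D p q : chr0 (p + q) = chr0 p * chr0 q.
Proof.
have [[n i] /= l] := chr0_rep p; have [[m j] /= l'] := chr0_rep q.
pose N := (n + m)%N.
have L x a (k : int) b : loc3 (x - k%:~R / 3 ^+ a) ->
    loc3 (x - (3 ^+ b * k)%:~R / 3 ^+ (a + b)).
  rewrite intrM rmorphXn exprD (_ : _ / _ = k%:~R / 3 ^+ a) //.
  by field; rewrite !expf_neq0.
have lN := L _ _ _ m l; have := L _ _ _ n l'; rewrite addnC => lN'.
rewrite (chr0E lN) (chr0E lN') -expfzDr ?z3_neq0 //; apply: chr0E.
by rewrite intrD mulrDl opprD addrACA; apply: loc3D.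
Qed.

Lemma chr0_eq1 q : (chr0 q = 1) <-> loc3 q.
Proof.
have [[n i] /= l] := chr0_rep q; rewrite (chr0E l); split=> [/eqP|lq].
  rewrite z3_exp_eq1 => /dvdzP[m mE]; move: l; rewrite mE intrM rmorphXn mulfK ?expf_neq0 //.
  by move=> l; rewrite -(subrK m%:~R q); apply: loc3D => //; apply: loc3_int.
apply/eqP; rewrite z3_exp_eq1; apply: loc3_pow_int.
by rewrite -[X in loc3 X](subKr q); apply: loc3B.
Qed.

Notation Om := (series algC).

Definition locE (g : expo) : Prop := loc3 g.1 /\ loc3 g.2.

Lemma locE_pow g : exists n, locE (g *+ 3 ^ n).
Proof.
have [n nP] := loc3_pow g.1; have [m mP] := loc3_pow g.2; exists (n + m)%N.
split.
  rewrite raddfMn -mulr_natl /= expnD natrM !natrX mulrC mulrA mulrC.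
  have -> : 3 ^+ m = ((3 ^+ m)%:~R : rat) by rewrite rmorphXn.
  by rewrite [g.1 * _]mulrC; apply: loc3Z.
rewrite raddfMn -mulr_natl /= expnD natrM !natrX -mulrA.
by have -> : 3 ^+ n = ((3 ^+ n)%:~R : rat) by [rewrite rmorphXn]; apply: loc3Z.
Qed.

Lemma locED g h : locE g -> locE h -> locE (g + h).
Proof. by move=> [? ?] [? ?]; split; apply: loc3D. Qed.
Lemma locEN g : locE g -> locE (- g).
Proof. by move=> [? ?]; split; apply: loc3N. Qed.

Record chr := Chr {
  chf :> expo -> algC;
  chrD : forall g h, chf (g + h) = chf g * chf h;
  chr1 : forall g, locE g -> chf g = 1
}.

Lemma locE0 : locE 0. Proof. by split; apply: (loc3_int 0). Qed.

Lemma chr_0 (x : chr) : x 0 = 1. Proof. exact/chr1/locE0. Qed.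

Lemma chrN (x : chr) g : x (- g) = (x g)^-1.
Proof.
apply: (mulIf (x := x g)); last first.
  by rewrite -chrD addNr chr_0 mulVf //; apply/eqP => e; have := chr_0 x;
     rewrite -(subrr g) chrD e mul0r => /esym/eqP; rewrite oner_eq0.
by apply/eqP => e; have := chr_0 x; rewrite -(subrr g) chrD e mul0r => /esym/eqP; rewrite oner_eq0.
Qed.

Lemma chr_neq0 (x : chr) g : x g != 0.
Proof.
by apply/eqP => e; have := chr_0 x; rewrite -(subrr g) chrD e mul0r => /esym/eqP; rewrite oner_eq0.
Qed.

Lemma chrMn (x : chr) g n : x (g *+ n) = x g ^+ n.
Proof. by elim: n => [|n IHn]; rewrite ?mulr0n ?chr_0 // mulrS chrD IHn exprS. Qed.

Lemma chr_pow (x : chr) g : exists n, x g ^+ (3 ^ n) = 1.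
Proof. by have [n gn] := locE_pow g; exists n; rewrite -chrMn chr1. Qed.

(** The values are roots of unity; the action by inversion comes from here. *)
Lemma chr_conj (x : chr) g : (x g)^* = (x g)^-1.
Proof.
have [n xn] := chr_pow x g; rewrite invC_norm.
have /eqP : `|x g| ^+ (3 ^ n) = 1 by rewrite -normrX xn normr1.
by rewrite pexpr_eq1 ?expn_gt0 // => /eqP->; rewrite expr1n invr1 mul1r.
Qed.

Lemma chr_ext (x y : chr) : x =1 y -> x = y.
Proof.
case: x y => x xD x1 [y yD y1] /= /funext e; move: xD x1 yD y1; rewrite e => *.
by congr Chr; apply: Prop_irrelevance.
Qed.

Definition ch1 : chr := @Chr (fun=> 1) (fun _ _ => esym (mulr1 1)) (fun _ _ => erefl).

Fact chm_D (x y : chr) g h : x (g + h) * y (g + h) = x g * y g * (x h * y h).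
Proof. by rewrite !chrD mulrACA. Qed.
Fact chm_1 (x y : chr) g : locE g -> x g * y g = 1.
Proof. by move=> gl; rewrite !chr1 ?mulr1. Qed.
Definition chm (x y : chr) : chr := Chr (chm_D x y) (@chm_1 x y).

Fact chi_D (x : chr) g h : x (- (g + h)) = x (- g) * x (- h).
Proof. by rewrite opprD chrD. Qed.
Fact chi_1 (x : chr) g : locE g -> x (- g) = 1.
Proof. by move=> gl; apply/chr1/locEN. Qed.
Definition chi (x : chr) : chr := Chr (chi_D x) (@chi_1 x).

Definition chfst : chr := @Chr (fun g => chr0 g.1) (fun g h => chr0D g.1 h.1)
  (fun g gl => (chr0_eq1 g.1).2 gl.1).
Definition chsnd : chr := @Chr (fun g => chr0 g.2) (fun g h => chr0D g.2 h.2)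
  (fun g gl => (chr0_eq1 g.2).2 gl.2).

(** Characters separate the points of Q^2/Z_(3)^2; the two coordinate characters suffice. *)
Lemma locEP g : (forall x : chr, x g = 1) -> locE g.
Proof. by move=> H; split; apply/chr0_eq1; [apply: (H chfst) | apply: (H chsnd)]. Qed.

(** The pair [(b, x)] conjugates the coefficients if [b] holds, and then multiplies by the character
    [x]. *)
Definition gaut : Type := (bool * chr)%type.

(** * The action on series, the field K and algebraic elements *)

Section Twist.
Implicit Types (h : gaut) (x y : chr) (f z : Om).

Definition cj (b : bool) (c : algC) : algC := if b then c^* else c.

Lemma cjD b c d : cj b (c + d) = cj b c + cj b d.
Proof. by case: b => //=; apply: rmorphD. Qed.
Lemma cjB b c d : cj b (c - d) = cj b c - cj b d.
Proof. by case: b => //=; apply: rmorphB. Qed.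
Lemma cjM b c d : cj b (c * d) = cj b c * cj b d.
Proof. by case: b => //=; apply: rmorphM. Qed.
Lemma cj0 b : cj b 0 = 0. Proof. by case: b => //=; apply: rmorph0. Qed.
Lemma cj1 b : cj b 1 = 1. Proof. by case: b => //=; apply: rmorph1. Qed.
Lemma cj_eq0 b c : (cj b c == 0) = (c == 0).
Proof. by case: b => //=; rewrite conjC_eq0. Qed.

Fact tw_lf h f : left_finite (fun g => h.2 g * cj h.1 (f g)).
Proof.
move=> r; have [s sP] := seriesP f r; exists s => g.
by rewrite mulf_eq0 negb_or cj_eq0 => /andP[_]; apply: sP.
Qed.
Definition tw h f : Om := Series (tw_lf h f).

Lemma twE h f g : tw h f g = h.2 g * cj h.1 (f g). Proof. by []. Qed.

Lemma tw_neq0 h f g : (tw h f g != 0) = (f g != 0).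
Proof. by rewrite twE mulf_eq0 (negPf (chr_neq0 _ _)) cj_eq0. Qed.

Fact tw_additive h : zmod_morphism (tw h).
Proof. by move=> f f'; apply: series_ext => g; rewrite twE !cfB cjB mulrBr. Qed.
Fact tw_multiplicative h : monoid_morphism (tw h).
Proof.
split=> [|f f']; apply: series_ext => g.
  by rewrite twE !cf1; case: eqP => [->|_]; rewrite ?chr_0 ?cj1 ?cj0 ?mulr1 ?mulr0.
have [s [us sP]] := conv_supp f f' g; rewrite twE (cfM us sP) (@cfM _ _ _ _ s) //; last first.
  by move=> a; rewrite !tw_neq0; apply: sP.
rewrite (big_morph (cj h.1) (cjD h.1) (cj0 h.1)) mulr_sumr; apply: eq_bigr => a _.
rewrite cjM !twE (_ : h.2 g = h.2 a * h.2 (g - a)); first by ring.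
by rewrite -chrD addrC subrK.
Qed.
HB.instance Definition _ h := GRing.isZmodMorphism.Build _ _ (tw h) (tw_additive h).
HB.instance Definition _ h := GRing.isMonoidMorphism.Build _ _ (tw h) (tw_multiplicative h).

Lemma vl_tw h f : f != 0 -> vl (tw h f) = vl f.
Proof.
by move=> f0; apply: vl_uniq => [|g]; rewrite tw_neq0; [apply: vl_lead | apply: vl_min].
Qed.

Definition chtw (b : bool) x : chr := if b then chi x else x.
Definition gautm h h' : gaut := (h.1 (+) h'.1, chm h.2 (chtw h.1 h'.2)).
Definition gauti h : gaut := (h.1, chtw h.1 (chi h.2)).
Definition gaut1 : gaut := (false, ch1).

Lemma cj_chr b x g : cj b (x g) = chtw b x g.
Proof. by case: b => //=; rewrite chr_conj chrN. Qed.
Lemma cj_cj b b' c : cj b (cj b' c) = cj (b (+) b') c.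
Proof. by case: b; case: b' => //=; rewrite conjCK. Qed.

Lemma twM h h' f : tw h (tw h' f) = tw (gautm h h') f.
Proof. by apply: series_ext => g; rewrite !twE /= cjM cj_cj cj_chr mulrA. Qed.

Lemma tw1 f : tw gaut1 f = f.
Proof. by apply: series_ext => g; rewrite twE mul1r. Qed.

Lemma gautVm h : gautm (gauti h) h = gaut1.
Proof.
case: h => b x; rewrite /gautm /gauti /gaut1 /= addbb; congr (_, _); apply: chr_ext => g /=.
by case: b => /=; rewrite ?opprK chrN ?mulfV ?mulVf // chr_neq0.
Qed.

Lemma gautmV h : gautm h (gauti h) = gaut1.
Proof.
case: h => b x; rewrite /gautm /gauti /gaut1 /= addbb; congr (_, _); apply: chr_ext => g /=.
by case: b => /=; rewrite ?opprK ?chrN ?invrK ?mulfV ?mulVf // chr_neq0.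
Qed.

Lemma twK h : cancel (tw h) (tw (gauti h)).
Proof. by move=> f; rewrite twM gautVm tw1. Qed.
Lemma twVK h : cancel (tw (gauti h)) (tw h).
Proof. by move=> f; rewrite twM gautmV tw1. Qed.

Lemma tw_comm x y f : tw (false, x) (tw (false, y) f) = tw (false, y) (tw (false, x) f).
Proof. by apply: series_ext => g; rewrite !twE /= mulrCA. Qed.

(* Conjugation inverts the characters. *)
Lemma tw_inv x y f :
  tw (false, x) (tw (true, y) (tw (false, x) f)) = tw (true, y) f.
Proof.
apply: series_ext => g; rewrite !twE /= rmorphM /= chr_conj; field; exact: chr_neq0.
Qed.

(** In a generalised dihedral group all elements outside the abelian part are involutions. *)
Lemma tw_true2 y f : tw (true, y) (tw (true, y) f) = f.
Proof.
apply: series_ext => g; rewrite !twE /= rmorphM /= conjCK chr_conj; field; exact: chr_neq0.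
Qed.

Lemma iter_twE x n f g : iter n (tw (false, x)) f g = x g ^+ n * f g.
Proof.
elim: n => [|n IHn] /=; first by rewrite expr0 mul1r.
by rewrite IHn exprS mulrA.
Qed.

Lemma tw_mono h c g : tw h (mono c g) = mono (h.2 g * cj h.1 c) g.
Proof.
by apply: series_ext => g'; rewrite twE !monoE; case: eqP => [->|_] //; rewrite cj0 mulr0.
Qed.

Lemma tw_cst x c : tw (false, x) (cst c) = cst c.
Proof. by rewrite /cst tw_mono chr_0 mul1r. Qed.

Definition fixed_by_aut f : bool := `[< forall h, tw h f = f >].

Fact fixed_divring_closed : divring_closed fixed_by_aut.
Proof.
split=> [|f f' /asboolP fP /asboolP fP'|f f' /asboolP fP /asboolP fP']; apply/asboolP => h.
- exact: rmorph1.
- by rewrite rmorphB /= fP fP'.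
- by rewrite fmorph_div /= fP fP'.
Qed.
HB.instance Definition _ := GRing.isDivringClosed.Build _ fixed_by_aut fixed_divring_closed.

Record baseK := BaseK { kval :> Om; kvalP : kval \in fixed_by_aut }.
HB.instance Definition _ := [isSub for kval].
HB.instance Definition _ := [Choice of baseK by <:].
HB.instance Definition _ := [SubChoice_isSubIntegralDomain of baseK by <:].
HB.instance Definition _ := [SubIntegralDomain_isSubField of baseK by <:].

Fact kval_zmod : zmod_morphism kval. Proof. by []. Qed.
Fact kval_monoid : monoid_morphism kval. Proof. by []. Qed.
HB.instance Definition _ := GRing.isZmodMorphism.Build _ _ kval kval_zmod.
HB.instance Definition _ := GRing.isMonoidMorphism.Build _ _ kval kval_monoid.

Lemma tw_kval h (c : baseK) : tw h (kval c) = kval c.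
Proof. by have /asboolP := kvalP c. Qed.

Lemma fixed_kval z : (forall h, tw h z = z) -> exists c : baseK, z = kval c.
Proof. by move=> zP; have zf : z \in fixed_by_aut by [apply/asboolP]; exists (BaseK zf). Qed.

(** The leading coefficient is fixed by all characters, so they are trivial on the value. With
    [mono_kval], the value group of K is exactly Z_(3)^2. *)
Lemma kval_loc (c : baseK) : c != 0 -> locE (vl (kval c)).
Proof.
move=> c0; apply: locEP => x; have := congr1 (fun f : Om => f (vl (kval c))) (tw_kval (false, x) c).
rewrite twE /= -[RHS]mul1r => /mulIf; apply.
by apply: vl_lead; rewrite fmorph_eq0.
Qed.

Lemma mono_kval g : locE g -> exists c : baseK, kval c = mono 1 g.
Proof.
move=> gl; have [h|c ->] := @fixed_kval (mono 1 g); last by exists c.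
by rewrite tw_mono chr1 // cj1 mulr1.
Qed.

Definition Alg z : Prop := algebraicOver kval z.

Lemma Alg_kval c : Alg (kval c). Proof. exact: algebraic_id. Qed.

Lemma Alg_root (p : {poly Om}) z : p != 0 -> root p z -> (forall i, Alg p`_i) -> Alg z.
Proof.
move=> p0 pz pA; apply/integral_algebraic; apply: (integral_root p0 pz) => c /(nthP 0)[i _ <-].
exact/integral_algebraic/pA.
Qed.

Lemma root_tw (p : {poly baseK}) h z : root (map_poly kval p) z -> root (map_poly kval p) (tw h z).
Proof.
move=> pz; have -> : map_poly kval p = map_poly (tw h) (map_poly kval p).
  by rewrite -map_poly_comp; apply: eq_map_poly => c /=; rewrite tw_kval.
exact: rmorph_root.
Qed.

Lemma split_Om (p : {poly Om}) : p \is monic -> exists rs : seq Om, p = \prod_(r <- rs) ('X - r%:P).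
Proof.
have [n] := ubnP (size p); elim: n p => // n IHn p; rewrite ltnS => sp pm.
have [p1|p1] := leqP (size p) 1.
  exists [::]; have pc := size1_polyC p1; rewrite big_nil pc.
  by move: pm; rewrite {1}pc monicE lead_coefC => /eqP->.
have [r /factor_theorem[q pq]] := series_root p1.
have qm : q \is monic by move: pm; rewrite pq monicMr // monicXsubC.
have [|rs qE] := IHn q _ qm; last by exists (rcons rs r); rewrite big_rcons -qE.
by apply: leq_trans sp; rewrite pq size_Mmonic ?monic_neq0 ?monicXsubC // size_XsubC addn2.
Qed.

Lemma finite_roots (p : {poly Om}) : p != 0 ->
  exists s : seq Om, forall a, root p a -> a \in s.
Proof.
move=> p0; have [|rs rsE] := @split_Om ((lead_coef p)^-1 *: p).
  by rewrite monicE lead_coefZ mulVf // lead_coef_eq0.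
by exists rs => a; rewrite -root_prod_XsubC -rsE rootZ // invr_eq0 lead_coef_eq0.
Qed.

Lemma Alg_orbit z : Alg z ->
  exists2 O : seq Om, uniq O & forall w, w \in O <-> exists h, w = tw h z.
Proof.
move=> [p p0 pz]; have [|s sP] := @finite_roots (map_poly kval p); first by rewrite map_poly_eq0.
exists [seq w <- undup s | `[< exists h, w = tw h z >]].
  by rewrite filter_uniq // undup_uniq.
move=> w; rewrite mem_filter mem_undup; split=> [/andP[/asboolP]//|[h ->]].
apply/andP; split; first by apply/asboolP; exists h.
exact/sP/root_tw.
Qed.

(** By the pigeonhole principle in the finite orbit, some [m] satisfies [x g ^+ m = 1] for all [g]
    in the support of [z]; as the values of [x] are 3-power roots of unity, the 3-part of [m] works
    as well. *)
Lemma Alg_torsion z x : Alg z -> exists n, iter (3 ^ n) (tw (false, x)) z = z.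
Proof.
move=> /Alg_orbit[O uO OP]; pose F j := iter j (tw (false, x)) z.
have FO j : F j \in O.
  apply/OP; elim: j => [|j [h hE]]; first by exists gaut1; rewrite tw1.
  by exists (gautm (false, x) h); rewrite -twM -hE.
have : ~~ uniq [seq F j | j <- iota 0 (size O).+1].
  apply/negP => u; have := uniq_leq_size u (s2 := O).
  rewrite size_map size_iota ltnn => /(_ _)/notF[] // w /mapP[j _ ->]; exact: FO.
move=> /(uniqPn 0)[i [j [ij]]]; rewrite size_map size_iota => jO.
rewrite !(nth_map 0%N) ?size_iota ?(ltn_trans ij) // !nth_iota ?(ltn_trans ij) // !add0n => FE.
pose m := (j - i)%N; have m0 : (0 < m)%N by rewrite subn_gt0.
have xm g : z g != 0 -> x g ^+ m = 1.
  move=> zg; have := congr1 (fun f : Om => f g) FE; rewrite /F !iter_twE => /(mulIf zg).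
  rewrite -(subnKC (ltnW ij)) exprD -/m -[LHS]mulr1 => /mulfI E.
  by rewrite -E // expf_neq0 // chr_neq0.
have [u cu mE] := @pfactor_coprime 3 m isT m0; exists (logn 3 m).
apply: series_ext => g; rewrite iter_twE; have [->|zg] := eqVneq (z g) 0; first by rewrite mulr0.
rewrite -[RHS]mul1r; congr (_ * _).
have [n nP] := chr_pow x g; have n0 : (0 < 3 ^ n)%N by rewrite expn_gt0.
have [d dP dn] := prim_order_exists n0 nP.
apply/eqP; rewrite -(prim_order_dvd dP).
have : (d %| u * 3 ^ logn 3 m)%N by rewrite -mE (prim_order_dvd dP) xm.
by rewrite Gauss_dvdr //; apply: coprime_dvdl dn _; rewrite coprimeXl.
Qed.

End Twist.

(** * Galois theory of subfields of the series field *)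

Lemma Om_char0 : has_char0 Om.
Proof.
move=> p; rewrite inE /=; apply/negP => /andP[/prime_gt0 p0].
by rewrite -(rmorph_nat (@cst algC)) fmorph_eq0 pnatr_eq0 eqn0Ngt p0.
Qed.

Lemma char0_to_Om (F : fieldType) (f : {rmorphism F -> Om}) : has_char0 F.
Proof. by move=> p; rewrite -(fmorph_pchar f) Om_char0. Qed.

Section Extend.
Variables (E : fieldType) (L : fieldExtType E) (b : L).
Hypothesis gen_b : <<1; b>>%VS = {:L}%VS.

Lemma gen_horner (x : L) : exists p : {poly E}, x = (map_poly (in_alg L) p).[b].
Proof.
have /Fadjoin_polyP[p /polyOver1P[q ->] ->] : x \in <<1; b>>%VS by rewrite gen_b memvf.
by exists q.
Qed.

(** The target may be noncommutative: this serves for embeddings into division algebras as well as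
    into Om. *)
Lemma ext_rmorph (B : nzRingType) (phi : {rmorphism {poly E} -> B}) :
  (forall p, (map_poly (in_alg L) p).[b] = 0 -> phi p = 0) ->
  exists f : {rmorphism L -> B}, forall p, f (map_poly (in_alg L) p).[b] = phi p.
Proof.
move=> phi0; pose f x := phi (sval (cid (gen_horner x))).
have fE p : f (map_poly (in_alg L) p).[b] = phi p.
  rewrite /f; case: cid => q /= pq; apply/eqP; rewrite -subr_eq0 -rmorphB; apply/eqP/phi0.
  by rewrite rmorphB hornerD hornerN pq subrr.
have fz : zmod_morphism f.
  move=> x y; have [p ->] := gen_horner x; have [q ->] := gen_horner y.
  by rewrite -hornerN -hornerD -rmorphB !fE rmorphB.
have fm : monoid_morphism f.
  split=> [|x y]; first by have := fE 1; rewrite !rmorph1 hornerC.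
  have [p ->] := gen_horner x; have [q ->] := gen_horner y.
  by rewrite -hornerM -rmorphM !fE rmorphM.
pose F : {rmorphism L -> B} := HB.pack f
  (GRing.isZmodMorphism.Build L B f fz) (GRing.isMonoidMorphism.Build L B f fm).
by exists F.
Qed.

End Extend.

Lemma char0_gen (E : fieldType) (L : fieldExtType E) : has_char0 L ->
  exists b : L, <<1; b>>%VS = {:L}%VS.
Proof.
move=> c0; exists (separable_generator 1%AS {:L}%AS); symmetry.
apply: eq_adjoin_separable_generator; last exact: sub1v.
by apply/separableP => x _; apply: pcharf0_separable.
Qed.

Lemma minPoly1 (E : fieldType) (L : fieldExtType E) (b : L) :
  exists m : {poly E}, minPoly 1 b = map_poly (in_alg L) m.
Proof. by have /polyOver1P[m mE] := minPolyOver 1 b; exists m. Qed.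

Section Package.
Variables (E : fieldType) (io : {rmorphism E -> Om}).

Definition fixE (h : gaut) : Prop := forall x, tw h (io x) = io x.

(** The embedded field is the fixed field of its stabiliser. This form of the Galois correspondence
    holds for K by construction and passes to finite extensions by [gal_ext]. *)
Definition gal_closed : Prop := forall z : Om,
  (forall h, fixE h -> tw h z = z) -> exists x, z = io x.

Hypothesis gal : gal_closed.
Hypothesis alg : forall x, Alg (io x).

Lemma fixE1 : fixE gaut1. Proof. by move=> x; rewrite tw1. Qed.
Lemma fixEM h h' : fixE h -> fixE h' -> fixE (gautm h h').
Proof. by move=> hP hP' x; rewrite -twM hP' hP. Qed.
Lemma fixEV h : fixE h -> fixE (gauti h).
Proof. by move=> hP x; apply: (can_inj (twK h)); rewrite twVK hP. Qed.

Lemma Alg_over (p : {poly E}) z : p != 0 -> root (map_poly io p) z -> Alg z.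
Proof.
move=> p0 pz; apply: (Alg_root _ pz); first by rewrite map_poly_eq0.
by move=> i; rewrite coef_map; apply: alg.
Qed.

Lemma tw_map_poly h (p : {poly E}) : fixE h ->
  map_poly (tw h) (map_poly io p) = map_poly io p.
Proof. by move=> hP; rewrite -map_poly_comp; apply: eq_map_poly => x /=; apply: hP. Qed.

Lemma tw_horner h (p : {poly E}) z : fixE h ->
  tw h (map_poly io p).[z] = (map_poly io p).[tw h z].
Proof. by move=> hP; rewrite -horner_map tw_map_poly. Qed.

Lemma tw_root h (p : {poly E}) z : fixE h ->
  root (map_poly io p) z -> root (map_poly io p) (tw h z).
Proof. by move=> hP pz; rewrite -(tw_map_poly p hP) fmorph_root. Qed.

Lemma poly_fixed (q : {poly Om}) : (forall h, fixE h -> map_poly (tw h) q = q) ->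
  exists p, q = map_poly io p.
Proof.
move=> qP; have cP i : exists x, q`_i = io x.
  by apply: gal => h hP; rewrite -[in RHS](qP h hP) coef_map.
exists (\poly_(i < size q) sval (cid (cP i))); apply/polyP => i; rewrite coef_map coef_poly /=.
by case: ltnP => iq; [case: cid | rewrite rmorph0 nth_default].
Qed.

Lemma finite_orbit z : Alg z -> exists2 O : seq Om, uniq O &
  forall w, w \in O <-> exists2 h, fixE h & w = tw h z.
Proof.
move=> /Alg_orbit[O uO OP]; exists [seq w <- O | `[< exists2 h, fixE h & w = tw h z >]].
  by rewrite filter_uniq.
move=> w; rewrite mem_filter; split=> [/andP[/asboolP]//|[h hP ->]].
by apply/andP; split; [apply/asboolP; exists h | apply/OP; exists h].
Qed.

Lemma orbit_perm z (O : seq Om) h : uniq O ->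
  (forall w, w \in O <-> exists2 h, fixE h & w = tw h z) -> fixE h ->
  perm_eq (map (tw h) O) O.
Proof.
move=> uO OP hP; have uh : uniq (map (tw h) O) by rewrite map_inj_uniq //; apply: can_inj (twK h).
have [_ Oh] : (size (map (tw h) O) = size O) * (map (tw h) O =i O).
  have := uniq_min_size uh; apply => // [w /mapP[v /OP[k kP ->] ->]|]; last by rewrite size_map.
  by apply/OP; exists (gautm h k); [apply: fixEM | rewrite twM].
exact: uniq_perm.
Qed.

Lemma orbit_poly z (O : seq Om) : uniq O ->
  (forall w, w \in O <-> exists2 h, fixE h & w = tw h z) ->
  exists p : {poly E}, map_poly io p = \prod_(o <- O) ('X - o%:P).
Proof.
move=> uO OP; have [h hP|p ->] := @poly_fixed (\prod_(o <- O) ('X - o%:P)); last by exists p.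
rewrite map_prod_XsubC -(big_map (tw h) predT (fun o => 'X - o%:P)).
by apply: perm_big; apply: orbit_perm hP.
Qed.

(* Euler's formula: if P = prod_o (X - o) over the orbit of theta and z_o is the conjugate of z over
   o, then N = sum_o z_o P / (X - o) is rational and z = N(theta) / P'(theta). *)
Lemma fixed_horner theta z : Alg theta ->
  (forall h, fixE h -> tw h theta = theta -> tw h z = z) ->
  exists p : {poly E}, z = (map_poly io p).[theta].
Proof.
move=> at_ hz; have [O uO OP] := finite_orbit at_.
have ex o : exists h, (o \in O -> fixE h /\ o = tw h theta).
  have [/OP[h hP oE]|no] := boolP (o \in O); first by exists h.
  by exists gaut1.
(* One automorphism carrying [theta] to [o]. The conjugate [Z o] does not depend on the choice,
   since the stabiliser of [theta] fixes [z]. *)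
pose k o := sval (cid (ex o)).
have kP o : o \in O -> fixE (k o) /\ o = tw (k o) theta by rewrite /k; case: cid.
pose Z o := tw (k o) z.
have zE h o : fixE h -> o \in O -> tw h (Z o) = Z (tw h o).
  move=> hP oO; have [kf oE] := kP o oO.
  have hoO : tw h o \in O.
    by apply/OP; exists (gautm h (k o)); [apply: fixEM | rewrite -twM -oE].
  have [kf' oE'] := kP _ hoO.
  pose g := gautm (gauti (k (tw h o))) (gautm h (k o)).
  have gP : fixE g by apply: fixEM; [apply: fixEV | apply: fixEM].
  have e : tw g theta = theta by rewrite /g -!twM -oE [X in tw (gauti _) X]oE' twK.
  have := hz g gP e; rewrite /g -!twM => e'.
  by rewrite /Z -[X in _ = tw _ X]e' twVK.
pose Q (o : Om) := \prod_(o' <- O | o' != o) ('X - o'%:P).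
have QE h o : fixE h -> map_poly (tw h) (Q o) = Q (tw h o).
  move=> hP; rewrite map_prod_XsubC /Q.
  rewrite -[RHS](perm_big _ (orbit_perm uO OP hP)) /= big_map.
  by apply: eq_bigl => o'; rewrite (can_eq (twK h)).
have [h hP|N NE] := @poly_fixed (\sum_(o <- O) Z o *: Q o).
  rewrite raddf_sum -[RHS](perm_big _ (orbit_perm uO OP hP)) /= big_map big_seq [RHS]big_seq.
  by apply: eq_bigr => o oO; rewrite /= map_polyZ /= zE // QE.
have [P PE] := orbit_poly uO OP.
have tO : theta \in O by apply/OP; exists gaut1; [apply: fixE1 | rewrite tw1].
have Zt : Z theta = z by have [kf /esym tE] := kP _ tO; rewrite /Z hz.
have NEt : (map_poly io N).[theta] = z * (Q theta).[theta].
  rewrite -NE horner_sum (bigD1_seq theta) //= hornerZ Zt big1 ?addr0 // => o ot.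
  rewrite hornerZ /Q horner_prod -big_filter (bigD1_seq theta) /=.
  - by rewrite hornerXsubC subrr mul0r mulr0.
  - by rewrite mem_filter tO andbT eq_sym.
  - by rewrite filter_uniq.
have PEt : (map_poly io P^`()).[theta] = (Q theta).[theta].
  rewrite -deriv_map PE (bigD1_seq theta) //= derivM derivXsubC mul1r hornerD hornerM.
  by rewrite hornerXsubC subrr mul0r addr0.
have sP : separable_poly P by rewrite -(separable_map io) PE separable_prod_XsubC.
move: sP; rewrite unlock => /Bezout_eq1_coprimepP[[u v] /= uv].
(* At [theta] the Bezout relation becomes v P' = 1, so [v] provides the inverse of P'(theta). *)
exists (N * v); rewrite rmorphM hornerM NEt -mulrA -PEt mulrC.
have rP : (map_poly io P).[theta] = 0 by apply/eqP; rewrite -/(root _ _) PE root_prod_XsubC.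
have := congr1 (fun p => (map_poly io p).[theta]) uv.
rewrite rmorphD !rmorphM rmorph1 /= hornerD !hornerM rP mulr0 add0r hornerC => e.
by rewrite -[LHS]mul1r -e mulrAC mulrC mulrA.
Qed.

(** The orbit polynomial [P] is defined over [E], and it divides [p] because its roots are distinct
    roots of [p]; irreducibility does the rest. *)
Lemma irreducible_orbit (p : {poly E}) z (O : seq Om) : irreducible_poly p -> uniq O ->
  (forall w, w \in O <-> exists2 h, fixE h & w = tw h z) ->
  root (map_poly io p) z -> size p = (size O).+1.
Proof.
move=> [sp irr] uO OP pz; have [P PE] := orbit_poly uO OP.
have zO : z \in O by apply/OP; exists gaut1; [apply: fixE1 | rewrite tw1].
have sP : size P = (size O).+1 by rewrite -(size_map_poly io) PE size_prod_XsubC.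
rewrite -sP; apply/esym/eqp_size/irr; first by rewrite sP eqSS; case: (O) zO.
rewrite -(dvdp_map io) PE; apply: uniq_roots_dvdp; last by rewrite uniq_rootsE.
by apply/allP => w /OP[h hP ->]; apply: tw_root.
Qed.

Lemma Om_root (p : {poly E}) : (1 < size p)%N -> exists z, root (map_poly io p) z.
Proof. by move=> sp; apply: series_root; rewrite size_map_poly. Qed.

Section Extension.
Variable L : fieldExtType E.

Lemma embed_Om : exists j : {rmorphism L -> Om}, forall x, j (in_alg L x) = io x.
Proof.
have c0 : has_char0 L by move=> p; rewrite (fmorph_pchar (in_alg L)) (char0_to_Om io).
have [b gb] := char0_gen c0; have [m mE] := minPoly1 b.
have [|z mz] := @Om_root m.
  by rewrite -(size_map_poly (in_alg L)) -mE size_minPoly.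
have [|f fE] := @ext_rmorph E L b gb Om (horner_eval z \o map_poly io).
  move=> p pb /=; have : minPoly 1 b %| map_poly (in_alg L) p.
    by apply: minPoly_dvdp; [apply/polyOver1P; exists p | apply/eqP].
  rewrite mE dvdp_map => /dvdpP[q ->]; rewrite /horner_eval rmorphM hornerM.
  by rewrite (eqP mz) mulr0.
exists f => x; have := fE x%:P; rewrite map_polyC hornerC => -> /=.
by rewrite /horner_eval map_polyC hornerC.
Qed.

Variable j : {rmorphism L -> Om}.
Hypothesis jE : forall x, j (in_alg L x) = io x.

Lemma j_horner (p : {poly E}) b : j (map_poly (in_alg L) p).[b] = (map_poly io p).[j b].
Proof.
rewrite -horner_map -map_poly_comp; congr _.[_].
by apply: eq_map_poly => x; apply: jE.
Qed.

Lemma L_gen : exists b : L, <<1; b>>%VS = {:L}%VS.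
Proof. exact/char0_gen/(char0_to_Om j). Qed.

Lemma alg_ext x : Alg (j x).
Proof.
have [m mE] := minPoly1 x; apply: (@Alg_over m).
  by rewrite -(map_poly_eq0 (in_alg L)) -mE monic_neq0 ?monic_minPoly.
by rewrite /root -j_horner -mE (eqP (root_minPoly 1 x)) rmorph0.
Qed.

(** An automorphism fixing the image of a primitive element fixes that of [L], so [fixed_horner]
    applies to this element. *)
Lemma gal_ext z : (forall h, (forall x, tw h (j x) = j x) -> tw h z = z) -> exists x, z = j x.
Proof.
move=> hz; have [b gb] := L_gen.
have [h hP hb|p ->] := @fixed_horner (j b) z (alg_ext b); last first.
  by exists (map_poly (in_alg L) p).[b]; rewrite j_horner.
apply: hz => x; have [p ->] := gen_horner gb x.
by rewrite j_horner tw_horner // hb.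
Qed.

End Extension.

Section Galois.
Variable L : splittingFieldType E.
Variable j : {rmorphism L -> Om}.
Hypothesis jE : forall x, j (in_alg L x) = io x.
Hypothesis galL : galois 1 {:L}.

Lemma gal_horner (g : gal_of {:L}) (p : {poly E}) b :
  g (map_poly (in_alg L) p).[b] = (map_poly (in_alg L) p).[g b].
Proof.
rewrite -horner_map -map_poly_comp; congr _.[_]; apply: eq_map_poly => y /=.
by rewrite rmorph_alg.
Qed.

(** Restriction to a Galois extension: [tw h] sends the image of a primitive element to a root of
    its minimal polynomial, which the Galois group reaches too. *)
Lemma gal_lift h : fixE h -> exists2 g, g \in 'Gal({:L} / 1)%g & forall x, tw h (j x) = j (g x).
Proof.
move=> hP; have [b gb] := L_gen j.
have [r [rG _ mE]] := galois_factors (sub1v _) galL b (memvf b).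
have [m mE'] := minPoly1 b.
have : root (map_poly io m) (tw h (j b)).
  by apply: tw_root => //; rewrite /root -(j_horner jE) -mE' (eqP (root_minPoly 1 b)) rmorph0.
have -> : map_poly io m = map_poly j (minPoly 1 b).
  by rewrite mE' -map_poly_comp; apply: eq_map_poly => x; rewrite /= jE.
rewrite mE map_prod_XsubC -(big_map j predT (fun o => 'X - o%:P)) root_prod_XsubC.
case/mapP=> _ /mapP[g gr ->] e; exists g; first exact: (fintype.subsetP rG g gr).
move=> x; have [p ->] := gen_horner gb x.
by rewrite (j_horner jE) tw_horner // e -(j_horner jE) gal_horner.
Qed.

Lemma iter_lift h (g : gal_of {:L}) n : (forall x, tw h (j x) = j (g x)) -> forall x,
  iter n (tw h) (j x) = j ((g ^+ n)%g x).
Proof.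
move=> hg x; elim: n => [|n IHn]; first by rewrite /= expg0 gal_id.
by rewrite iterS IHn hg expgSr galM ?memvf.
Qed.

Lemma lift_torsion x (g : gal_of {:L}) : (forall y, tw (false, x) (j y) = j (g y)) ->
  exists n, (g ^+ (3 ^ n))%g = 1%g.
Proof.
move=> hg; have [b gb] := L_gen j; have [n nP] := Alg_torsion x (alg_ext jE b).
exists n; apply/eqP/gal_eqP => y _; have [p ->] := gen_horner gb y.
by rewrite !gal_horner gal_id; congr _.[_]; apply: (fmorph_inj j); rewrite -(iter_lift _ hg).
Qed.

Lemma j_fixed x : (forall h, fixE h -> tw h (j x) = j x) -> exists c, x = in_alg L c.
Proof. by move=> /gal[c cE]; exists c; apply: (fmorph_inj j); rewrite jE. Qed.

Definition ii : Om := cst 'i.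

Definition has_i : Prop := exists x, ii = io x.

Lemma tw_ii h : tw h ii = if h.1 then - ii else ii.
Proof.
rewrite /ii /cst tw_mono chr_0 mul1r; case: h => [[]] x //=.
by rewrite conjCi; exact: (rmorphN (@cst algC) 'i).
Qed.

Lemma ii_sqr : ii * ii = -1.
Proof. by rewrite /ii -rmorphM -expr2 sqrCi rmorphN rmorph1. Qed.

Lemma fixE_true : ~ has_i -> exists2 s, fixE s & s.1.
Proof.
move=> ni; apply: contrapT => ns; apply: ni; apply: gal => h hP; rewrite tw_ii.
by case: ifP => // h1; case: ns; exists h.
Qed.

Lemma fixE_false h : has_i -> fixE h -> h.1 = false.
Proof.
move=> [x xE] /(_ x); rewrite -xE tw_ii; case: h.1 => // /eqP.
rewrite eq_sym -subr_eq0 opprK -mulr2n /ii -(rmorphMn (@cst algC)) fmorph_eq0.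
by rewrite mulrn_eq0 /= (negPf (neq0Ci _)).
Qed.

(** The stabiliser is generated by the characters in it and any one element [s] of it outside
    them. *)
Lemma gal_split s z : fixE s -> s.1 -> tw s z = z ->
  (forall x, fixE (false, x) -> tw (false, x) z = z) -> exists x, z = io x.
Proof.
move=> sP s1 sz xz; apply: gal => h hP; have [h1|h1] := boolP h.1; last first.
  by case: h hP h1 => [[]] x //= hP _; apply: xz.
have : tw (gautm (gauti s) h) z = z.
  move: (fixEM (fixEV sP) hP); rewrite /gautm /= s1 h1 /= => tP; exact: xz.
by rewrite -twM => /(congr1 (tw s)); rewrite twVK sz.
Qed.

(** An element with conjugation inverts the characters, so in an abelian quotient the image of a
    character has order dividing both 2 and a power of 3. What is left is generated by the
    involution [gs]. *)
Lemma abelian_dim : ~ has_i -> abelian 'Gal({:L} / 1) -> (\dim {:L} <= 2)%N.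
Proof.
move=> ni /centsP ab; have [s sP s1] := fixE_true ni; have [gs gsG gsE] := gal_lift sP.
have tfix x : fixE (false, x) -> forall y, tw (false, x) (j y) = j y.
  move=> xP y; have [g gG gE] := gal_lift xP.
  have g2 : (g * g = 1)%g.
    apply: (mulgI gs); rewrite mulg1 mulgA -(ab g gG gs gsG) -mulgA; apply/eqP/gal_eqP => u _.
    apply: (fmorph_inj j); rewrite !galM ?memvf // -gE -!gsE -gE.
    by case: (s) s1 => [[]] w // _; rewrite tw_inv.
  have [n gn] := lift_torsion gE; have g1 : g = 1%g.
    apply/eqP; rewrite -order_eq1 -dvdn1.
    have : (#[g]%g %| gcdn 2 (3 ^ n))%N by rewrite dvdn_gcd !order_dvdn expgS expg1 g2 gn !eqxx.
    by rewrite (eqP (_ : coprime 2 (3 ^ n))) // coprimeXr.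
  by rewrite gE g1 gal_id.
have fix1 : (fixedField <[gs]>%g <= 1%AS)%VS.
  apply/subvP => x /fixedFieldP-/(_ (memvf x) gs (cycle_id gs)) gx.
  suff [c ->] : exists c, x = in_alg L c by rewrite rpredZ // rpred1.
  have [|c cE] := gal_split sP s1 _ (fun y yP => tfix y yP x); first by rewrite gsE gx.
  by exists c; apply: (fmorph_inj j); rewrite jE.
have <- : #[gs]%g = \dim {:L}.
  rewrite orderE dim_fixedField; have -> : \dim (fixedField <[gs]>%g) = 1%N.
    by apply/eqP; rewrite eqn_leq adim_gt0 andbT (leq_trans (dimvS fix1)) // dimv1.
  by rewrite divn1.
apply: dvdn_leq => //; rewrite order_dvdn; apply/gal_eqP => x _.
apply: (fmorph_inj j); rewrite gal_id expgS expg1 galM ?memvf // -!gsE.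
by case: (s) s1 => [[]] w // _; rewrite tw_true2.
Qed.

(** The stabiliser consists of characters, so a nontrivial element of the Galois group has 3-power
    order, and this order divides [p]. *)
Lemma cyclic_prime_dim p : has_i -> prime p -> \dim {:L} = p -> p = 3.
Proof.
move=> hi pp dp; have [b gb] := L_gen j.
have [h hP hb] : exists2 h, fixE h & tw h (j b) != j b.
  apply: contrapT => nh; have [h hP|c bE] := @j_fixed b.
    by apply/eqP; apply: contrapT => /negP hb; case: nh; exists h.
  have : \dim {:L} = 1%N; last by rewrite dp => p1; rewrite p1 in pp.
  have sub : ({:L} <= 1%AS)%VS.
    by rewrite -gb (Fadjoin_idP _) ?subvv // bE; exact: (rpredZ _ (rpred1 _)).
  by apply/eqP; rewrite eqn_leq adim_gt0 andbT (leq_trans (dimvS sub)) // dimv1.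
have h1 := fixE_false hi hP; case: h hP hb h1 => [[]] x //= xP xb _.
have [g gG gE] := gal_lift xP; have [n gn] := lift_torsion gE.
have gdvd : (#[g]%g %| p)%N
  by rewrite -dp (_ : \dim {:L} = #|'Gal({:L} / 1)%g|) ?order_dvdG // -galois_dim // dimv1 divn1.
have g1 : #[g]%g != 1%N by apply: contraNneq xb => /eqP; rewrite order_eq1 gE => /eqP->; rewrite gal_id.
have : (#[g]%g %| 3 ^ n)%N by rewrite order_dvdn gn.
move/(prime_nt_dvdP pp g1): gdvd => ->.
by rewrite Euclid_dvdX // => /andP[]; rewrite dvdn_prime2 // => /eqP.
Qed.

End Galois.
End Package.

(** * Squares, cubes and Kummer theory *)

Lemma Om_natr_eq0 n : (n%:R == 0 :> Om) = (n == 0)%N.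
Proof. by rewrite -(rmorph_nat (@cst algC)) fmorph_eq0 pnatr_eq0. Qed.

Lemma Om_oppr_id (b : Om) : - b = b -> b = 0.
Proof.
move=> /eqP; rewrite eq_sym -subr_eq0 opprK -mulr2n -mulr_natr mulf_eq0 Om_natr_eq0 orbF.
by move/eqP.
Qed.

(** A character acts on [b] with odd order, so it cannot map [b] to [- b]. *)
Lemma sqrt_fixed (x : chr) (b : Om) : Alg b ->
  tw (false, x) (b ^+ 2) = b ^+ 2 -> tw (false, x) b = b.
Proof.
move=> ab; rewrite rmorphXn /= => /eqP; rewrite eqf_sqr => /orP[/eqP//|/eqP bN].
have it n : iter n (tw (false, x)) b = (-1) ^+ n * b.
  by elim: n => [|n IHn] /=; rewrite ?expr0 ?mul1r // IHn rmorphM rmorphXn rmorphN1 /= bN exprSr -mulrA mulN1r.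
have [n nP] := Alg_torsion x ab.
move: nP; rewrite it -signr_odd oddX orbT expr1 mulN1r => /Om_oppr_id->; exact: rmorph0.
Qed.

Definition om : Om := cst (z3 1).

Lemma om_prim : 3.-primitive_root om.
Proof. by rewrite fmorph_primitive_root; apply: (z3_prim 1). Qed.

Lemma om3 : om ^+ 3 = 1. Proof. exact: prim_expr_order om_prim. Qed.

Lemma om_neq1 : om != 1.
Proof. by rewrite -[om]expr1 -(prim_order_dvd om_prim). Qed.

Lemma tw_om x : tw (false, x) om = om. Proof. exact: tw_cst. Qed.

Section Package.
Variables (E : fieldType) (io : {rmorphism E -> Om}).
Hypothesis gal : gal_closed io.
Hypothesis alg : forall x, Alg (io x).

Lemma Alg_sqrt (z : Om) (a : E) : z ^+ 2 = io a -> Alg z.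
Proof.
move=> za; apply: (Alg_over alg (p := 'X^2 - a%:P)).
  by rewrite -size_poly_gt0 size_XnsubC.
by rewrite /root rmorphB /= map_polyXn map_polyC !hornerE za subrr.
Qed.

Lemma sqrt_Om (z : Om) : exists b, b ^+ 2 = z.
Proof.
have [|b] := @series_root _ ('X^2 - z%:P); first by rewrite size_XnsubC.
by rewrite /root !hornerE subr_eq0 => /eqP; exists b.
Qed.

Section Real.
Hypothesis no_i : ~ has_i io.

(** A square root [b] of [a] is fixed by the characters and is kept or negated by [s]; accordingly
    [b] or [ii * b] lies in [E]. *)
Lemma real_squares (a : E) : exists e, a = e ^+ 2 \/ a = - e ^+ 2.
Proof.
have [s sP s1] := fixE_true gal no_i; have [b ba] := sqrt_Om (io a).
have bx x : fixE io (false, x) -> tw (false, x) b = b.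
  by move=> xP; apply: sqrt_fixed; rewrite ?ba //; apply: Alg_sqrt ba.
have : (tw s b) ^+ 2 == b ^+ 2 by rewrite -rmorphXn /= ba sP.
rewrite eqf_sqr => /orP[/eqP sb|/eqP sb].
  have [e eE] := gal_split gal sP s1 sb bx; exists e; left.
  by apply: (fmorph_inj io); rewrite rmorphXn /= -eE.
have [|x xP|e eE] := gal_split gal sP s1 (z := ii * b).
- by rewrite rmorphM /= tw_ii s1 sb mulrNN.
- by rewrite rmorphM /= tw_ii bx.
exists e; right; apply: (fmorph_inj io); rewrite rmorphN rmorphXn /= -eE exprMn.
by rewrite [ii ^+ 2]ii_sqr mulN1r opprK.
Qed.

(** The sum is the norm of [w] from E(i). A square root [u] of [w] is fixed by the characters, so
    [u * tw s u] lies in [E] and squares to that norm. *)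
Lemma sum_squares (a b : E) : exists c, a ^+ 2 + b ^+ 2 = c ^+ 2.
Proof.
have [s sP s1] := fixE_true gal no_i; pose w := io a + ii * io b.
have [u uw] := sqrt_Om w.
have Aii : Alg ii by apply: (Alg_sqrt (a := -1)); rewrite [ii ^+ 2]ii_sqr rmorphN1.
have au : Alg u.
  apply: (Alg_root (p := 'X^2 - w%:P)); first by rewrite -size_poly_gt0 size_XnsubC.
    by rewrite /root !hornerE uw subrr.
  have Aw : Alg w by apply: algebraic_add (alg _) _; apply: algebraic_mul Aii (alg _).
  move=> i; rewrite coefB coefXn coefC; apply: algebraic_sub.
    by case: (i == 2); [exact: algebraic1 | exact: algebraic0].
  by case: ifP => _; [exact: Aw | exact: algebraic0].
have ux x : fixE io (false, x) -> tw (false, x) u = u.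
  move=> xP; apply: sqrt_fixed => //; rewrite uw rmorphD rmorphM /= tw_ii.
  by rewrite !xP.
have [||c cE] := gal_split gal sP s1 (z := u * tw s u).
- rewrite rmorphM /= mulrC; congr (_ * _).
  by case: (s) s1 => [[]] y // _; rewrite tw_true2.
- move=> x xP; rewrite rmorphM /= ux //; congr (_ * _).
  by case: (s) s1 => [[]] y // _; rewrite -{1}(ux x xP) tw_inv.
exists c; apply: (fmorph_inj io); rewrite rmorphD !rmorphXn /= -cE exprMn uw.
have -> : tw s u ^+ 2 = io a - ii * io b.
  by rewrite -(rmorphXn (tw s)) uw rmorphD rmorphM /= tw_ii s1 !sP mulNr.
rewrite (_ : _ * _ = io a ^+ 2 - (ii * ii) * io b ^+ 2); last by rewrite /w; ring.
by rewrite ii_sqr mulN1r opprK.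
Qed.

(** Otherwise [a / b] would be a square root of -1. *)
Lemma sum_squares_eq0 (a b : E) : a ^+ 2 + b ^+ 2 = 0 -> a = 0 /\ b = 0.
Proof.
have [->|b0] := eqVneq b 0.
  by rewrite expr0n addr0 => /eqP; rewrite sqrf_eq0 => /eqP.
move=> ab; case: no_i; have : (io (a / b)) ^+ 2 == ii ^+ 2.
  rewrite [ii ^+ 2]ii_sqr -rmorphXn -(rmorphN1 io); apply/eqP; congr (io _).
  apply: (mulIf (expf_neq0 2 b0)).
  rewrite expr_div_n divfK ?expf_neq0 // mulN1r; apply/eqP; rewrite -addr_eq0; exact/eqP.
rewrite eqf_sqr => /orP[/eqP e|/eqP e]; first by exists (a / b).
by exists (- (a / b)); rewrite rmorphN e opprK.
Qed.

End Real.

Section Imaginary.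
Hypothesis hi : has_i io.

Lemma fix_false h : fixE io h -> h = (false, h.2).
Proof. by move=> hP; have := fixE_false hi hP; case: h hP => [] [] x. Qed.

Lemma omE_ex : exists w, om = io w.
Proof. by apply: gal => h hP; rewrite (fix_false hP) tw_om. Qed.

(** The stabiliser multiplies a cube root [u] by cube roots of unity; the value of [u] is 0, where
    characters are trivial, so its leading coefficient is fixed and the multiplier is 1. *)
Lemma cube_of_unit (a : E) : a != 0 -> vl (io a) = 0 -> exists e, a = e ^+ 3.
Proof.
move=> a0 va; have [|u] := @series_root _ ('X^3 - (io a)%:P); first by rewrite size_XnsubC.
rewrite /root !hornerE subr_eq0 => /eqP ua.
have u0 : u != 0 by apply: contra_neq a0 => u0; apply/eqP; rewrite -(fmorph_eq0 io) -ua u0 expr0n.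
have vu : vl u = 0.
  apply: ht_eq0; have := congr1 ht va; rewrite -ua vlX // htMn ht0 => /eqP.
  by rewrite mulrn_eq0 /= => /eqP.
have [h hP|e eE] := gal (z := u).
  have r3 : (tw h u / u) ^+ 3 = 1 by rewrite expr_div_n -rmorphXn /= ua hP mulfV // fmorph_eq0.
  have [i iE] := prim_rootP om_prim r3.
  have hu : tw h u = om ^+ i * u by rewrite -iE divfK.
  have hE : om ^+ i = mono (z3 1 ^+ i) 0 by rewrite -[RHS]/(cst _) rmorphXn.
  have := congr1 (fun f : Om => f 0) hu.
  rewrite hE cf_monoM subr0 (fix_false hP) twE chr_0 mul1r /= -[LHS]mul1r => /mulIf E1.
  rewrite -(fix_false hP) hu hE -E1; first by rewrite mono1 mul1r.
  by rewrite -{1}vu vl_lead.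
by exists e; apply: (fmorph_inj io); rewrite rmorphXn /= -eE.
Qed.

Lemma cube_of_val (a c : E) : a != 0 -> c != 0 -> vl (io a) = vl (io c) *+ 3 -> exists e, a = e ^+ 3.
Proof.
move=> a0 c0 va; have ioc : io c != 0 by rewrite fmorph_eq0.
have [||e eE] := @cube_of_unit (a / c ^+ 3).
- by rewrite mulf_neq0 ?invr_eq0 ?expf_neq0.
- rewrite fmorph_div rmorphXn /= vlM ?fmorph_eq0 ?invr_eq0 ?expf_neq0 // vlV ?expf_neq0 //.
  by rewrite vlX // va subrr.
by exists (e * c); rewrite exprMn -eE divfK // expf_neq0.
Qed.

Lemma irreducible_dvd (q p : {poly E}) b : irreducible_poly q ->
  root (map_poly io q) b -> root (map_poly io p) b -> q %| p.
Proof.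
move=> [sq irr] qb pb; have [/eqP c|nc] := boolP (size (gcdp q p) == 1).
  have /Bezout_eq1_coprimepP[[u v] /= uv] : coprimep q p by rewrite /coprimep c.
  have := congr1 (fun r => (map_poly io r).[b]) uv.
  rewrite rmorphD !rmorphM rmorph1 /= hornerD !hornerM (eqP qb) (eqP pb) !mulr0 addr0 hornerC.
  by move=> /esym/eqP; rewrite oner_eq0.
by have := irr _ nc (dvdp_gcdl q p) => /eqp_dvdl <-; apply: dvdp_gcdr.
Qed.

(* Kummer theory by the Lagrange resolvent of a root of q. *)
Lemma cubic_kummer (q : {poly E}) : irreducible_poly q -> size q = 4 ->
  exists (P : {poly E}) (al : E), q %| P ^+ 3 - al%:P /\ forall c, ~~ (q %| P - c%:P).
Proof.
move=> iq sq; have [|be qb] := @Om_root _ io q; first by rewrite sq.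
have q0 : q != 0 by rewrite -size_poly_gt0 sq.
have Ab : Alg be := Alg_over alg q0 qb.
have [O uO OP] := finite_orbit io Ab.
have sO : size O = 3 by apply: succn_inj; rewrite -(irreducible_orbit gal iq uO OP qb).
have bO : be \in O by apply/OP; exists gaut1; [apply: fixE1 | rewrite tw1].
have inO h w : fixE io h -> w \in O -> tw h w \in O.
  move=> hP /OP[k kP ->]; apply/OP; exists (gautm h k); [exact: fixEM | by rewrite twM].
have comm h k w : fixE io h -> fixE io k -> tw h (tw k w) = tw k (tw h w).
  by move=> hP kP; rewrite (fix_false hP) (fix_false kP) tw_comm.
have inj h := can_inj (twK h).
have [h hP hb] : exists2 h, fixE io h & tw h be != be.
  apply: contrapT => nh; have : (size O <= 1)%N; last by rewrite sO.
  apply: (@uniq_leq_size _ O [:: be] uO) => w /OP[k kP ->]; rewrite inE.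
  by apply: contrapT => /negP kb; case: nh; exists k.
(* If [h] exchanged two points, it would fix the third one, [tw k be]; as the stabiliser is
   commutative, it would then fix [be]. *)
have hhb : tw h (tw h be) != be.
  apply/eqP => e; have : (size O <= 2)%N; last by rewrite sO.
  apply: (@uniq_leq_size _ O [:: be; tw h be] uO) => w wO; rewrite !inE; apply: contrapT.
  move=> /negP; rewrite negb_or => /andP[wb whb].
  have [k kP wE] := (OP w).1 wO.
  have hw : tw h w \in [:: be; tw h be; w].
    have uu : uniq [:: be; tw h be; w] by rewrite /= !inE negb_or eq_sym hb eq_sym wb eq_sym whb.
    have sub : {subset [:: be; tw h be; w] <= O}.
      by move=> v; rewrite !inE => /or3P[] /eqP->; rewrite ?inO.
    by have [_ ->] := uniq_min_size uu sub (eq_leq sO); apply: inO.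
  move: hw; rewrite !inE => /or3P[/eqP hw|/eqP/inj hw|/eqP hw].
  - by case/eqP: whb; apply: (inj h); rewrite hw e.
  - by rewrite hw eqxx in wb.
  case/eqP: hb; apply: (inj k); rewrite comm // -wE //.
have uu : uniq [:: be; tw h be; tw h (tw h be)].
  rewrite /= !inE negb_or [be == _]eq_sym hb [be == _]eq_sym hhb /= andbT.
  by rewrite (inj_eq (inj h)) eq_sym.
have OE : O =i [:: be; tw h be; tw h (tw h be)].
  have sub : {subset [:: be; tw h be; tw h (tw h be)] <= O}.
    by move=> v; rewrite !inE => /or3P[] /eqP->; rewrite ?inO.
  by move=> v; have [_ ->] := uniq_min_size uu sub (eq_leq sO).
have h3 : tw h (tw h (tw h be)) = be.
  have := inO _ _ hP (inO _ _ hP (inO _ _ hP bO)); rewrite OE !inE => /or3P[/eqP//|/eqP/inj e|/eqP/inj/inj e].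
    by rewrite e eqxx in hhb.
  by rewrite e eqxx in hb.
have hom : tw h om = om by rewrite (fix_false hP) tw_om.
have o3 : om ^+ 3 = 1 := om3.
(* The Lagrange resolvent, an eigenvector of [tw h] with eigenvalue [c]. *)
pose eta (c : Om) := be + c ^+ 2 * tw h be + c * tw h (tw h be).
have heta c : c ^+ 3 = 1 -> tw h c = c -> tw h (eta c) = c * eta c.
  move=> c3 hc; have -> : c * eta c = c * be + c ^+ 3 * tw h be + c ^+ 2 * tw h (tw h be).
    by rewrite /eta; ring.
  by rewrite /eta !rmorphD rmorphM rmorphXn rmorphM /= hc h3 c3; ring.
(* One of the two nontrivial resolvents is nonzero: if both vanished, their difference would give
   [tw h (tw h be) = tw h be]. *)
have [c [c3 hc c1 e0]] : exists c, [/\ c ^+ 3 = 1, (forall x, tw (false, x) c = c), c != 1 & eta c != 0].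
  have [e0|e0] := eqVneq (eta om) 0.
    exists (om ^+ 2); split.
    - by rewrite -exprM mulnC exprM o3 expr1n.
    - by move=> x; rewrite rmorphXn /= tw_om.
    - by rewrite -(prim_order_dvd om_prim).
    apply/eqP => e1; have : (om - om ^+ 2) * (tw h (tw h be) - tw h be) = 0.
      have -> : (om - om ^+ 2) * (tw h (tw h be) - tw h be) =
         eta om - eta (om ^+ 2) + (om ^+ 3 * om - om) * tw h be by rewrite /eta; ring.
      by rewrite e0 e1 o3; ring.
    move/eqP; rewrite mulf_eq0 !subr_eq0 (inj_eq (inj h)) (negPf hb) orbF.
    by rewrite -{1}[om]expr1 (eq_prim_root_expr om_prim).
  exists om; split=> //; [exact: tw_om | exact: om_neq1].
have hck k : fixE io k -> tw k c = c by move=> kP; rewrite (fix_false kP) hc.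
have he : tw h (eta c) = c * eta c by apply: heta => //; apply: hck.
have he2 : tw h (tw h (eta c)) = c * (c * eta c) by rewrite he rmorphM /= hck // he.
have tweta k : fixE io k -> tw k (eta c) =
    tw k be + c ^+ 2 * tw k (tw h be) + c * tw k (tw h (tw h be)).
  by move=> kP; rewrite /eta !rmorphD rmorphM rmorphXn rmorphM /= hck.
have keta k : fixE io k -> tw k (eta c) =
    tw k be + c ^+ 2 * tw h (tw k be) + c * tw h (tw h (tw k be)).
  by move=> kP; rewrite tweta // !(comm k h).
have [P PE] : exists P, eta c = (map_poly io P).[be].
  by apply: (fixed_horner gal Ab) => k kP kb; rewrite keta // kb.
have [k kP|al alE] := gal (z := eta c ^+ 3).
  rewrite rmorphXn /= keta //; have := inO _ _ kP bO; rewrite OE !inE => /or3P[] /eqP->.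
  - by [].
  - by rewrite -tweta // he exprMn c3 mul1r.
  have -> : tw h (tw h be) + c ^+ 2 * tw h (tw h (tw h be)) + c * tw h (tw h (tw h (tw h be))) =
     c * (c * eta c).
    by rewrite -he2 tweta // !rmorphD rmorphM rmorphXn rmorphM /= hck.
  by rewrite mulrA exprMn -expr2 exprAC c3 expr1n mul1r.
exists P, al; split.
  apply: (irreducible_dvd iq qb).
  by rewrite /root rmorphB rmorphXn /= map_polyC !hornerE -PE alE subrr.
(* If [P] were constant modulo [q], the resolvent would lie in [E] and be fixed by [h], which
   multiplies it by [c != 1]. *)
move=> a; apply/negP => /dvdpP[r rE].
have /eqP : (map_poly io (P - a%:P)).[be] = 0 by rewrite rE rmorphM hornerM (eqP qb) mulr0.
rewrite rmorphB /= map_polyC hornerD hornerN hornerC -PE subr_eq0 => /eqP.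
move=> ea; case/eqP: c1; apply: (mulIf e0); rewrite -he ea hP mul1r //.
Qed.

End Imaginary.
End Package.

(** * Symbol algebras *)

Section SymbolAlgebra.
Variables (E : fieldType) (n : nat) (a b z : E).
Local Notation p := n.+2.
Local Notation Q := ('I_p * 'I_p)%type.
Implicit Types g h k : Q.

(** Structure constants of the monomials U^i V^j with i, j < p, where U^p = a, V^p = b and VU = z
    UV: the carries of the two additions modulo p give the powers of [a] and [b]. *)
Definition symbol_cocycle g h : E :=
  a ^+ ((g.1 + h.1) %/ p) * b ^+ ((g.2 + h.2) %/ p) * z ^+ (g.2 * h.1).

(* a and b only select the multiplication. *)
Definition symbol_alg (_ _ : E) of z ^+ p = 1 : Type := {ffun Q -> E^o}.

Hypothesis zp : z ^+ p = 1.
Local Notation A := (symbol_alg a b zp).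
Local Notation c := symbol_cocycle.

HB.instance Definition _ := Vector.copy A {ffun Q -> E^o}.

Lemma zX_mod m : z ^+ (m %% p) = z ^+ m.
Proof. by rewrite [in RHS](divn_eq m p) exprD mulnC exprM zp expr1n mul1r. Qed.

(** The 2-cocycle condition, equivalent to associativity. For the carries it says that the total
    carry in a sum of three digits does not depend on the bracketing. *)
Lemma symbol_cocycleP g h k : c g h * c (g + h) k = c h k * c g (h + k).
Proof.
have carry (i j l : 'I_p) : ((i + j) %/ p + (((i + j) %% p)%N + l) %/ p =
    (j + l) %/ p + (i + ((j + l) %% p)%N) %/ p)%N.
  have e1 (m q : nat) : (m %/ p + (m %% p + q) %/ p = (m + q) %/ p)%N.
    by rewrite [in RHS](divn_eq m p) -addnA divnMDl.
  by rewrite e1 (addnC i ((j + l) %% p)%N) e1 [in RHS]addnC addnA.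
rewrite /c /=.
have -> : a ^+ ((g.1 + h.1) %/ p) * b ^+ ((g.2 + h.2) %/ p) * z ^+ (g.2 * h.1) *
   (a ^+ (((g.1 + h.1) %% p + k.1) %/ p) * b ^+ (((g.2 + h.2) %% p + k.2) %/ p) *
     z ^+ ((g.2 + h.2) %% p * k.1)) =
   a ^+ ((g.1 + h.1) %/ p + ((g.1 + h.1) %% p + k.1) %/ p) *
   b ^+ ((g.2 + h.2) %/ p + ((g.2 + h.2) %% p + k.2) %/ p) *
   (z ^+ (g.2 * h.1) * z ^+ ((g.2 + h.2) %% p * k.1)).
  by rewrite !exprD; ring.
rewrite !carry !exprD [z ^+ (_ %% p * _)]exprM zX_mod -exprM.
rewrite [(g.2 * (_ %% p))%N]mulnC [z ^+ ((_ %% p) * _)]exprM zX_mod -exprM.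
have -> : z ^+ (g.2 * h.1) * z ^+ ((g.2 + h.2) * k.1) = z ^+ (h.2 * k.1) * z ^+ ((h.1 + k.1) * g.2).
  by rewrite -!exprD; congr (_ ^+ _); rewrite !mulnDl [(h.1 * _)%N]mulnC [(k.1 * _)%N]mulnC !addnA addnC addnA.
by ring.
Qed.

Definition symbol_mul (x y : A) : A := [ffun q : Q => \sum_h c h (q - h) * (x h * y (q - h))].
Definition symbol_one : A := [ffun q : Q => (q == 0)%:R].

Lemma symbol_mulE (x y : A) (q : Q) : symbol_mul x y q = \sum_h c h (q - h) * (x h * y (q - h)).
Proof. by rewrite ffunE. Qed.

Fact symbol_mulA : associative symbol_mul.
Proof.
move=> x y t; apply/ffunP=> q; rewrite !symbol_mulE.
under eq_bigr => h _ do rewrite symbol_mulE !mulr_sumr.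
under [RHS]eq_bigr => h _ do rewrite symbol_mulE mulr_suml mulr_sumr.
rewrite [RHS]exchange_big; apply: eq_bigr => h _ /=.
rewrite [RHS](reindex_inj (addrI h)) /=; apply: eq_bigr => k _.
rewrite [h + k - h]addrC addKr opprD addrA.
have := symbol_cocycleP h k (q - h - k); rewrite [k + _]addrC subrK => e.
transitivity (c k (q - h - k) * c h (q - h) * (x h * y k * t (q - h - k))); first by ring.
by rewrite -e; ring.
Qed.

Lemma cocycle0l g : c 0 g = 1.
Proof. by rewrite /c /= !add0n !divn_small // mul0n !expr0 !mulr1. Qed.

Lemma cocycle0r g : c g 0 = 1.
Proof. by rewrite /c /= !addn0 !divn_small // muln0 !expr0 !mulr1. Qed.

Fact symbol_mul1l : left_id symbol_one symbol_mul.
Proof.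
move=> x; apply/ffunP=> q; rewrite symbol_mulE (bigD1 (0 : Q)) //= big1 => [|h h0].
  by rewrite ffunE eqxx mul1r subr0 cocycle0l mul1r addr0.
by rewrite ffunE (negPf h0) mul0r mulr0.
Qed.

Fact symbol_mul1r : right_id symbol_one symbol_mul.
Proof.
move=> x; apply/ffunP=> q; rewrite symbol_mulE (bigD1 q) //= big1 => [|h h0].
  by rewrite ffunE subrr eqxx mulr1 cocycle0r mul1r addr0.
by rewrite ffunE subr_eq0 eq_sym (negPf h0) !mulr0.
Qed.

Fact symbol_mulDl : left_distributive symbol_mul +%R.
Proof.
move=> x y t; apply/ffunP=> q; rewrite [RHS]ffunE !symbol_mulE -big_split.
by apply: eq_bigr => h _; rewrite ffunE mulrDl mulrDr.
Qed.

Fact symbol_mulDr : right_distributive symbol_mul +%R.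
Proof.
move=> x y t; apply/ffunP=> q; rewrite [RHS]ffunE !symbol_mulE -big_split.
by apply: eq_bigr => h _; rewrite ffunE mulrDr mulrDr.
Qed.

Fact symbol_one_neq0 : symbol_one != 0.
Proof. by apply/eqP=> /ffunP/(_ 0)/eqP; rewrite !ffunE oner_eq0. Qed.

HB.instance Definition _ := GRing.Zmodule_isNzRing.Build A
  symbol_mulA symbol_mul1l symbol_mul1r symbol_mulDl symbol_mulDr symbol_one_neq0.

Fact symbol_scaleAl (s : E) (x y : A) : s *: (x * y) = (s *: x) * y.
Proof.
apply/ffunP=> q; rewrite [LHS]ffunE.
change (s * symbol_mul x y q = symbol_mul (s *: x) y q); rewrite !symbol_mulE mulr_sumr.
by apply: eq_bigr => h _; rewrite ffunE -[s *: x h]/(s * x h); ring.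
Qed.

Fact symbol_scaleAr (s : E) (x y : A) : s *: (x * y) = x * (s *: y).
Proof.
apply/ffunP=> q; rewrite [LHS]ffunE.
change (s * symbol_mul x y q = symbol_mul x (s *: y) q); rewrite !symbol_mulE mulr_sumr.
by apply: eq_bigr => h _; rewrite ffunE -[s *: y _]/(s * y (q - h)); ring.
Qed.

HB.instance Definition _ := GRing.Lmodule_isLalgebra.Build E A symbol_scaleAl.
HB.instance Definition _ := GRing.Lalgebra_isAlgebra.Build E A symbol_scaleAr.
HB.instance Definition _ := Algebra_isFalgebra.Build E A.

Lemma symbolM (x y : A) (q : Q) : (x * y) q = \sum_h c h (q - h) * (x h * y (q - h)).
Proof. exact: symbol_mulE. Qed.

Lemma symbol1 (q : Q) : (1 : A) q = (q == 0)%:R.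
Proof. by rewrite ffunE. Qed.

Definition sdelta g : A := [ffun q : Q => (q == g)%:R].

Lemma sdelta_sum (x : A) : x = \sum_g x g *: sdelta g.
Proof.
apply/ffunP=> q; rewrite sum_ffunE (bigD1 q) //= big1 => [|g gq].
  by rewrite !ffunE eqxx [_ *: _]mulr1 addr0.
by rewrite !ffunE eq_sym (negPf gq) [_ *: _]mulr0.
Qed.

Lemma symbol_dim : \dim {:A} = (p * p)%N.
Proof. by rewrite dimvf /dim /= card_prod !card_ord muln1. Qed.

Section Universal.
Variables (C : falgType E) (U V : C).
Hypotheses (Up : U ^+ p = a%:A) (Vp : V ^+ p = b%:A) (VU : V * U = z *: (U * V)).

Definition smon g : C := U ^+ g.1 * V ^+ g.2.

Lemma VUX (i j : nat) : V ^+ j * U ^+ i = z ^+ (j * i) *: (U ^+ i * V ^+ j).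
Proof.
have VUi m : V * U ^+ m = z ^+ m *: (U ^+ m * V).
  elim: m => [|m IHm]; first by rewrite !expr0 mulr1 mul1r scale1r.
  by rewrite [U ^+ _]exprS [z ^+ _]exprS mulrA VU -scalerAl -[U * V * _]mulrA IHm -scalerAr scalerA mulrA.
elim: j => [|j IHj]; first by rewrite !expr0 mulr1 mul1r scale1r.
have -> : V ^+ j.+1 * U ^+ i = V ^+ j * (V * U ^+ i) by rewrite exprSr mulrA.
by rewrite VUi -scalerAr mulrA IHj -scalerAl scalerA -mulrA -exprSr mulSn exprD.
Qed.

Lemma smonM g h : smon g * smon h = c g h *: smon (g + h).
Proof.
have Xmod (W : C) w m : W ^+ p = w%:A -> W ^+ m = w ^+ (m %/ p) *: W ^+ (m %% p).
  move=> Wp; rewrite [in LHS](divn_eq m p) exprD mulnC exprM Wp.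
  by rewrite exprZn expr1n -scalerAl mul1r.
have -> : smon g * smon h = z ^+ (g.2 * h.1) *: (U ^+ (g.1 + h.1) * V ^+ (g.2 + h.2)).
  by rewrite /smon !exprD -[LHS]mulrA [V ^+ g.2 * (_ * _)]mulrA VUX -scalerAl -scalerAr !mulrA.
rewrite (Xmod U a (g.1 + h.1)%N Up) (Xmod V b (g.2 + h.2)%N Vp) /=.
by rewrite -scalerAl -scalerAr !scalerA /c; congr (_ *: _); ring.
Qed.

Definition sphi (x : A) : C := \sum_g x g *: smon g.

Lemma sphi_linear : linear sphi.
Proof.
move=> s x y; rewrite /sphi scaler_sumr -big_split; apply: eq_bigr => g _ /=.
by rewrite !ffunE scalerDl scalerA.
Qed.

Lemma sphiM x y : sphi (x * y) = sphi x * sphi y.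
Proof.
rewrite /sphi mulr_suml; under eq_bigr => q _ do rewrite symbolM scaler_suml.
rewrite exchange_big; apply: eq_bigr => h _ /=.
rewrite mulr_sumr (reindex_inj (addrI h)) /=; apply: eq_bigr => k _.
rewrite [h + k - h]addrC addKr -scalerAl -scalerAr smonM !scalerA.
by congr (_ *: _); rewrite -[x h * y k * _]mulrC.
Qed.

Lemma sphi_delta g : sphi (sdelta g) = smon g.
Proof.
rewrite /sphi (bigD1 g) //= big1 => [|h hg]; first by rewrite ffunE eqxx scale1r addr0.
by rewrite ffunE (negPf hg) scale0r.
Qed.

Lemma sphi1 : sphi 1 = 1.
Proof.
have -> : (1 : A) = sdelta 0 by apply/ffunP => q; rewrite !ffunE.
by rewrite sphi_delta /smon /= !expr0 mulr1.
Qed.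

End Universal.
End SymbolAlgebra.

(** * Tensor products of symbol algebras *)

Section TensorHom.
Variables (E : fieldType) (B A C : falgType E).
Variables (f : {lrmorphism B -> C}) (g : {lrmorphism A -> C}).
Hypothesis fg : forall x y, f x * g y = g y * f x.
Local Notation b := (vbasis {:A}).

Lemma tensor_hom : exists h : {lrmorphism tensor B A -> C},
  forall u, h u = \sum_k f (u k) * g b`_k.
Proof.
pose h (u : tensor B A) := \sum_k f (u k) * g b`_k.
have hl : linear h.
  move=> s u v; rewrite /h scaler_sumr -big_split; apply: eq_bigr => k _ /=.
  by rewrite !ffunE linearP mulrDl scalerAl.
have hp x y : h (pure_tensor x y) = f x * g y.
  rewrite [y in RHS](coord_vbasis (memvf y)) linear_sum mulr_sumr; apply: eq_bigr => k _.
  by rewrite ffunE !linearZ /= -scalerAl -scalerAr.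
have h0 : h 0 = 0 by rewrite /h big1 // => k _; rewrite ffunE rmorph0 mul0r.
have hD : {morph h : u v / u + v} by move=> u v; rewrite -[u]scale1r hl !scale1r.
have h1 : h 1 = 1 by rewrite -[1]/(pure_tensor 1 1) hp !rmorph1 mulr1.
have hM : {morph h : u v / u * v}.
  move=> u v; rewrite (pure_tensor_span u) (pure_tensor_span v) mulr_suml.
  rewrite !(big_morph h hD h0) mulr_suml; apply: eq_bigr => i _.
  rewrite mulr_sumr (big_morph h hD h0) mulr_sumr; apply: eq_bigr => j _.
  rewrite [pure_tensor _ _ * _]pure_tensorM !hp !rmorphM.
  by rewrite -!mulrA; congr (_ * _); rewrite !mulrA fg.
pose H : {lrmorphism tensor B A -> C} := HB.pack h
  (GRing.isLinear.Build E (tensor B A) C _ h hl)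
  (GRing.isMonoidMorphism.Build (tensor B A) C h (conj h1 hM)).
by exists H.
Qed.

End TensorHom.

Section SymbolHom.
Variables (E : fieldType) (n : nat) (a b z : E).
Local Notation p := n.+2.
Local Notation Q := ('I_p * 'I_p)%type.
Hypotheses (zprim : p.-primitive_root z) (p0 : p%:R != 0 :> E) (a0 : a != 0) (b0 : b != 0).
Variable zp : z ^+ p = 1.
Local Notation A := (symbol_alg a b zp).

Lemma symbol_hom (C : falgType E) (U V : C) : U ^+ p = a%:A -> V ^+ p = b%:A ->
  V * U = z *: (U * V) -> exists g : {lrmorphism A -> C}, forall x, g x = sphi U V x.
Proof.
move=> Up Vp VU.
pose F : A -> C := sphi U V.
have Fl : linear F by apply: sphi_linear.
have F1 : F 1 = 1 by apply: sphi1.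
have FM : {morph F : x y / x * y} by move=> x y; apply: sphiM.
pose G : {lrmorphism A -> C} := HB.pack F (GRing.isLinear.Build E A C _ F Fl)
  (GRing.isMonoidMorphism.Build A C F (conj F1 FM)).
by exists G.
Qed.

Lemma root_sum m : \sum_(i < p) z ^+ (i * m) = if (p %| m)%N then p%:R else 0.
Proof.
rewrite (eq_bigr (fun i : 'I_p => (z ^+ m) ^+ i)) => [|i _]; last by rewrite -exprM mulnC.
have := prim_order_dvd zprim m; case: ifP => _ => [/esym/eqP->|/esym zm].
  by rewrite (eq_bigr (fun=> 1)) => [|i _]; rewrite ?expr1n // sumr_const card_ord.
have := subrX1 (z ^+ m) p; rewrite -exprM mulnC exprM zp expr1n subrr => /esym/eqP.
by rewrite mulf_eq0 subr_eq0 zm => /eqP.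
Qed.

(** The [T i] are eigenvectors of conjugation by [V]. Averaging V^m (sum of the T i) V^(p - m) with
    weights z^(- m k) projects onto the eigenvalue z^k, since p is invertible; [V ^+ (p - m)]
    inverts [V ^+ m] up to the scalar [c]. *)
Lemma eigen_sum (C : falgType E) (I : finType) (T : I -> C) (e : I -> 'I_p) (c : E) (V : C) :
  c != 0 -> V ^+ p = c%:A -> (forall i, V * T i = z ^+ e i *: (T i * V)) ->
  \sum_i T i = 0 -> forall k, \sum_(i | e i == k) T i = 0.
Proof.
move=> c0 Vp VT T0 k.
have VTm m i : V ^+ m * T i = z ^+ (m * e i) *: (T i * V ^+ m).
  elim: m => [|m IHm]; first by rewrite !expr0 mulr1 mul1r scale1r.
  have -> : V ^+ m.+1 * T i = V * (V ^+ m * T i) by rewrite exprS mulrA.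
  by rewrite IHm -scalerAr mulrA VT -scalerAl scalerA -mulrA -exprS mulSn exprD mulrC.
have : \sum_(m < p) z ^+ (m * (p - k)) *: (V ^+ m * (\sum_i T i) * V ^+ (p - m)) = 0.
  by rewrite big1 // => m _; rewrite T0 mulr0 mul0r scaler0.
have -> : \sum_(m < p) z ^+ (m * (p - k)) *: (V ^+ m * (\sum_i T i) * V ^+ (p - m)) =
   \sum_i (c * \sum_(m < p) z ^+ (m * (p - k + e i))) *: T i.
  under eq_bigr => m _ do rewrite mulr_sumr mulr_suml scaler_sumr.
  rewrite exchange_big; apply: eq_bigr => i _; rewrite mulr_sumr scaler_suml.
  apply: eq_bigr => m _; rewrite VTm -scalerAl -mulrA -exprD subnKC ?(ltnW (ltn_ord m)) //.
  by rewrite Vp -scalerAr mulr1 !scalerA mulnDr exprD; congr (_ *: _); ring.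
rewrite (bigID (fun i => e i == k)) /= [X in _ + X]big1 ?addr0 => [|i ek]; last first.
  rewrite root_sum; case: ifP => [|_]; last by rewrite mulr0 scale0r.
  move=> pd; case/eqP: ek; apply/val_inj => /=.
  have : ((p - k + e i) + k == 0 + k %[mod p])%N by rewrite eqn_modDr mod0n.
  by rewrite addnAC subnK ?(ltnW (ltn_ord k)) // modnDl add0n !modn_small // => /eqP.
rewrite (eq_bigr (fun i => (c * p%:R) *: T i)) => [|i /eqP->]; last first.
  by rewrite root_sum subnK ?(ltnW (ltn_ord k)) // dvdnn.
rewrite -scaler_sumr => /eqP; rewrite scaler_eq0 mulf_eq0 (negPf c0) (negPf p0) /=.
by move/eqP.
Qed.

(** Conjugation by [V] and then by [U] separates the terms [f (w q) * smon U V q], and the monomials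
    are invertible. The clause on commutation allows the lemma to be iterated. *)
Lemma tensor_symbol_inj (B C : falgType E) (f : {lrmorphism B -> C}) (U V : C) :
  U ^+ p = a%:A -> V ^+ p = b%:A -> V * U = z *: (U * V) ->
  (forall x, f x * U = U * f x) -> (forall x, f x * V = V * f x) -> injective f ->
  exists h : {lrmorphism tensor B A -> C}, injective h /\
    forall W, (forall x, f x * W = W * f x) -> U * W = W * U -> V * W = W * V ->
      forall u, h u * W = W * h u.
Proof.
move=> Up Vp VU fU fV finj; have [g gE] := symbol_hom Up Vp VU.
have commX (x W : C) m : x * W = W * x -> x * W ^+ m = W ^+ m * x.
  by move=> xW; apply: commrX.
have fM x q : f x * smon U V q = smon U V q * f x.
  by rewrite /smon mulrA (commX _ _ _ (fU x)) -!mulrA (commX _ _ _ (fV x)).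
have [x y|h hE] := @tensor_hom E B A C f g.
  rewrite gE /sphi mulr_sumr mulr_suml; apply: eq_bigr => q _.
  by rewrite -scalerAr -scalerAl fM.
exists h; split; last first.
  move=> W fW UW VW u; rewrite hE mulr_suml mulr_sumr; apply: eq_bigr => k _.
  rewrite -mulrA; have -> : g (vbasis {:A})`_k * W = W * g (vbasis {:A})`_k.
    rewrite gE /sphi mulr_sumr mulr_suml; apply: eq_bigr => q _.
    rewrite -scalerAr -scalerAl; congr (_ *: _); rewrite /smon -mulrA.
    have -> : V ^+ q.2 * W = W * V ^+ q.2 by apply/esym/commX.
    by rewrite mulrA (_ : U ^+ q.1 * W = W * U ^+ q.1) ?mulrA //; apply/esym/commX.
  by rewrite mulrA fW -mulrA.
suff hinj u : h u = 0 -> u = 0.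
  by move=> u v uv; apply/eqP; rewrite -subr_eq0; apply/eqP/hinj; rewrite linearB /= uv subrr.
pose bs := vbasis {:A}.
(* Coordinates of [u] in the basis of monomials, whereas [tensor] uses those of [vbasis]. *)
pose w (q : Q) : B := \sum_(k < \dim {:A}) ((bs`_k : A) q) *: u k.
have hw : h u = \sum_q f (w q) * smon U V q.
  rewrite hE; under [RHS]eq_bigr => q _ do rewrite linear_sum mulr_suml.
  rewrite [RHS]exchange_big; apply: eq_bigr => k _; rewrite gE /sphi mulr_sumr.
  by apply: eq_bigr => q _; rewrite linearZ /= -scalerAl -scalerAr.
rewrite hw => T0; pose T q := f (w q) * smon U V q.
have w0 q : w q = 0.
  have VT r : V * T r = z ^+ (r.1 : 'I_p) *: (T r * V).
    suff e : V * smon U V r = z ^+ r.1 *: (smon U V r * V).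
      by rewrite /T mulrA -fV -mulrA e -scalerAr mulrA.
    have := VUX VU r.1 1; rewrite !expr1 mul1n => VU1.
    by rewrite /smon mulrA VU1 -scalerAl -!mulrA -exprS -exprSr.
  have := eigen_sum b0 Vp VT T0 q.1.
  pose T' r := if r.1 == q.1 then T r else 0.
  have -> : \sum_(i | i.1 == q.1) T i = \sum_r T' r by rewrite big_mkcond.
  move=> T'0.
  have UT r : U * T r = z ^+ (- r.2 : 'I_p) *: (T r * U).
    suff e : U * smon U V r = z ^+ (- r.2 : 'I_p) *: (smon U V r * U).
      by rewrite /T mulrA -fU -mulrA e -scalerAr mulrA.
    have := VUX VU 1 r.2; rewrite !expr1 muln1 => VU1.
    rewrite /smon -[X in _ = _ *: X]mulrA VU1 -scalerAr scalerA -exprD /=.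
    rewrite -[z ^+ _](zX_mod zp) modnDml subnK ?(ltnW (ltn_ord _)) // modnn expr0 scale1r.
    by rewrite !mulrA -exprS -exprSr.
  have UT' r : U * T' r = z ^+ (- r.2 : 'I_p) *: (T' r * U).
    by rewrite /T'; case: ifP => _; rewrite ?UT // mulr0 mul0r scaler0.
  have := eigen_sum a0 Up UT' T'0 (- q.2); rewrite (bigD1 q) //= big1 ?addr0 => [|r /andP[r2 rq]].
    rewrite /T' eqxx /T => fw; apply: finj; rewrite rmorph0.
    have : f (w q) * smon U V q * (V ^+ (p - q.2) * U ^+ (p - q.1)) = 0 by rewrite fw mul0r.
    rewrite /smon -!mulrA [V ^+ _ * (_ * _)]mulrA -exprD subnKC ?(ltnW (ltn_ord _)) // Vp.
    rewrite -scalerAl mul1r -!scalerAr -exprD subnKC ?(ltnW (ltn_ord _)) // Up -scalerAr mulr1.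
    by rewrite scalerA => /eqP; rewrite scaler_eq0 mulf_eq0 (negPf b0) (negPf a0) => /eqP.
  rewrite /T'; case: eqP => // r1; case/eqP: rq; move/eqP/oppr_inj: r2 => r2.
  by rewrite [LHS]surjective_pairing r1 r2 -surjective_pairing.
apply/ffunP => k; rewrite ffunE.
(* Back from the monomial basis to [vbasis]: each [u k] is a combination of the [w q]. *)
transitivity (\sum_(q : Q) coord bs k (sdelta a b zp q) *: w q); last first.
  by rewrite big1 // => q _; rewrite w0 scaler0.
under eq_bigr => q _ do rewrite scaler_sumr.
rewrite exchange_big /=.
have inner (l : 'I_(\dim {:A})) : \sum_(q : Q) coord bs k (sdelta a b zp q) *: (((bs`_l : A) q : E) *: u l) =
    (k == l)%:R *: u l.
  transitivity (\sum_(q : Q) coord bs k (((bs`_l : A) q : E) *: sdelta a b zp q) *: u l).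
    by apply: eq_bigr => q _; rewrite scalerA [in RHS]linearZ; congr (_ *: _); apply: mulrC.
  rewrite -scaler_suml -linear_sum -sdelta_sum /= coord_free ?(basis_free (vbasisP _)) //.
  by rewrite eq_sym.
rewrite (eq_bigr _ (fun l _ => inner l)) (bigD1 k) //= eqxx scale1r big1 ?addr0 // => l lk.
by rewrite eq_sym (negPf lk) scale0r.
Qed.

End SymbolHom.

(** * Brauer classes of symbol algebras *)

Section Splitting.
Variables (E : fieldType) (n : nat) (a b z : E).
Local Notation p := n.+2.
Hypotheses (zprim : p.-primitive_root z) (p0 : p%:R != 0 :> E) (a0 : a != 0) (b0 : b != 0).
Variable zp : z ^+ p = 1.
Local Notation A := (symbol_alg a b zp).

Definition symbol_pair (C : falgType E) (U V : C) : Prop :=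
  [/\ U ^+ p = a%:A, V ^+ p = b%:A & V * U = z *: (U * V)].

Lemma tensor_pow_hom (C : falgType E) (U V : nat -> C) m :
  (forall i, (i < m)%N -> symbol_pair (U i) (V i)) ->
  (forall i j, (i < j)%N -> (j < m)%N ->
    [/\ U i * U j = U j * U i, U i * V j = V j * U i, V i * U j = U j * V i
      & V i * V j = V j * V i]) ->
  exists f : {lrmorphism tensor_pow A m -> C}, injective f /\
    forall W, (forall i, (i < m)%N -> U i * W = W * U i /\ V i * W = W * V i) ->
      forall u, f u * W = W * f u.
Proof.
elim: m => [|m IHm] UV com.
  pose f (c : E^o) : C := c%:A.
  have fl : linear f by move=> s x y; rewrite /f scalerDl scalerA.
  have f1 : f 1 = 1 by apply: scale1r.
  have fM : {morph f : x y / x * y} by move=> x y; rewrite /f -scalerAl mul1r scalerA.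
  pose F : {lrmorphism E^o -> C} := HB.pack f
    (GRing.isLinear.Build E E^o C _ f fl) (GRing.isMonoidMorphism.Build E^o C f (conj f1 fM)).
  exists F; split=> [x y /eqP|W _ u]; last by rewrite /= /f -scalerAl -scalerAr mul1r mulr1.
  by rewrite /= /f -subr_eq0 -scalerBl scaler_eq0 oner_eq0 orbF subr_eq0 => /eqP.
have [i im|i j ij jm|f [finj fcom]] := IHm; [exact/UV/ltnW | exact/com/ltnW |].
have [Up Vp VU] := UV m (ltnSn m).
have [||h [hinj hcom]] := tensor_symbol_inj zprim p0 a0 b0 zp Up Vp VU _ _ finj.
- by apply: fcom => i im; have [-> _ -> _] := com i m im (ltnSn m).
- by apply: fcom => i im; have [_ -> _ ->] := com i m im (ltnSn m).
exists h; split=> // W WP u; apply: hcom.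
- by apply: fcom => i im; apply/WP/ltnW.
- by have [] := WP m (ltnSn m).
- by have [] := WP m (ltnSn m).
Qed.

Lemma dim_tensor_pow m : dim (tensor_pow A m) = ((p * p) ^ m)%N.
Proof.
elim: m => [|m IHm]; first by rewrite expn0.
rewrite expnSr -IHm -(symbol_dim a b zp) /= mulnC.
by rewrite [LHS]/dim /= card_ord.
Qed.

Lemma inj_lrmorph_bij (B C : falgType E) (f : {lrmorphism B -> C}) :
  injective f -> dim B = dim C -> bijective f.
Proof.
move=> finj dBC; pose F := linfun f.
have ker0 : lker F == 0%VS by apply/lker0P => x y; rewrite !lfunE; apply: finj.
have lim : limg F = {:C}%VS.
  apply/eqP; rewrite eqEdim subvf /= limg_dim_eq ?dimvf ?dBC //.
  by rewrite (eqP ker0) capv0.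
exists (fun y => (F^-1)%VF y) => [x|y]; first by rewrite -[f x](lfunE f) lker0_lfunK.
by rewrite -[LHS](lfunE f) limg_lfunVK // lim memvf.
Qed.

Lemma brauer_of_matrix (B : falgType E) (N : nat) (f : {lrmorphism B -> 'M[E]_N.+1}) :
  bijective f -> brauer_equiv B E^o.
Proof.
move=> [g fK gK]; pose F (x : 'M[B]_1) : 'M[E^o]_N.+1 := f (x ord0 ord0).
have Fz : zmod_morphism F by move=> x y; rewrite /F !mxE rmorphB.
have F1 : F 1 = 1 by rewrite /F mxE rmorph1.
have FM : {morph F : x y / x * y}.
  by move=> x y; rewrite /F mxE big_ord_recl big_ord0 addr0 rmorphM.
pose G : {rmorphism 'M[B]_1 -> 'M[E^o]_N.+1} := HB.pack F
  (GRing.isZmodMorphism.Build _ _ F Fz) (GRing.isMonoidMorphism.Build _ _ F (conj F1 FM)).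
exists 0%N, N, G; split.
  exists (fun y => \matrix_(i, j) g y) => [x|y] /=; last by rewrite /F mxE gK.
  by apply/matrixP => i j; rewrite mxE /F fK !ord1.
by move=> k x; rewrite /= /F mxE -scalerAl mul1r linearZ /= [k%:A](mulr1 k).
Qed.

(** * Monomial matrices splitting the p-th tensor power *)

Local Notation X := {ffun 'I_p -> 'I_p}.

Lemma card_X : #|{: X}| = (p ^ p).-1.+1.
Proof. by rewrite card_ffun !card_ord prednK // expn_gt0. Qed.

Definition ix (i : 'I_((p ^ p).-1.+1)) : X := enum_val (cast_ord (esym card_X) i).
Definition xi (x : X) : 'I_((p ^ p).-1.+1) := cast_ord card_X (enum_rank x).

Lemma xiK : cancel xi ix. Proof. by move=> x; rewrite /ix /xi cast_ordK enum_rankK. Qed.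
Lemma ixK : cancel ix xi. Proof. by move=> i; rewrite /ix /xi enum_valK cast_ordKV. Qed.

(** A weighted translation of the index group (Z/p)^p. Translations add up under multiplication, so
    matrix relations become identities between weights. *)
Definition mon (w : X -> E) (d : X) : 'M[E]_((p ^ p).-1.+1) :=
  \matrix_(i, j) (if ix j == ix i + d then w (ix i) else 0).

Lemma monM w d w' d' : mon w d * mon w' d' = mon (fun x => w x * w' (x + d)) (d + d').
Proof.
apply/matrixP => i j; rewrite !mxE (bigD1 (xi (ix i + d))) //= big1 => [|k ki].
  by rewrite !mxE xiK eqxx addr0 addrA; case: ifP; rewrite ?mulr0.
rewrite !mxE; case: ifP => [/eqP kE|_]; last by rewrite mul0r.
by case/eqP: ki; rewrite -kE ixK.
Qed.

Lemma eq_mon w w' d d' : w =1 w' -> d = d' -> mon w d = mon w' d'.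
Proof. by move=> ww' ->; apply/matrixP => i j; rewrite !mxE ww'. Qed.

Lemma monZ k w d : k *: mon w d = mon (fun x => k * w x) d.
Proof. by apply/matrixP => i j; rewrite !mxE; case: ifP; rewrite ?mulr0. Qed.

Lemma mon1 : mon (fun=> 1) 0 = 1.
Proof.
by apply/matrixP => i j; rewrite !mxE addr0 (can_eq ixK) eq_sym; case: eqP.
Qed.

Lemma monX w d m : mon w d ^+ m = mon (fun x => \prod_(l < m) w (x + d *+ l)) (d *+ m).
Proof.
elim: m => [|m IHm].
  by rewrite expr0 -mon1; apply: eq_mon => // x; rewrite big_ord0.
rewrite exprSr IHm monM; apply: eq_mon => [x|]; last by rewrite mulrSr.
by rewrite big_ord_recr.
Qed.

Lemma mon_pow_scalar w d k : d *+ p = 0 -> (forall x, \prod_(l < p) w (x + d *+ l) = k) ->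
  mon w d ^+ p = k%:A.
Proof.
move=> d0 wk; rewrite monX -mon1 monZ; apply: eq_mon => // x; by rewrite wk mulr1.
Qed.

(** Puts the product [t] along a cycle of Z/p at the single place [k]; the p-th power of the
    corresponding unit translation is then the scalar [t]. *)
Definition wt (k : 'I_p) (t : E) (y : 'I_p) : E := if y == k then t else 1.

Lemma wt_prod k t y : \prod_(l < p) wt k t (y + l) = t.
Proof.
rewrite (bigD1 (k - y)) //= big1 => [|l lk]; first by rewrite /wt addrC subrK eqxx mulr1.
by rewrite /wt; case: eqP => // e; case/eqP: lk; rewrite -e addrC addKr.
Qed.

Lemma wt_prodN k t y : \prod_(l < p) wt k t (y - l) = t.
Proof.
rewrite (bigD1 (y - k)) //= big1 => [|l lk]; first by rewrite /wt opprB addrC subrK eqxx mulr1.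
by rewrite /wt; case: eqP => // e; case/eqP: lk; rewrite -e opprB addrC subrK.
Qed.

Lemma zZD (x y : 'I_p) : z ^+ ((x + y)%R : 'I_p) = z ^+ x * z ^+ y.
Proof. by rewrite -exprD -[RHS](zX_mod zp). Qed.

Definition ev (i : 'I_p) : X := [ffun j => (j == i)%:R].
Definition dv : X := [ffun j => if j == 0 then 0 else -1].

Lemma charX (x : X) : x *+ p = 0.
Proof.
apply/ffunP => j; rewrite ffunMnE ffunE -mulr_natr.
by rewrite (_ : p%:R = 0 :> 'I_p) ?mulr0 // Zp_nat; apply/val_inj; exact: modnn.
Qed.

Lemma natZp (l : 'I_p) : (1 : 'I_p) *+ l = l.
Proof. exact: natr_Zp. Qed.

(** Origin of the formulas: in the tensor power, replace the pairs (U_i, V_i) by (U_i / U_0, V_i)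
    for i != 0 and (U_0, V_0 ... V_(p-1)). Now U_i / U_0 has p-th power 1 and the product of the V_i
    has p-th power b^p, so each new pair acts on E^p by a diagonal matrix and a weighted shift: U_i
    / U_0 is z^(x_i) and the product of the V_i is b z^(- x_0). Solving for V_0 gives [v0] and
    [dv]. *)
Definition UU (i : 'I_p) : 'M[E]_((p ^ p).-1.+1) :=
  mon (fun x => wt (-1) a (x 0) * (if i == 0 then 1 else z ^+ x i)) (ev 0).
Definition v0 (x : X) : E := b * z ^+ (- x 0 : 'I_p) * \prod_(i | i != 0) wt 0 b^-1 (x i).
Definition VV (i : 'I_p) : 'M[E]_((p ^ p).-1.+1) :=
  if i == 0 then mon v0 dv else mon (fun x => wt (-1) b (x i)) (ev i).

Lemma UU_p i : UU i ^+ p = a%:A.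
Proof.
apply: mon_pow_scalar => [|x]; first exact: charX.
rewrite big_split /= (eq_bigr (fun l : 'I_p => wt (-1) a (x 0 + l))) => [|l _]; last first.
  by rewrite ffunE ffunMnE ffunE eqxx natZp.
rewrite wt_prod; case: eqP => [_|/eqP i0]; first by rewrite big1 ?mulr1.
rewrite (eq_bigr (fun=> z ^+ x i)) => [|l _].
  by rewrite prodr_const card_ord -exprM mulnC exprM zp expr1n mulr1.
by rewrite ffunE ffunMnE ffunE (negPf i0) mul0rn addr0.
Qed.

Lemma VV_p i : VV i ^+ p = b%:A.
Proof.
rewrite /VV; case: eqP => [_|/eqP i0]; last first.
  apply: mon_pow_scalar => [|x]; first exact: charX.
  rewrite (eq_bigr (fun l : 'I_p => wt (-1) b (x i + l))) ?wt_prod // => l _.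
  by rewrite ffunE ffunMnE ffunE eqxx natZp.
apply: mon_pow_scalar => [|x]; first exact: charX.
rewrite big_split big_split /= prodr_const card_ord.
rewrite (eq_bigr (fun=> z ^+ (- x 0 : 'I_p))) => [|l _]; last first.
  by rewrite ffunE ffunMnE ffunE eqxx mul0rn addr0.
rewrite prodr_const card_ord -[X in _ * X * _]exprM mulnC exprM zp expr1n mulr1 exchange_big /=.
(* The constant factor of [v0] contributes b^p, and each of the p - 1 nonzero indices takes away one
   [b]. *)
rewrite (eq_bigr (fun=> b^-1)) => [|j j0]; last first.
  rewrite -[RHS](wt_prodN 0 _ (x j)); apply: eq_bigr => l _.
  by rewrite ffunE ffunMnE ffunE (negPf j0) mulNrn natZp.
rewrite prodr_const; have -> : #|[pred i : 'I_p | i != 0]| = n.+1.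
  by rewrite (cardC1 (0 : 'I_p)) card_ord.
by rewrite exprS mulrAC -mulrA -exprMn mulVf // expr1n mulr1.
Qed.

Lemma zN1 (x : 'I_p) : z ^+ (- x : 'I_p) * z ^+ x = 1.
Proof. by rewrite -zZD addNr expr0. Qed.

Lemma z1 : z ^+ (1%R : 'I_p) = z.
Proof. by rewrite -[RHS]expr1. Qed.

Lemma VU_rel i : VV i * UU i = z *: (UU i * VV i).
Proof.
rewrite /VV /UU; case: eqP => [_|/eqP i0]; rewrite !monM monZ; apply: eq_mon; try exact: addrC.
  move=> x; rewrite !mulr1 {1}/v0 /v0 !ffunE eqxx addr0.
  rewrite (eq_bigr (fun j => wt 0 b^-1 ((x + ev 0) j))) => [|j j0]; last first.
    by rewrite !ffunE (negPf j0) addr0.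
  rewrite opprD zZD.
  have -> : z ^+ ((-1)%R : 'I_p) = z^-1.
    have z0 : z != 0 by apply: contra_eq_neq zp => ->; rewrite expr0n eq_sym oner_eq0.
    by apply: (mulIf z0); rewrite mulVf // -{2}z1 zN1.
  have z0 : z != 0 by apply: contra_eq_neq zp => ->; rewrite expr0n eq_sym oner_eq0.
  by field.
have i0' : (0 == i) = false by rewrite eq_sym (negPf i0).
by move=> x; rewrite !ffunE (negPf i0) i0' eqxx !addr0 zZD z1; ring.
Qed.

Lemma UU_comm i j : UU i * UU j = UU j * UU i.
Proof.
rewrite /UU !monM; apply: eq_mon => // x; rewrite !ffunE eqxx.
have H (k : 'I_p) : (if k == 0 then 1 else z ^+ ((x k + (k == 0)%:R)%R : 'I_p)) = (if k == 0 then 1 else z ^+ x k).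
  by case: eqP => // _; rewrite addr0.
by rewrite !H; ring.
Qed.

Lemma VV_comm0 j : j != 0 -> VV 0 * VV j = VV j * VV 0.
Proof.
move=> j0; rewrite /VV eqxx (negPf j0) !monM; apply: eq_mon; last exact: addrC.
move=> x; rewrite /v0 !ffunE (negPf j0) [0 == j]eq_sym (negPf j0) addr0.
rewrite (bigD1 j) //= [in RHS](bigD1 j) //=.
rewrite [in RHS](eq_bigr (fun i => wt 0 b^-1 (x i))) => [|i /andP[_ ij]]; last first.
  by rewrite !ffunE (negPf ij) addr0.
rewrite !ffunE eqxx.
have w1 : wt 0 b^-1 (x j) * wt (-1) b (x j - 1) = 1.
  by rewrite /wt subr_eq addNr; case: eqP => _; rewrite ?mulVf ?mulr1.
have w2 : wt (-1) b (x j) * wt 0 b^-1 (x j + 1) = 1.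
  by rewrite /wt addr_eq0; case: eqP => _; rewrite ?mulfV ?mulr1.
transitivity (b * z ^+ ((- x 0)%R : 'I_p) * \prod_(i | (i != 0) && (i != j)) wt 0 b^-1 (x i) *
   (wt 0 b^-1 (x j) * wt (-1) b (x j - 1))); first by ring.
rewrite w1 -w2; ring.
Qed.

Lemma VV_comm i j : VV i * VV j = VV j * VV i.
Proof.
have [->|i0] := eqVneq i 0; have [->|j0] := eqVneq j 0 => //; first exact: VV_comm0.
  by rewrite VV_comm0.
have [->//|ij] := eqVneq i j.
rewrite /VV (negPf i0) (negPf j0) !monM; apply: eq_mon; last exact: addrC.
by move=> x; rewrite !ffunE (negPf ij) [j == i]eq_sym (negPf ij) !addr0 mulrC.
Qed.

Lemma UV_comm i j : i != j -> UU i * VV j = VV j * UU i.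
Proof.
move=> ij; rewrite /UU /VV; have [j0|j0] := eqVneq j 0.
  have i0 : i != 0 by rewrite -j0.
  rewrite (negPf i0) !monM; apply: eq_mon; last exact: addrC.
  move=> x; rewrite /v0 !ffunE eqxx (negPf i0) addr0 opprD !zZD.
  rewrite (eq_bigr (fun k => wt 0 b^-1 (x k))) => [|k k0]; last by rewrite !ffunE (negPf k0) addr0.
  by ring.
rewrite !monM; apply: eq_mon; last exact: addrC.
move=> x; rewrite !ffunE [0 == j]eq_sym (negPf j0) (negPf ij) !addr0.
by case: (i == 0); ring.
Qed.

(** The embedding of the tensor power into matrices of size p^p is bijective, both dimensions being
    p^(2p). *)
Lemma tensor_pow_split : brauer_equiv (tensor_pow A p) E^o.
Proof.
have [i ip|i j ij jp|f [finj _]] := @tensor_pow_hom 'M[E]_((p ^ p).-1.+1)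
    (fun i => UU (inord i)) (fun i => VV (inord i)) p.
- by split; [exact: UU_p | exact: VV_p | exact: VU_rel].
- have nij : (inord i : 'I_p) != inord j.
    by rewrite -val_eqE /= !inordK ?(ltn_eqF ij) // (ltn_trans ij).
  split; [exact: UU_comm | exact: UV_comm | | exact: VV_comm].
  by rewrite UV_comm // eq_sym.
apply: (@brauer_of_matrix _ _ f); apply: inj_lrmorph_bij => //.
rewrite dim_tensor_pow /dim /= prednK ?expn_gt0 //.
by rewrite expnMn.
Qed.

(** Commuting with U and V forces [z ^+ h.2 = 1] and [z ^+ h.1 = 1] at every nonzero coordinate
    [h]. *)
Lemma symbol_central : central A.
Proof.
apply/eqP; rewrite eqEsubv; apply/andP; split; last first.
  apply/subvP => y /vlineP[k ->]; rewrite memv_cap memvf; apply/centvP => w _.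
  by rewrite -scalerAl -scalerAr mul1r mulr1.
apply/subvP => x; rewrite memv_cap => /andP[_ /centvP xc].
pose d (g : 'I_p * 'I_p) := sdelta a b zp g.
have dl g q : (d g * x) q = symbol_cocycle a b z g (q - g) * x (q - g).
  rewrite symbolM (bigD1 g) //= big1 ?addr0 => [|h hg]; first by rewrite ffunE eqxx mul1r.
  by rewrite ffunE (negPf hg) mul0r mulr0.
have dr g q : (x * d g) q = symbol_cocycle a b z (q - g) g * x (q - g).
  rewrite symbolM (bigD1 (q - g)) //= big1 ?addr0 => [|h hg].
    by rewrite ffunE subKr eqxx mulr1.
  rewrite ffunE subr_eq; case: eqP => [qE|_]; last by rewrite !mulr0.
  by case/eqP: hg; rewrite qE addrC addKr.
have com g h : symbol_cocycle a b z g h * x h = symbol_cocycle a b z h g * x h.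
  have := congr1 (fun y : A => y (h + g)) (xc (d g) (memvf _)); rewrite dl dr addrK.
  by move=> <-.
have x0 h : h != 0 -> x h = 0.
  move=> h0; apply/eqP; apply: contraNT h0 => xh.
  have c1 := mulIf xh (com (1, 0) h); have c2 := mulIf xh (com (0, 1) h).
  have zi (i : 'I_p) : z ^+ i = 1 -> i = 0.
    move/eqP; rewrite -(prim_order_dvd zprim) => /dvdn_leq; case: (posnP i) => [i0 _|_ /(_ isT)].
      exact: val_inj.
    by rewrite ltnNge -ltnS ltn_ord.
  move: c1 c2; rewrite /symbol_cocycle /= !mul0n !muln0 !expr0 !muln1 !mul1n.
  rewrite ![(h.1 + _)%N]addnC ![(h.2 + _)%N]addnC !mulr1 -!mulrA => c1 c2.
  have ab0 i j : a ^+ i * b ^+ j != 0 by rewrite mulf_neq0 ?expf_neq0.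
  have h2 : h.2 = 0.
    apply: zi; apply: (mulfI (ab0 ((1 %% p + h.1) %/ p)%N ((0 + h.2) %/ p)%N)).
    by rewrite mulr1 -mulrA -c1.
  have h1 : h.1 = 0.
    apply: zi; apply: (mulfI (ab0 ((0 + h.1) %/ p)%N ((1 %% p + h.2) %/ p)%N)).
    by rewrite mulr1 -mulrA c2.
  by rewrite [h]surjective_pairing h1 h2.
suff -> : x = (x 0 : E) *: 1 by apply/vlineP; exists (x 0).
apply/ffunP => q; rewrite !ffunE; have [->|q0] := eqVneq q 0; first by rewrite [RHS]mulr1.
by rewrite (x0 _ q0) [RHS]mulr0.
Qed.

Section Domain.
Hypothesis dom : forall x y : A, x * y = 0 -> x = 0 \/ y = 0.

Lemma domain_unit (B : falgType E) : (forall x y : B, x * y = 0 -> x = 0 \/ y = 0) ->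
  forall x : B, x != 0 -> x \is a GRing.unit.
Proof.
move=> domB x x0.
have rinv (y : B) : y != 0 -> exists w, y * w = 1.
  move=> y0; have ker0 : lker (amull y) == 0%VS.
    apply/lker0P => u v; rewrite !lfunE /= => /eqP; rewrite -subr_eq0 -mulrBr => /eqP/domB[/eqP|/eqP].
      by rewrite (negPf y0).
    by rewrite subr_eq0 => /eqP.
  have : 1 \in limg (amull y).
    suff -> : limg (amull y) = fullv by rewrite memvf.
    by apply/eqP; rewrite eqEdim subvf /= limg_dim_eq // (eqP ker0) capv0.
  by case/memv_imgP => w _; rewrite lfunE /= => ->; exists w.
have [y xy] := rinv x x0.
have y0 : y != 0 by apply: contra_eq_neq xy => ->; rewrite mulr0 eq_sym oner_eq0.
have [w yw] := rinv y y0; apply/unitrP; exists y; split=> //.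
by rewrite -yw -[w]mul1r -xy -mulrA yw mulr1.
Qed.

Lemma symbol_simple : simple_alg A.
Proof.
move=> U AU UA; have [->|U0] := eqVneq U 0%VS; [by left | right].
have xU := memv_pick U; have x0 : vpick U != 0 by rewrite vpick0.
apply/eqP; rewrite eqEsubv subvf /=; apply/subvP => y _.
rewrite -[y](mulrVK (domain_unit dom x0)); apply: (subvP AU); exact: memv_mul (memvf _) xU.
Qed.

(** The preimage [e] of a matrix unit cuts out a corner that is one-dimensional over [E]. The linear
    map [phi] embeds [B] into this corner, because the entry [e i j * x * e i j] vanishes only for
    [x = 0]. *)
Lemma domain_not_split (B : falgType E) : (forall x y : B, x * y = 0 -> x = 0 \/ y = 0) ->
  brauer_equiv B E^o -> (\dim {:B} <= 1)%N.
Proof.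
move=> domB [m [N [f [fbij fZ]]]]; have [g fK gK] := fbij.
pose e00 : 'M[E^o]_N.+1 := delta_mx 0 0.
pose e := g e00; have fe : f e = e00 by rewrite /e gK.
have e0 : e != 0.
  apply/eqP => e0; have := congr1 (fun y : 'M[E^o]_N.+1 => y 0 0) fe.
  by rewrite e0 rmorph0 !mxE !eqxx => /esym/eqP; rewrite oner_eq0.
have [i [j eij]] : exists i j, e i j != 0.
  apply: contrapT => ne; case/eqP: e0; apply/matrixP => i j; rewrite mxE; apply/eqP.
  by apply: contrapT => /negP eij; apply: ne; exists i, j.
pose phi (x : B) : 'M[B]_m.+1 := e *m (x *: delta_mx j i) *m e.
have phiE x : phi x i j = e i j * x * e i j.
  rewrite /phi !mxE (bigD1 i) //= big1 ?addr0 => [|k ki].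
    rewrite !mxE (bigD1 j) //= big1 ?addr0 => [|k kj]; first by rewrite !mxE !eqxx mulr1.
    by rewrite !mxE (negPf kj) !mulr0.
  rewrite !mxE big1 ?mul0r // => l _; by rewrite !mxE (negPf ki) andbF !mulr0.
have phi0 x : phi x = 0 -> x = 0.
  move=> px; have := phiE x; rewrite px mxE => /esym/domB[/domB[/eqP|//]|/eqP]; by rewrite (negPf eij).
pose c x : E := f (x *: delta_mx j i) 0 0.
have fphi x : f (phi x) = c x *: e00.
  have -> : phi x = e * (x *: delta_mx j i) * e by [].
  rewrite !rmorphM /= fe; apply/matrixP => k l; rewrite mxE (bigD1 0) //= big1 ?addr0 => [|r r0].
    rewrite !mxE (bigD1 0) //= big1 ?addr0 => [|r r0].
      by rewrite !mxE eqxx andbT /= -/(c x); case: (k == 0); case: (l == 0);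
         rewrite ?mul0r ?mulr0 ?mul1r ?mulr1 //= ?mulr0 ?mulr1.
    by rewrite !mxE (negPf r0) andbF mul0r.
  by rewrite !mxE (negPf r0) mulr0.
have cz s x y : c (s *: x + y) = s * c x + c y.
  rewrite /c scalerDl; have -> : (s *: x) *: (delta_mx j i : 'M[B]_m.+1) = s%:A *: (x *: delta_mx j i).
    by rewrite scalerA -scalerAl mul1r.
  by rewrite rmorphD /= fZ !mxE [s%:A](mulr1 s).
have c0 x : c x = 0 -> x = 0.
  move=> cx; apply: phi0; apply: (can_inj fK); rewrite fphi cx scale0r rmorph0 //.
have c1 : c 1 != 0 by apply/eqP => /c0/eqP; rewrite oner_eq0.
apply: (leq_trans _ (eq_leq (dimv1 B))); apply: dimvS; apply/subvP => x _; apply/vlineP; exists (c x / c 1).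
apply/eqP; rewrite -subr_eq0 -scaleNr addrC; apply/eqP/c0.
by rewrite cz mulNr divfK // addNr.
Qed.

Lemma symbol_Br_p : ~ Br_p_trivial E p.
Proof.
move=> triv; have : (\dim {:A} <= 1)%N.
  apply: domain_not_split => //; apply: triv.
    by split; [exact: symbol_central | exact: symbol_simple].
  by exists 1%N; rewrite expn1; exact: tensor_pow_split.
by rewrite symbol_dim.
Qed.

End Domain.
End Splitting.

(** * Embeddings into division algebras *)

Section Roots.
Variable E : fieldType.

Lemma ahom_of_root (L : fieldExtType E) (D : falgType E) (q : {poly E}) (z : L) (w : D) :
  irreducible_poly q -> size q = (\dim {:L}).+1 ->
  horner_alg z q = 0 -> horner_alg w q = 0 -> inhabited 'AHom(L, D).
Proof.
move=> [sq irr] dq zq wq; have [m mE] := minPoly1 z.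
have ev p : (map_poly (in_alg L) p).[z] = horner_alg z p by [].
have mq : m %| q.
  rewrite -(dvdp_map (in_alg L)) -mE; apply: minPoly_dvdp; first by apply/polyOver1P; exists q.
  by rewrite /root ev zq.
have sm : size m = (adjoin_degree 1 z).+1 by rewrite -(size_map_poly (in_alg L)) -mE size_minPoly.
have mq' : m %= q by apply: irr mq; rewrite sm.
have gz : <<1; z>>%VS = {:L}%VS.
  apply/eqP; rewrite eqEdim subvf /= dim_Fadjoin dimv1 muln1 -ltnS -dq -sm.
  by rewrite (eqp_size mq').
have [|f fE] := ext_rmorph gz (phi := horner_alg w).
  move=> p pz; have : m %| p.
    rewrite -(dvdp_map (in_alg L)) -mE; apply: minPoly_dvdp; first by apply/polyOver1P; exists p.
    exact/eqP.
  by rewrite (eqp_dvdl _ mq') => /dvdpP[r ->]; rewrite rmorphM /= wq mulr0.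
have fl : scalable f.
  move=> k x; have [p ->] := gen_horner gz x.
  by rewrite -[k *: _]mulr_algl -(hornerC (k%:A) z) -(map_polyC (in_alg L)) -hornerM -rmorphM !fE mul_polyC /= linearZ /= mulr_algl.
pose F : {lrmorphism L -> D} := HB.pack (f : L -> D)
  (GRing.RMorphism.class f) (GRing.isScalable.Build E L D _ f fl).
exact: (inhabits (linfun_ahom F)).
Qed.

Lemma adjoin_sub (B : falgType E) (A : {aspace B}) (x : B) :
  1 \in A -> x \in A -> (<<1; x>> <= A)%VS.
Proof.
move=> A1 Ax; apply: agenv_sub_modl; first by rewrite -memvE.
by apply: subv_trans (asubv A); apply: prodvSl; rewrite subv_add -!memvE A1.
Qed.

Section Division.
Variable B : falgType E.
Hypothesis unitB : forall x : B, x != 0 -> x \is a GRing.unit.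

Lemma div_integral (x y : B) : x * y = 0 -> x = 0 \/ y = 0.
Proof.
move=> xy; have [->|x0] := eqVneq x 0; first by left.
by right; rewrite -[y](mulKr (unitB x0)) xy mulr0.
Qed.

(** Minimal polynomials in a possibly noncommutative division algebra; irreducibility comes from the
    absence of zero divisors. *)
Lemma min_poly_ex (x : B) : exists q : {poly E},
  [/\ irreducible_poly q, horner_alg x q = 0, size q = (\dim <<1; x>>%VS).+1 &
      forall p, horner_alg x p = 0 -> q %| p].
Proof.
pose K := <<1; x>>%AS; pose d := \dim K.
have xK i : x ^+ i \in K.
  elim: i => [|i IHi]; first by rewrite expr0 memvE sub1_agenv.
  by rewrite exprS memvM // memv_adjoin.
have [p0 [p00 p0s p0x]] : exists p : {poly E}, [/\ p != 0, (size p <= d.+1)%N & horner_alg x p = 0].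
  pose X := [tuple x ^+ i | i < d.+1].
  have : ~~ free X.
    rewrite /free size_tuple neq_ltn ltnS dimvS //.
    by apply/span_subvP => y /mapP[i _ ->]; apply: xK.
  rewrite -[free X]negbK => /negP/negP nf.
  have [k kP] : exists k : 'I_d.+1 -> E, \sum_i k i *: X`_i = 0 /\ exists i, k i != 0.
    apply: contrapT => nk; case/negP: nf; apply/negPn/freeP => k k0 i; apply: contrapT => ki.
    by case: nk; exists k; split=> //; exists i; apply/eqP.
  have [k0 [i ki]] := kP.
  have k0' : \sum_(j < d.+1) k j *: x ^+ j = 0.
    by rewrite -[RHS]k0; apply: eq_bigr => j _; rewrite -(tnth_nth 0 X) tnth_mktuple.
  exists (\poly_(j < d.+1) (if insub j is Some j' then k j' else 0)); split.
  - apply: contraNneq ki => /polyP/(_ i); rewrite coef_poly ltn_ord coef0.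
    by rewrite insubT ?ltn_ord // => iL /=; rewrite (_ : Sub _ _ = i) => [->//|]; apply: val_inj.
  - exact: size_poly.
  rewrite -[RHS]k0' poly_def linear_sum; apply: eq_bigr => j _ /=.
  rewrite insubT ?ltn_ord // => jL /=; rewrite (_ : Sub _ _ = j); last exact: val_inj.
  by rewrite linearZ /= rmorphXn /= horner_algX mulr_algl.
have ex : exists n, `[< exists p : {poly E}, [/\ p != 0, size p = n & horner_alg x p = 0] >].
  by exists (size p0); apply/asboolP; exists p0.
pose n := ex_minn ex.
have [q [q0 qs qx]] : exists p : {poly E}, [/\ p != 0, size p = n & horner_alg x p = 0].
  by rewrite /n; case: ex_minnP => m /asboolP.
have nmin p : p != 0 -> horner_alg x p = 0 -> (n <= size p)%N.
  move=> pn0 px; rewrite /n; case: ex_minnP => m _; apply; apply/asboolP.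
  by exists p.
have dv p : horner_alg x p = 0 -> q %| p.
  move=> px; apply: contraTT isT; rewrite /dvdp => r0.
  have : horner_alg x (p %% q) = 0.
    have := px; rewrite {1}(divp_eq p q) rmorphD rmorphM /= qx mulr0 add0r; exact.
  by move=> /(nmin _ r0); rewrite leqNgt -qs ltn_modp q0.
have sq1 : (1 < size q)%N.
  rewrite ltnNge; apply/negP => /size1_polyC qc; move: qx q0; rewrite qc horner_algC.
  by move=> /eqP; rewrite scaler_eq0 oner_eq0 orbF => /eqP->; rewrite polyC0 eqxx.
have iq : irreducible_poly q.
  split=> // r r1 /dvdpP[s sr].
  have r0 : r != 0 by apply: contraNneq q0 => r0; rewrite sr r0 mulr0.
  have s0 : s != 0 by apply: contraNneq q0 => s0; rewrite sr s0 mul0r.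
  have : horner_alg x (s * r) = 0 by rewrite -sr.
  rewrite rmorphM => /div_integral[sx|rx].
    have := nmin s s0 sx; rewrite -qs sr size_mul // leqNgt => /negP[].
    have : (1 < size r)%N by rewrite ltn_neqAle eq_sym r1 lt0n size_poly_eq0.
    by case: (size r) => [|[|l]] // _; rewrite addnS /= addnS ltnS leq_addr.
  have rq : r %| q by rewrite sr dvdp_mull.
  by rewrite -(dvdp_size_eqp rq) eqn_leq (dvdp_leq q0 rq) qs nmin.
exists q; split=> //; apply/eqP; rewrite eqn_leq -/K -/d; apply/andP; split.
  by apply: leq_trans p0s; rewrite qs nmin.
rewrite -[X in (_ < X)%N](prednK (ltnW sq1)) ltnS.
pose V := <<[seq (x ^+ i)%R | i <- iota 0 (size q).-1]>>%VS.
have hV (p : {poly E}) : horner_alg x p \in V.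
  have -> : horner_alg x p = horner_alg x (p %% q).
    by rewrite {1}(divp_eq p q) rmorphD rmorphM /= qx mulr0 add0r.
  rewrite -[p %% q]coefK poly_def linear_sum rpred_sum // => i _.
  rewrite linearZ /= rmorphXn /= horner_algX mulr_algl rpredZ // memv_span //.
  apply/mapP; exists (val i) => //; rewrite mem_iota add0n /=.
  by apply: leq_trans (ltn_ord i) _; rewrite -ltnS (prednK (ltnW sq1)) ltn_modp.
have KV : (K <= V)%VS.
  apply: agenv_sub_modl; first by rewrite -memvE -(rmorph1 (horner_alg x)) hV.
  apply/prodvP => u v /memv_addP[_ /vlineP[k ->]] [_ /vlineP[l ->] ->] vV.
  rewrite mulrDl rpredD //; first by rewrite -scalerAl mul1r rpredZ.
  rewrite -scalerAl rpredZ // (coord_span vV) mulr_sumr rpred_sum // => i _.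
  rewrite -scalerAr rpredZ // (nth_map 0%N) ?size_iota //.
  by rewrite -exprS -(horner_algX x) -rmorphXn hV.
apply: leq_trans (dimvS KV) _; apply: leq_trans (dim_span _) _.
by rewrite size_map size_iota.
Qed.

Lemma field_axiomB : GRing.MathCompCompatField.Field.axiom B.
Proof. by move=> x; apply: unitB. Qed.

Lemma dim_adjoin_dvd (x : B) : (\dim <<1; x>>%VS %| \dim {:B})%N.
Proof. by rewrite (skew_field_dimS field_axiomB) // subvf. Qed.

Lemma dim_adjoin_gt1 (x : B) : x \notin 1%VS -> (1 < \dim <<1; x>>%VS)%N.
Proof.
move=> x1; rewrite ltnNge; apply: contraNN x1 => d1.
have e : 1%VS = <<1; x>>%VS :> {vspace B}.
  by apply/eqP; rewrite eqEdim sub1_agenv dimv1.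
by rewrite e memv_adjoin.
Qed.

Lemma min_poly_prime (x : B) p : prime p -> \dim {:B} = p -> x \notin 1%VS ->
  \dim <<1; x>>%VS = p.
Proof.
move=> pp dB /dim_adjoin_gt1 d1; have := dim_adjoin_dvd x; rewrite dB => dp.
by apply/prime_nt_dvdP => //; rewrite neq_ltn d1 orbT.
Qed.

(** If [x] had degree [p ^ 2], it would generate [B] and hence be central. *)
Lemma min_poly_prime2 (x : B) p : central B -> prime p -> \dim {:B} = (p ^ 2)%N -> x \notin 1%VS ->
  \dim <<1; x>>%VS = p.
Proof.
move=> cB pp dB x1; have d1 := dim_adjoin_gt1 x1; have := dim_adjoin_dvd x.
rewrite dB => /(dvdn_pfactor _ _ pp)[[|[|[|i]]] // _ dE];
  first by rewrite dE in d1.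
have full : <<1; x>>%VS = {:B}%VS by apply/eqP; rewrite eqEdim subvf /= dE dB.
case/negP: x1; have <- := cB; rewrite memv_cap memvf /=; apply/centvP => y _.
have : (<<1; x>> <= 'C[x])%VS by apply: adjoin_sub; rewrite ?cent1v1 ?cent1v_id.
by move/subvP/(_ y); rewrite full memvf => /(_ isT)/cent1vP ->.
Qed.

(* Completing the square. *)
Lemma quadratic_i (x : B) : 2%:R != 0 :> E ->
  (forall a : E, exists e, a = e ^+ 2 \/ a = - e ^+ 2) ->
  x \notin 1%VS -> \dim <<1; x>>%VS = 2%N -> exists z : B, z ^+ 2 = -1.
Proof.
move=> two0 sq x1 dx; have [q [iq qx]] := min_poly_ex x; rewrite dx => sq3 _.
have l0 : q`_2 != 0.
  have : lead_coef q != 0 by rewrite lead_coef_eq0 -size_poly_eq0 sq3.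
  by rewrite lead_coefE sq3.
pose s := q`_1 / q`_2; pose t := q`_0 / q`_2.
have xE : x ^+ 2 = - s *: x - t%:A.
  have : horner_alg x q = (q`_0)%:A + q`_1 *: x + q`_2 *: x ^+ 2.
    have qE : q = (q`_0)%:P + q`_1 *: 'X + q`_2 *: 'X^2.
      apply/polyP => i; rewrite !coefD !coefZ coefC coefX coefXn.
      case: i => [|[|[|i]]] /=; rewrite ?mulr0 ?mulr1 ?addr0 ?add0r //.
      by rewrite nth_default // sq3.
    rewrite {1}qE !rmorphD /= !linearZ /= rmorphXn /= horner_algC !horner_algX.
    by rewrite !mulr_algl.
  rewrite qx => /esym/eqP; rewrite addrC addr_eq0 => /eqP e.
  apply: (scalerI l0); rewrite e scalerBr !scalerA mulrN mulrC divfK // [_ * t]mulrC divfK //.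
  by rewrite opprD scaleNr addrC.
pose h := s / 2%:R; pose y := x + h%:A; pose d := h ^+ 2 - t.
have yE : y ^+ 2 = d%:A.
  rewrite /y expr2 mulrDl !mulrDr -expr2 xE -!scalerAl -!scalerAr !mulr1 !mul1r scalerA /d.
  have -> : s = h + h by rewrite /h; field.
  have cancel (u v w : B) : - u - u - w + u + (u + v) = v - w.
    by rewrite addrA -[_ + u + u]addrA -opprD [_ + (u + u)]addrAC addNr add0r addrC.
  by rewrite scalerBl scaleNr scalerDl expr2 opprD cancel.
have y1 : y \notin 1%VS.
  apply: contraNN x1 => y1; rewrite -(addrK (h%:A) x) rpredB //.
  by apply/vlineP; exists h.
have yk k : y != k%:A by apply: contraNneq y1 => ->; apply/vlineP; exists k.
have [e de] := sq d.
have ye : (y - e%:A) * (y + e%:A) = (d - e ^+ 2)%:A.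
  move: (y) yE => v vE.
  rewrite mulrBl !mulrDr mulr_algr !mulr_algl scalerA -!expr2 vE.
  by rewrite opprD addrA addrK -scalerBl.
case: de => de'.
  move: ye; rewrite de' subrr scale0r => /div_integral[/eqP|/eqP].
    by rewrite subr_eq0 (negPf (yk e)).
  by rewrite addr_eq0 -scaleNr (negPf (yk (- e))).
have e0 : e != 0.
  apply/eqP => e0; move: yE; rewrite de' e0 expr0n oppr0 scale0r => /eqP.
  rewrite expr2 => /eqP/div_integral[]/eqP; by rewrite -(scale0r 1) (negPf (yk 0)).
by exists (e^-1 *: y); rewrite exprZn yE scalerA de' mulrN -exprMn mulVf // expr1n scaleN1r.
Qed.

End Division.

Lemma not_scalar_ex (B : falgType E) : (1 < \dim {:B})%N -> exists x : B, x \notin 1%VS.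
Proof.
move=> dB; apply: contrapT => nx; move: dB; rewrite ltnNge => /negP[].
rewrite -[X in (_ <= X)%N](dimv1 B) dimvS //; apply/subvP => x _.
by apply: contrapT => /negP x1; apply: nx; exists x.
Qed.

(** By degrees, ['X^p - al%:P] is the minimal polynomial of the generator [z], so any p-th root of
    [al] in [D] receives [L]. *)
Lemma radical_embed (L : fieldExtType E) (D : falgType E) p (z : L) (W : D) al :
  prime p -> \dim {:L} = p -> z \notin 1%VS -> z ^+ p = al%:A -> W ^+ p = al%:A ->
  inhabited 'AHom(L, D).
Proof.
move=> pp dL z1 zE WE.
have unitL (x : L) : x != 0 -> x \is a GRing.unit by rewrite unitfE.
have [q [iq qz dq qmin]] := min_poly_ex unitL z.
move: dq; rewrite (min_poly_prime unitL pp dL z1) => sq.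
have qE : 'X^p - al%:P %| q.
  have qd : q %| 'X^p - al%:P.
    by apply: qmin; rewrite rmorphB /= rmorphXn /= horner_algX horner_algC zE subrr.
  by move: (dvdp_size_eqp qd); rewrite sq size_XnsubC ?prime_gt0 // eqxx => /esym; rewrite /eqp => /andP[].
apply: (ahom_of_root iq _ qz (w := W)); first by rewrite sq dL.
have /dvdpP[s ->] := qE.
by rewrite rmorphM rmorphB /= rmorphXn /= horner_algX horner_algC WE subrr mulr0.
Qed.

End Roots.

(** * Cubic extensions *)

(** Three vectors of Q^2 are dependent; after denominators are cleared, the relation is divided by 3
    until some coefficient is not divisible. *)
Lemma int_kernel (v : 'I_3 -> rat * rat) : exists c : 'I_3 -> int,
  \sum_i v i *~ c i = 0 /\ exists i, ~~ (3 %| c i)%Z.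
Proof.
pose M : 'M[rat]_(3, 2) := \matrix_(i, j) (if j == 0 then (v i).1 else (v i).2).
have /rowV0Pn[r /sub_kermxP rM r0] : kermx M != 0.
  by rewrite kermx_eq0 /row_free neq_ltn ltnS rank_leq_col.
have [i0 ri0] : exists i, r 0 i != 0.
  apply: contrapT => nr; case/eqP: r0; apply/rowP => i; rewrite mxE; apply/eqP.
  by apply: contrapT => /negP ri; apply: nr; exists i.
have r1 : \sum_i r 0 i * (v i).1 = 0.
  have := congr1 (fun B : 'rV_2 => B 0 0) rM; rewrite !mxE => e; rewrite -[RHS]e.
  by apply: eq_bigr => i _; rewrite mxE eqxx.
have r2 : \sum_i r 0 i * (v i).2 = 0.
  have := congr1 (fun B : 'rV_2 => B 0 1) rM; rewrite !mxE => e; rewrite -[RHS]e.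
  by apply: eq_bigr => i _; rewrite mxE.
have sumE (c : 'I_3 -> int) (s : rat) : (forall i, (c i)%:~R = s * r 0 i) -> \sum_i v i *~ c i = 0.
  move=> cE; have f1 : (\sum_i v i *~ c i).1 = 0.
    rewrite (raddf_sum fst) /=; transitivity (s * \sum_i r 0 i * (v i).1); last by rewrite r1 mulr0.
    by rewrite mulr_sumr; apply: eq_bigr => i _; rewrite (raddfMz fst) -mulrzr cE /=; ring.
  have f2 : (\sum_i v i *~ c i).2 = 0.
    rewrite (raddf_sum snd) /=; transitivity (s * \sum_i r 0 i * (v i).2); last by rewrite r2 mulr0.
    by rewrite mulr_sumr; apply: eq_bigr => i _; rewrite (raddfMz snd) -mulrzr cE /=; ring.
  by rewrite [LHS]surjective_pairing f1 f2.
pose D : int := \prod_i denq (r 0 i).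
have D0 : D != 0 by apply/prodf_neq0 => i _; apply: denq_neq0.
pose c i : int := numq (r 0 i) * \prod_(k | k != i) denq (r 0 k).
have cE i : (c i)%:~R = D%:~R * r 0 i.
  rewrite /c /D [in RHS](bigD1 i) //= !rmorphM /=; have := divq_num_den (r 0 i).
  have : (denq (r 0 i))%:~R != 0 :> rat by rewrite intr_eq0 denq_neq0.
  move: (numq _)%:~R (denq _)%:~R (\prod_(_ | _) _)%:~R => a b p b0 <-; by field.
have ci0 : c i0 != 0 by rewrite -(intr_eq0 rat) cE mulf_neq0 ?intr_eq0.
have [n] := ubnP `|c i0|%N; elim: n (c) D%:~R cE ci0 => // n IHn {}c s cE ci0.
rewrite ltnS => cn; have [d3|nd3] := boolP [forall i, (3 %| c i)%Z]; last first.
  by exists c; split; [apply: sumE cE | move: nd3; rewrite negb_forall => /existsP].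
have dE i : c i = (c i %/ 3)%Z * 3 by rewrite divzK //; apply: (forallP d3).
apply: (IHn (fun i => (c i %/ 3)%Z) (s / 3%:R)).
- by move=> i; rewrite mulrAC -cE [in RHS]dE rmorphM /= mulfK.
- by apply: contraNneq ci0 => c3; rewrite dE c3 mul0r.
apply: leq_trans cn; rewrite [in X in (_ < X)%N](dE i0) abszM ltn_Pmulr // absz_gt0.
by apply: contraNneq ci0 => c3; rewrite dE c3 mul0r.
Qed.

(* Reducing the exponents of an integral relation modulo 3. *)
Lemma three_dep (g1 g2 g3 : rat * rat) : exists (r1 r2 r3 : nat) (q1 q2 q3 : int),
  ~~ [&& 3 %| r1, 3 %| r2 & 3 %| r3]%N /\
  g1 *+ r1 + g2 *+ r2 + g3 *+ r3 = (g1 *~ q1 + g2 *~ q2 + g3 *~ q3) *+ 3.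
Proof.
have [c []] := int_kernel (fun i => nth 0 [:: g1; g2; g3] i).
rewrite !big_ord_recl big_ord0 addr0 /=; set c1 := c _; set c2 := c _; set c3 := c _.
move=> sum0 [i ci].
have div (m : int) : exists (r : nat) (q : int), m = r%:Z - q * 3 /\ (3 %| r)%N = (3 %| m)%Z.
  exists `|(m %% 3)%Z|%N, (- (m %/ 3)%Z); split.
    by rewrite {1}(divz_eq m 3) mulNr opprK gez0_abs ?modz_ge0 // addrC.
  rewrite [in RHS](divz_eq m 3) rpredDl ?dvdz_mull //.
have [r1 [q1 [e1 d1]]] := div c1; have [r2 [q2 [e2 d2]]] := div c2.
have [r3 [q3 [e3 d3]]] := div c3; exists r1, r2, r3, q1, q2, q3; split.
  rewrite d1 d2 d3; apply: contraNN ci => /and3P[D1 D2 D3].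
  have := ltn_ord i; case: (unliftP ord0 i) => [j ->|->] //.
  case: (unliftP ord0 j) => [k ->|->] // _.
  by case: (unliftP ord0 k) => [[]|->].
apply/eqP; rewrite -subr_eq0 -[X in _ == X]sum0 addrA e1 e2 e3; apply/eqP.
rewrite !mulrzBr !mulrzA -!pmulrn !mulrnDl !opprD; ring.
Qed.

Lemma vlXz (f : Om) (m : int) : f != 0 -> vl (f ^ m) = vl f *~ m.
Proof.
move=> f0; case: m => m; first by rewrite vlX.
by rewrite NegzE -exprnN vlV ?expf_neq0 // vlX // mulrNz.
Qed.

Section Cubic.
Variables (E : fieldType) (io : {rmorphism E -> Om}).
Hypothesis gal : gal_closed io.
Hypothesis alg : forall x, Alg (io x).
Hypothesis hi : has_i io.

Section Division.
Variable B : falgType E.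
Hypothesis unitB : forall x : B, x != 0 -> x \is a GRing.unit.

(** [cubic_kummer] is stated modulo the minimal polynomial, so it can be evaluated at [x] inside a
    noncommutative division algebra. *)
Lemma cubic_radical (x : B) : x \notin 1%VS -> \dim <<1; x>>%VS = 3%N ->
  exists (z : B) (al : E), z ^+ 3 = al%:A /\ z \notin 1%VS.
Proof.
move=> x1 dx; have [q [iq qx]] := min_poly_ex unitB x; rewrite dx => sq qmin.
have [P [al [/dvdpP[r rE] nP]]] := cubic_kummer gal alg hi iq sq.
exists (horner_alg x P), al; split.
  apply/eqP; rewrite -subr_eq0 -rmorphXn -(horner_algC x al) -rmorphB rE rmorphM /=.
  by rewrite qx mulr0.
apply/negP => /vlineP[c cE]; case/negP: (nP c); apply: qmin.
by rewrite rmorphB /= cE horner_algC subrr.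
Qed.

(** The polynomial X^3 - e^3 splits over [E], and one of its linear factors must vanish at [x]. *)
Lemma cube_root_in1 (w : E) (x : B) (e : E) : 3.-primitive_root w -> x ^+ 3 = (e ^+ 3)%:A -> x \in 1%VS.
Proof.
move=> wp xe; have w3 : w ^+ 3 = 1 := prim_expr_order wp.
have w1 : w != 1 by rewrite -[w]expr1 -(prim_order_dvd wp).
have w0 : 1 + w + w ^+ 2 = 0.
  apply: (mulfI (x := w - 1)); first by rewrite subr_eq0.
  by rewrite mulr0; transitivity (w ^+ 3 - 1); [ring | rewrite w3 subrr].
pose f (c : E) : {poly E} := 'X - (c * e)%:P.
have fE : f 1 * (f w * f (w ^+ 2)) = 'X^3 - (e ^+ 3)%:P.
  have id (R : comNzRingType) (X v u : R) : (X - 1 * u) * ((X - v * u) * (X - v ^+ 2 * u)) =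
    X ^+ 3 - (1 + v + v ^+ 2) * u * X ^+ 2 + v * (1 + v + v ^+ 2) * u ^+ 2 * X - v ^+ 3 * u ^+ 3 by ring.
  have W0 : 1 + w%:P + w%:P ^+ 2 = 0 :> {poly E} by rewrite -polyC_exp -polyC1 -!polyCD w0.
  rewrite /f polyC_exp 3?polyCM [(w ^+ 2)%:P]polyC_exp id W0 mulr0 !mul0r -[w%:P ^+ 3]polyC_exp w3.
  by rewrite subr0 addr0 mul1r.
have fx c : horner_alg x (f c) = x - (c * e)%:A by rewrite rmorphB /= horner_algX horner_algC.
have root c : x - (c * e)%:A = 0 -> x \in 1%VS.
  by move=> /eqP; rewrite subr_eq0 => /eqP->; apply/vlineP; exists (c * e).
have : horner_alg x (f 1 * (f w * f (w ^+ 2))) = 0.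
  by rewrite fE rmorphB /= rmorphXn /= horner_algX horner_algC xe subrr.
rewrite !rmorphM /= !fx.
by move=> /(div_integral unitB)[/root//|/(div_integral unitB)[/root//|/root]].
Qed.

(** Collecting the factors [u ^+ i] on the left produces the commutation scalar three times, and its
    cube is 1. *)
Lemma cube_scale (u v : B) (c : E) i j : c ^+ 3 = 1 -> v * u = c *: (u * v) ->
  (u ^+ i * v ^+ j) ^+ 3 = u ^+ (3 * i) * v ^+ (3 * j).
Proof.
move=> c3 vu; have YX := VUX vu i j.
have d3 : (c ^+ (j * i)) ^+ 3 = 1 by rewrite exprAC c3 expr1n.
rewrite ![(3 * _)%N]mulnC ![_ ^+ (_ * 3)]exprM.
move: (u ^+ i) (v ^+ j) (c ^+ (j * i)) YX d3 => X Y d YX d3.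
rewrite !exprS !expr0 !mulr1.
transitivity (X * (Y * X) * ((Y * X) * Y)); first by rewrite !mulrA.
rewrite YX -!scalerAr -!scalerAl -scalerAr scalerA.
transitivity ((d * d) *: (X * X * (Y * X) * Y * Y)); first by rewrite !mulrA.
by rewrite YX -scalerAr -!scalerAl scalerA (_ : d * d * d = 1) ?scale1r ?mulrA // -d3 !exprSr expr0 mul1r.
Qed.

End Division.

(* D is generated by u and v with u^3, v^3 in E and u v = c v u for a primitive cube root c of 1; the
   values of u^3, v^3 and of a Kummer generator of L are dependent modulo 3. *)
Lemma cubic_embed (L : fieldExtType E) (D : falgType E) :
  \dim {:L} = 3%N -> central_division D -> \dim {:D} = 9%N -> inhabited 'AHom(L, D).
Proof.
move=> dL [cD unitD] dD.
have unitL (x : L) : x != 0 -> x \is a GRing.unit by rewrite unitfE.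
have [w0 w0E] := omE_ex gal hi.
have wp : 3.-primitive_root w0 by rewrite -(fmorph_primitive_root io) -w0E om_prim.
have [x x1] : exists x : L, x \notin 1%VS by apply: not_scalar_ex; rewrite dL.
have [z [al [zE z1]]] := cubic_radical unitL x1 (min_poly_prime unitL (isT : prime 3) dL x1).
have [y y1] : exists y : D, y \notin 1%VS by apply: not_scalar_ex; rewrite dD.
have [u [a [uE u1]]] := cubic_radical unitD y1 (min_poly_prime2 unitD cD (isT : prime 3) dD y1).
have z0 : z != 0 by apply: contraNneq z1 => ->; apply: rpred0.
have al0 : al != 0.
  by apply: contraNneq z0 => al0; have := zE; rewrite al0 scale0r => /eqP; rewrite expf_eq0.
have cube0 (v : D) : v ^+ 3 = 0 -> v = 0.
  by rewrite !exprS expr0 mulr1 => /(div_integral unitD)[|/(div_integral unitD)[|]].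
have u0 : u != 0 by apply: contraNneq u1 => ->; apply: rpred0.
have a0 : a != 0.
  by apply: contraNneq u0 => a0; apply/eqP/cube0; rewrite uE a0 scale0r.
have w3 : w0 ^+ 3 = 1 := prim_expr_order wp.
have w1 : w0 != 1 by rewrite -[w0]expr1 -(prim_order_dvd wp).
have [t ut] : exists t : D, t * u != u * t.
  apply: contrapT => nt; case/negP: u1; rewrite -cD memv_cap memvf; apply/centvP => t _.
  by apply/eqP/negP => /negP tu; apply: nt; exists t; rewrite eq_sym.
have u3t : u * u * u * t = t * u * u * u.
  have uuu : u * (u * u) = a%:A by rewrite -uE !exprS expr0 mulr1.
  transitivity (u * (u * u) * t); first by rewrite !mulrA.
  by rewrite uuu mulr_algl -mulr_algr -uuu !mulrA.
(* The Lagrange resolvent of [t] under conjugation by [u], multiplied by the scalar u^3 to avoid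
   inverses. *)
pose Y (c : E) : D := t * u ^+ 3 + c ^+ 2 *: (u * t * u ^+ 2) + c *: (u ^+ 2 * t * u).
have YE c : c ^+ 3 = 1 -> u * Y c = c *: (Y c * u).
  move=> c3; rewrite /Y mulrDl mulrDl !mulrDr -!scalerAr -!scalerAl 2!scalerDr !scalerA.
  rewrite -[c * c ^+ 2]exprS c3 scale1r !exprS !expr0 !mulr1 !mulrA u3t.
  by rewrite addrC addrA.
(* If both nontrivial resolvents vanished, [t] would commute with [u]. *)
have [c [c3 c1 Yc0]] : exists c, [/\ c ^+ 3 = 1, c != 1 & Y c != 0].
  have [Y0|] := eqVneq (Y w0) 0; last by exists w0.
  exists (w0 ^+ 2); split; first by rewrite exprAC w3 expr1n.
    by rewrite -(prim_order_dvd wp).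
  apply/eqP => Y1; have : (w0 ^+ 2 - w0) *: (u * (t * u - u * t) * u) = 0.
    have w4 : (w0 ^+ 2) ^+ 2 = w0 by rewrite -exprM exprSr w3 mul1r.
    rewrite -[RHS](subrr 0) -{1}Y0 -Y1 /Y w4 mulrBr mulrBl !exprS !expr0 !mulr1 !mulrA.
    move: (u * t * u * u) (u * u * t * u) (t * u * u * u) => p q r.
    rewrite scalerBl !scalerBr opprD opprD addrACA [r + _]addrC opprK.
    move: (_ *: p) (w0 *: p) (_ *: q) (w0 *: q) => x1' x2 x3 x4.
    by rewrite [x1' + r + x4]addrAC opprD !addrA [in LHS]addrAC [x1' - x2 + x4]addrAC addrK.
  move/eqP; rewrite scaler_eq0 subr_eq0 -{2}[w0]expr1 (eq_prim_root_expr wp) /= => /eqP.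
  move=> /(div_integral unitD)[/(div_integral unitD)[/eqP|/eqP]|/eqP]; rewrite ?(negPf u0) //.
  by rewrite subr_eq0 (negPf ut).
move: (Y c) (YE c c3) Yc0 => v uv v0 {Y YE t ut u3t}.
have vu0 : v * u != 0.
  by apply/eqP => /(div_integral unitD)[]/eqP; rewrite ?(negPf v0) ?(negPf u0).
have v1 : v \notin 1%VS.
  apply/negP => /vlineP[k kE]; move: uv; rewrite kE mulr_algr mulr_algl => /eqP.
  rewrite scalerA -subr_eq0 -scalerBl scaler_eq0 (negPf u0) orbF -{1}[k]mul1r -mulrBl mulf_eq0.
  rewrite subr_eq0 eq_sym (negPf c1) /= => /eqP k0; case/eqP: v0; by rewrite kE k0 scale0r.
(* [v ^+ 3] commutes with [u]. If it were not a scalar, it would generate the same cubic subfield as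
   [v], and [v] would commute with [u]. *)
have [b bE] : exists b, v ^+ 3 = b%:A.
  apply/vlineP; apply/negPn/negP => v31.
  have sub : (<<1; v ^+ 3>> <= <<1; v>>)%VS.
    apply: adjoin_sub; first by rewrite memvE sub1_agenv.
    by rewrite !exprS expr0 mulr1 !memvM ?memv_adjoin.
  have eqd : <<1; v ^+ 3>>%VS = <<1; v>>%VS.
    apply/eqP; rewrite eqEdim sub /= (min_poly_prime2 unitD cD (isT : prime 3) dD v1).
    by rewrite (min_poly_prime2 unitD cD (isT : prime 3) dD v31).
  have : (<<1; v ^+ 3>> <= 'C[u])%VS.
    apply: adjoin_sub; first exact: cent1v1.
    by apply/cent1vP; have := VUX uv 3 1; rewrite expr1 mul1n c3 scale1r.
  rewrite eqd => /subvP/(_ v (memv_adjoin _ _))/cent1vP vu.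
  move: uv; rewrite -vu => /eqP; rewrite -{1}[v * u]scale1r -subr_eq0 -scalerBl scaler_eq0 subr_eq0.
  by rewrite eq_sym (negPf c1) (negPf vu0).
have b0 : b != 0 by apply: contraNneq v0 => b0; apply/eqP/cube0; rewrite bE b0 scale0r.
have [r1 [r2 [r3 [q1 [q2 [q3 [ndiv dep]]]]]]] := three_dep (vl (io b)) (vl (io a)) (vl (io al)).
have ioX0 g m : g != 0 -> (io g) ^ m != 0 :> Om by move=> g0; rewrite expfz_neq0 ?fmorph_eq0.
have [|||e eE] := @cube_of_val _ _ gal hi (b ^+ r1 * a ^+ r2 * al ^+ r3) (b ^ q1 * a ^ q2 * al ^ q3).
- by rewrite !mulf_neq0 ?expf_neq0.
- by rewrite !mulf_neq0 ?expfz_neq0.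
- rewrite !rmorphM !rmorphXn !rmorphXz /= ?unitfE // !vlM ?mulf_neq0 ?expf_neq0 ?ioX0 ?fmorph_eq0 //.
  by rewrite !vlX ?fmorph_eq0 // !vlXz ?fmorph_eq0.
have sc (i j : nat) : (v ^+ i * u ^+ j) ^+ 3 = (b ^+ i * a ^+ j)%:A.
  by rewrite (cube_scale i j c3 uv) !exprM bE uE !exprZn !expr1n mulr_algl scalerA.
(* If [r3] is divisible by 3, then [v ^+ r1 * u ^+ r2] has its cube in E^3 and so is a scalar.
   Commuting with [u] and [v], it forces 3 to divide [r1] and [r2], a contradiction. *)
have [d3|nd3] := boolP (3 %| r3)%N.
  pose W := v ^+ r1 * u ^+ r2; pose f := e / al ^+ (r3 %/ 3).
  have W1 : W \in 1%VS.
    apply: (cube_root_in1 unitD wp (e := f)); rewrite sc /f expr_div_n -eE -exprM divnK // mulfK //.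
    by rewrite expf_neq0.
  have cX i : c ^+ i = 1 -> (3 %| i)%N.
    rewrite (divn_eq i 3) exprD mulnC exprM c3 expr1n mul1r dvdn_addr ?dvdn_mulr //.
    have : (i %% 3 < 3)%N by rewrite ltn_mod.
    case: (i %% 3)%N => [|[|[|]]] // _; first by rewrite expr1 => /eqP; rewrite (negPf c1).
    by move=> c2; case/eqP: c1; rewrite -c3 exprS c2 mulr1.
  have px (s1 s2 : D) : s1 != 0 -> s2 != 0 -> s1 * s2 != 0.
    by move=> s10 s20; apply/eqP => /(div_integral unitD)[]/eqP; apply/negP.
  have pX (s : D) n : s != 0 -> s ^+ n != 0.
    by move=> s0; elim: n => [|n IHn]; rewrite ?expr0 ?oner_eq0 // exprS px.
  have W0 : W != 0 by rewrite px ?pX.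
  have c_eq1 (d : E) (s : D) : s != 0 -> d *: s = s -> d = 1.
    move=> s0 /eqP; rewrite -{2}[s]scale1r -subr_eq0 -scalerBl scaler_eq0 (negPf s0) orbF.
    by rewrite subr_eq0 => /eqP.
  have Wc s : s * W = W * s by case/vlineP: W1 => k ->; rewrite mulr_algl mulr_algr.
  case/negP: ndiv; rewrite d3 andbT; apply/andP; split; apply: cX.
    apply: (c_eq1 _ (W * u)); first by rewrite px.
    rewrite -[RHS]Wc /W mulrA; have := VUX uv r1 1; rewrite !expr1 mul1n => ->.
    by rewrite -!scalerAl -!mulrA -exprS exprSr.
  apply: (c_eq1 _ (v * W)); first by rewrite px.
  rewrite [in RHS]Wc /W -[RHS]mulrA; have := VUX uv 1 r2; rewrite !expr1 muln1 => ->.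
  by rewrite -!scalerAr !mulrA -exprS exprSr.
(* Otherwise [r3] is its own inverse modulo 3, and the relation can be solved for [al] modulo cubes;
   the factor 2 in the exponents below stands for -1 modulo 3. *)
pose k := ((r3 ^ 2) %/ 3)%N.
have r3k : (r3 ^ 2 = 1 + 3 * k)%N.
  rewrite {1}(divn_eq (r3 ^ 2) 3) mulnC addnC -modnXm; congr (_ + _)%N.
  by have := ltn_pmod r3 (isT : 0 < 3)%N; move: nd3; rewrite /dvdn; case: (r3 %% 3)%N => [|[|[|]]].
pose f := e ^+ r3 / (al ^+ k * b ^+ (r1 * r3) * a ^+ (r2 * r3)).
have alE : al = f ^+ 3 * (b ^+ (2 * r1 * r3) * a ^+ (2 * r2 * r3)).
  rewrite /f expr_div_n exprAC -eE !exprMn_comm -?exprM; do ?exact: mulrC.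
  rewrite -mulnn in r3k; rewrite r3k exprD expr1 [(3 * k)%N]mulnC -!mulnA ![(2 * _)%N]mulnC !exprM.
  move: (expf_neq0 k al0) (expf_neq0 r3 (expf_neq0 r1 b0)) (expf_neq0 r3 (expf_neq0 r2 a0)).
  move: (al ^+ k) (_ ^+ r3) (_ ^+ r3) => K B A K0 B0 A0; by field; rewrite K0 B0 A0.
pose W := f *: (v ^+ (2 * r1 * r3) * u ^+ (2 * r2 * r3)).
have WE : W ^+ 3 = al%:A by rewrite exprZn sc scalerA -alE.
exact: (radical_embed (isT : prime 3) dL z1 zE WE).
Qed.

End Cubic.

(** * Division symbol algebras *)

Section SymbolDomain.
Variables (E : fieldType) (io : {rmorphism E -> Om}) (a b z : E).
Hypotheses (zp : z ^+ 3 = 1) (a0 : a != 0) (b0 : b != 0).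
Local Notation ga := (vl (io a)).
Local Notation gb := (vl (io b)).
Hypothesis indep : forall (i j : nat) (e : E), e != 0 ->
  ga *+ i + gb *+ j = vl (io e) *+ 3 -> (3 %| i)%N /\ (3 %| j)%N.
Local Notation Q := ('I_3 * 'I_3)%type.
Local Notation A := (symbol_alg (n := 1) a b zp).

(** Three times the value of e U^i V^j, where U and V are given the values [ga / 3] and [gb / 3]. By
    independence, terms at distinct monomials have distinct values. *)
Let wt (e : E) (h : Q) : rat * rat := vl (io e) *+ 3 + ga *+ h.1 + gb *+ h.2.

Let wt_inj e f h k : e != 0 -> f != 0 -> wt e h = wt f k -> h = k.
Proof.
move=> e0 f0; rewrite /wt => hk.
have io0 (x : E) : x != 0 -> io x != 0 by rewrite fmorph_eq0.
(* The differences [h - k] are shifted by 3 to stay natural; the factors [a] and [b] compensate for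
   this. *)
have [] := @indep (h.1 + (3 - k.1)) (h.2 + (3 - k.2)) (f / e * a * b).
- by rewrite !mulf_neq0 ?invr_eq0.
- rewrite !rmorphM fmorphV /= !vlM ?mulf_neq0 ?invr_eq0 ?io0 // vlV ?io0 //.
  rewrite !mulrnDr !mulrnBr; try exact: ltnW.
  move: (ga *+ h.1) (gb *+ h.2) (ga *+ k.1) (gb *+ k.2) hk => B C B' C' hk.
  have -> : B = vl (io f) *+ 3 + B' + C' - vl (io e) *+ 3 - C by rewrite -hk; ring.
  by ring.
move=> d1 d2; have := ltn_ord h.1; have := ltn_ord h.2; have := ltn_ord k.1; have := ltn_ord k.2.
move=> *; rewrite [h]surjective_pairing [k]surjective_pairing; congr pair; apply: val_inj => /=; lia.
Qed.

Let wt_min (x : A) : x != 0 -> exists g, x g != 0 /\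
  forall k, x k != 0 -> k != g -> ht (wt (x g) g) < ht (wt (x k) k).
Proof.
move=> x0; have [g0 xg0] : exists g, x g != 0.
  apply: contrapT => ng; case/eqP: x0; apply/ffunP => g; rewrite ffunE; apply/eqP.
  by apply: contrapT => /negP xg; apply: ng; exists g.
case: (@arg_minP _ _ _ g0 (fun g => x g != 0) (fun g => ht (wt (x g) g)) xg0) => g xg gmin.
exists g; split=> // k xk kg; rewrite lt_neqAle gmin // andbT; apply: contraNneq kg.
by move/ht_inj/wt_inj => ->.
Qed.

(* In a product, the term coming from the two terms of least value has a strictly smaller value than
   the other terms contributing to the same coordinate. *)
Lemma symbol_domain (x y : A) : x * y = 0 -> x = 0 \/ y = 0.
Proof.
move=> xy; have [->|x0] := eqVneq x 0; first by left.
have [->|y0] := eqVneq y 0; first by right.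
have [g [xg gmin]] := wt_min x0; have [h [yh hmin]] := wt_min y0.
have io0 (e : E) : e != 0 -> io e != 0 by rewrite fmorph_eq0.
have z0 : z != 0 by apply: contra_eq_neq zp => ->; rewrite expr0n eq_sym oner_eq0.
have c0 k l : symbol_cocycle a b z k l != 0 by rewrite !mulf_neq0 ?expf_neq0.
have zv i : vl (io (z ^+ i)) = 0.
  have : vl (io (z ^+ i)) *+ 3 = 0.
    by rewrite -vlX ?io0 ?expf_neq0 // -rmorphXn /= exprAC zp expr1n rmorph1 vl1.
  by move=> /(congr1 ht) /eqP; rewrite htMn ht0 mulrn_eq0 /= => /eqP/ht_eq0.
pose F k l : E := symbol_cocycle a b z k l * (x k * y l).
have FE k l : x k != 0 -> y l != 0 ->
    vl (io (F k l)) *+ 3 + ga *+ (k + l).1 + gb *+ (k + l).2 = wt (x k) k + wt (y l) l.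
  move=> xk yl; rewrite /F /symbol_cocycle !rmorphM /= !vlM ?mulf_neq0 ?io0 ?expf_neq0 // zv.
  rewrite !rmorphXn /= !vlX ?io0 // /wt.
  have dv (m1 m2 : 'I_3) (ge : rat * rat) :
      ge *+ m1 + ge *+ m2 = ge *+ ((m1 + m2) %/ 3) *+ 3 + ge *+ ((m1 + m2) %% 3)%N.
    by rewrite -mulrnA -!mulrnDr -divn_eq.
  have d1 := dv k.1 l.1 ga; have d2 := dv k.2 l.2 gb.
  transitivity (vl (io (x k)) *+ 3 + vl (io (y l)) *+ 3 + (ga *+ k.1 + ga *+ l.1) + (gb *+ k.2 + gb *+ l.2)).
    by rewrite d1 d2 /=; ring.
  by ring.
have : io ((x * y) (g + h)) = 0 by rewrite xy ffunE rmorph0.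
rewrite symbolM rmorph_sum /= => /(congr1 (fun f : Om => f (vl (io (F g h))))).
rewrite (big_morph (fun f : Om => f (vl (io (F g h)))) (id1 := 0) (op1 := +%R)) //.
rewrite (bigD1 g) //= big1 => [|k kg].
  have Fn : io (F g h) != 0 by rewrite io0 // mulf_neq0 ?c0 // mulf_neq0.
  by rewrite [g + h - g]addrC addKr addr0 => e; case/eqP: (vl_lead Fn); exact: e.
apply/eqP; apply: contraTT isT => nz.
have : io (F k (g + h - k)) != 0 by apply: contra_neq nz; rewrite /F => ->.
rewrite fmorph_eq0 => Fk; have [xk yl] : x k != 0 /\ y (g + h - k) != 0.
  by apply/andP; rewrite -negb_or -mulf_eq0; apply: contraNneq Fk; rewrite /F => ->; rewrite mulr0.
have := vl_min nz; rewrite leNgt => /negP; case.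
set l := g + h - k; have kl : k + l = g + h by rewrite addrC subrK.
have := FE k l xk yl; have := FE g h xg yh; rewrite kl => /(congr1 ht) e1 /(congr1 ht) e2.
have := gmin k xk kg; have : ht (wt (y h) h) <= ht (wt (y l) l).
  by have [->|lh] := eqVneq l h; last exact/ltW/hmin.
move: e1 e2; rewrite !htD !htMn -/(F k l); lra.
Qed.

End SymbolDomain.

(** * Two elements with independent values modulo 3 *)

Lemma loc3M p q : loc3 p -> loc3 q -> loc3 (p * q).
Proof.
move=> [d [d3 [m mE]]] [e [e3 [n nE]]]; exists (d * e)%N.
split; first by rewrite Euclid_dvdM // negb_or d3.
by exists (m * n); rewrite intrM -mE -nE natrM; ring.
Qed.

Section Independent.
Variables (E : fieldType) (io : {rmorphism E -> Om}).
Hypothesis monos : forall g, locE g -> exists e, io e = mono 1 g.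

(* A pair of values whose determinant is nonzero with minimal 3-adic valuation. *)
Lemma indep_values (d : nat) : (0 < d)%N -> (forall e, e != 0 -> locE (vl (io e) *+ d)) ->
  exists a b : E, [/\ a != 0, b != 0 & forall (i j : nat) (e : E), e != 0 ->
    vl (io a) *+ i + vl (io b) *+ j = vl (io e) *+ 3 -> (3 %| i)%N /\ (3 %| j)%N].
Proof.
move=> d0 dP; have dn0 : d%:R != 0 :> rat by rewrite pnatr_eq0 -lt0n.
pose det (a b : E) : rat := (vl (io a)).1 * (vl (io b)).2 - (vl (io a)).2 * (vl (io b)).1.
(* Some pair has [d ^ 2 * det] of 3-adic valuation at most [n]. Since [d] times any value is in
   Z_(3)^2, this product is in Z_(3), which bounds its valuation below by 0. *)
pose P n := exists a b : E, [/\ a != 0, b != 0, det a b != 0 & loc3 (3 ^+ n / (d%:R ^+ 2 * det a b))].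
have exP : exists n, `[< P n >].
  have mono_ex g : locE g -> exists2 e, e != 0 & vl (io e) = g.
    move=> /monos[e eE]; exists e; last by rewrite eE vl_mono ?oner_eq0.
    rewrite -(fmorph_eq0 io) eE; apply/eqP => /(congr1 (fun f : Om => f g)).
    by rewrite monoE eqxx => /eqP; rewrite oner_eq0.
  have [|a a0 av] := mono_ex (1, 0); first by split; [exact: (loc3_int 1) | exact: (loc3_int 0)].
  have [|b b0 bv] := mono_ex (0, 1); first by split; [exact: (loc3_int 0) | exact: (loc3_int 1)].
  have dab : det a b = 1 by rewrite /det av bv /= mulr1 mul0r subr0.
  have [n nP] := loc3_pow (d%:R ^+ 2)^-1.
  by exists n; apply/asboolP; exists a, b; rewrite dab oner_eq0 mulr1.
have [n /asboolP[a [b [a0 b0 D0 nP]]] nmin] := ex_minnP exP.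
(* If 3 did not divide [k], the determinant of the new pair would have smaller valuation: against
   minimality if n > 0, against the bound above if n = 0. *)
have key a' b' (k : nat) : a' != 0 -> b' != 0 -> det a' b' * 3%:R = k%:R * det a b -> (3 %| k)%N.
  move=> a0' b0' D'; apply: contraT => k3.
  have k0 : k%:R != 0 :> rat by rewrite pnatr_eq0; case: (k) k3.
  have D0' : det a' b' != 0.
    by apply: contraTneq (mulf_neq0 k0 D0) => e; rewrite -D' e mul0r eqxx.
  have detE : det a b = det a' b' * 3%:R / k%:R by rewrite D' mulrC mulKf.
  case: n nP nmin => [|n] nP nmin.
    have [la1 la2] := dP a' a0'; have [lb1 lb2] := dP b' b0'.
    have Mn1 (g : rat * rat) : (g *+ d).1 = d%:R * g.1 by rewrite (raddfMn fst) /= mulr_natl.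
    have Mn2 (g : rat * rat) : (g *+ d).2 = d%:R * g.2 by rewrite (raddfMn snd) /= mulr_natl.
    have l := loc3M (loc3B (loc3M la1 lb2) (loc3M la2 lb1)) nP.
    have : loc3 ((k%:Z)%:~R / 3 ^+ 1).
      move: l; congr loc3; rewrite !Mn1 !Mn2 /=.
      transitivity (d%:R ^+ 2 * det a' b' * (3 ^+ 0 / (d%:R ^+ 2 * det a b))); first by rewrite /det; ring.
      by rewrite detE; field; rewrite dn0 D0' k0.
    by move/loc3_pow_int; rewrite dvdzE /= (negPf k3).
  have : (n.+1 <= n)%N.
    apply: nmin; apply/asboolP; exists a', b'; split=> //.
    apply: (loc3_div k3); move: nP; congr loc3.
    by rewrite detE exprS; field; rewrite dn0 D0' k0.
  by rewrite ltnn.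
(* Cramer's rule: the relation gives [det e b * 3 = i * det a b] and [det a e * 3 = j * det a b]. *)
exists a, b; split=> // i j e e0 rel.
have r1 : (vl (io a)).1 * i%:R + (vl (io b)).1 * j%:R = (vl (io e)).1 * 3%:R.
  by have := congr1 fst rel; rewrite /= !(raddfMn fst) /= !mulr_natr.
have r2 : (vl (io a)).2 * i%:R + (vl (io b)).2 * j%:R = (vl (io e)).2 * 3%:R.
  by have := congr1 snd rel; rewrite /= !(raddfMn snd) /= !mulr_natr.
split; [apply: (key e b) | apply: (key a e)] => //; rewrite /det mulrBl.
  by rewrite mulrAC -r1 [X in _ - X]mulrAC -r2; ring.
by rewrite -mulrA -r2 -[X in _ - X]mulrA -r1; ring.
Qed.

End Independent.

(** * The quaternion algebra (-1, -1) *)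

Section Quaternion.
Variables (E : fieldType) (zp : (-1 : E) ^+ 2 = 1).
Local Notation Q := ('I_2 * 'I_2)%type.
Local Notation A := (symbol_alg (n := 0) (-1) (-1) zp).

Let o0 : 'I_2 := ord0.
Let o1 : 'I_2 := ord_max.

Lemma sum_Q (V : zmodType) (F : Q -> V) :
  \sum_q F q = F (o0, o0) + F (o0, o1) + (F (o1, o0) + F (o1, o1)).
Proof.
transitivity (\sum_i \sum_j F (i, j)); first by rewrite pair_bigA; apply: eq_bigr => [[]].
rewrite !big_ord_recl !big_ord0 !addr0.
have -> : ord0 = o0 by []; have -> // : lift o0 (ord0 : 'I_1) = o1; exact: val_inj.
Qed.

(** The conjugate [c] satisfies c x = N, a sum of four squares; by the two hypotheses it vanishes
    only for [x = 0]. *)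
Lemma quaternion_domain :
  (forall a b : E, exists c, a ^+ 2 + b ^+ 2 = c ^+ 2) ->
  (forall a b : E, a ^+ 2 + b ^+ 2 = 0 -> a = 0 /\ b = 0) ->
  forall x y : A, x * y = 0 -> x = 0 \/ y = 0.
Proof.
move=> sq sq0 x y xy.
pose N : E := x (o0, o0) ^+ 2 + x (o0, o1) ^+ 2 + (x (o1, o0) ^+ 2 + x (o1, o1) ^+ 2).
pose c : A := [ffun q : Q => if q == (o0, o0) then x q else - x q].
have s00 : o0 - o0 = o0 by apply: val_inj.
have s01 : o0 - o1 = o1 by apply: val_inj.
have s10 : o1 - o0 = o1 by apply: val_inj.
have s11 : o1 - o1 = o0 by apply: val_inj.
have sP (i j k l : 'I_2) : (i, j) - (k, l) = (i - k, j - l) :> Q by [].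
have oP (k : 'I_2) : k = o0 \/ k = o1.
  by case: k => [[|[|]]] // l; [left | right]; apply: val_inj.
have s1 k l : (1 : A) (k, l) = ((k == o0) && (l == o0))%:R by rewrite symbol1.
have e10 : (o1 == o0) = false by [].
have e01 : (o0 == o1) = false by [].
(* The cocycle is a sign; as a boolean it is evaluated by computation in each case. *)
pose sgn (g h : Q) := odd ((g.1 + h.1) %/ 2 + (g.2 + h.2) %/ 2 + g.2 * h.1).
have cE g h : symbol_cocycle (-1) (-1) (-1 : E) g h = (-1) ^+ sgn g h by rewrite /sgn signr_odd !exprD.
have cx : c * x = N%:A.
  apply/ffunP => -[i j]; rewrite symbolM sum_Q !cE !sP [RHS]ffunE s1.
  case: (oP i) => ->; case: (oP j) => ->; rewrite ?s00 ?s01 ?s10 ?s11 !ffunE;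
  rewrite ?xpair_eqE ?e10 ?e01 ?eqxx /=;
  repeat first [rewrite (_ : sgn _ _ = true); last by [] | rewrite (_ : sgn _ _ = false); last by []];
  rewrite ?expr0 ?expr1 /N ?[_ *: 1]mulr1 ?[_ *: 0]mulr0; ring.
have [N0|N0] := eqVneq N 0; last first.
  right; apply: (scalerI N0); rewrite scaler0 -[N *: y]mulr_algl -cx -mulrA xy mulr0 //.
left; have [u uE] := sq (x (o0, o0)) (x (o0, o1)); have [v vE] := sq (x (o1, o0)) (x (o1, o1)).
have [u0 v0] := sq0 u v (etrans (esym (f_equal2 +%R uE vE)) N0).
rewrite u0 expr0n /= in uE; rewrite v0 expr0n /= in vE.
have [x00 x01] := sq0 _ _ uE; have [x10 x11] := sq0 _ _ vE.
apply/ffunP => -[i j]; rewrite ffunE.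
by case: (oP i) => ->; case: (oP j) => ->.
Qed.

End Quaternion.

(** * Strict quasilocality *)

Section QuasilocalPackage.
Variables (E : fieldType) (io : {rmorphism E -> Om}) (d : nat).
Hypothesis gal : gal_closed io.
Hypothesis alg : forall x, Alg (io x).
Hypothesis monos : forall g, locE g -> exists e, io e = mono 1 g.
Hypothesis d0 : (0 < d)%N.
Hypothesis dP : forall e, e != 0 -> locE (vl (io e) *+ d).

Lemma natr_E_neq0 n : n.+1%:R != 0 :> E.
Proof. by rewrite -(fmorph_eq0 io) rmorph_nat Om_natr_eq0. Qed.

(** Both [L] and [D] contain a square root of -1, and the one in [L] generates it. *)
Lemma quadratic_embed (L : fieldExtType E) (D : falgType E) : ~ has_i io ->
  \dim {:L} = 2%N -> central_division D -> \dim {:D} = 4%N -> inhabited 'AHom(L, D).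
Proof.
move=> no_i dL [cD unitD] dD.
have unitL (x : L) : x != 0 -> x \is a GRing.unit by rewrite unitfE.
have sq := real_squares gal alg no_i; have two0 := natr_E_neq0 1.
have [x x1] : exists x : L, x \notin 1%VS by apply: not_scalar_ex; rewrite dL.
have [z zE] := quadratic_i unitL two0 sq x1 (min_poly_prime unitL (isT : prime 2) dL x1).
have [y y1] : exists y : D, y \notin 1%VS by apply: not_scalar_ex; rewrite dD.
have [w wE] := quadratic_i unitD two0 sq y1 (min_poly_prime2 unitD cD (isT : prime 2) dD y1).
have z1 : z \notin 1%VS.
  apply/negP => /vlineP[k kE]; have := zE; rewrite kE exprZn expr1n => /eqP.
  rewrite -subr_eq0 opprK -{2}[1]scale1r -scalerDl scaler_eq0 oner_eq0 orbF => /eqP k2.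
  have [|_ /eqP] := @sum_squares_eq0 _ _ no_i k 1; first by rewrite expr1n.
  by rewrite oner_eq0.
by apply: (@radical_embed _ _ _ 2 z w (-1)); rewrite // ?zE ?wE scaleN1r.
Qed.

Lemma package_PQL : strictly_PQL E.
Proof.
move=> p pp; have [hi|no_i] := pselect (has_i io).
  have [p3|p3] := eqVneq p 3%N; last first.
    have nc : ~ cyclic_primes E p.
      move=> [_ [L [galL _ dL]]]; case/eqP: p3; have [j jE] := embed_Om io L.
      exact: (cyclic_prime_dim gal alg jE galL hi pp dL).
    by split; [left; right | right].
  rewrite p3; split.
    by right => L [_ _ dL] D cdD dD; apply: (cubic_embed gal alg hi dL cdD dD).
  left; have [w wE] := omE_ex gal hi.
  have wp : 3.-primitive_root w by rewrite -(fmorph_primitive_root io) -wE om_prim.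
  have [a [b [a0 b0 indep]]] := indep_values monos d0 dP.
  exact: (symbol_Br_p (n := 1) wp (natr_E_neq0 2) a0 b0 (symbol_domain (zp := prim_expr_order wp) a0 b0 indep)).
have [p2|p2] := eqVneq p 2%N; last first.
  have nc : ~ cyclic_primes E p.
    move=> [_ [L [galL cL dL]]]; case/eqP: p2; have [j jE] := embed_Om io L.
    have := abelian_dim gal alg jE galL no_i (cyclic_abelian cL); rewrite dL.
    by case: (p) pp => [|[|[|]]].
  by split; [left; right | right].
rewrite p2; split.
  by right => L [_ _ dL] D cdD dD; apply: (quadratic_embed no_i dL cdD dD).
left; have zp : (-1 : E) ^+ 2 = 1 by rewrite sqrrN expr1n.
have wp : 2.-primitive_root (-1 : E).
  have [[|[|[|m]]] mp dm] := prim_order_exists (isT : 0 < 2)%N zp => //.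
  have := prim_expr_order mp; rewrite expr1 => /eqP.
  by rewrite -subr_eq0 -opprD oppr_eq0 -mulr2n (negPf (natr_E_neq0 1)).
have N0 : (-1 : E) != 0 by rewrite oppr_eq0 oner_eq0.
apply: (symbol_Br_p (n := 0) wp (natr_E_neq0 1) N0 N0 (zp := zp)) => x y.
apply: quaternion_domain.
  exact: (sum_squares gal alg no_i).
exact: (sum_squares_eq0 no_i).
Qed.

End QuasilocalPackage.

(** * Norms *)

Section Norm.
Variables (E : fieldType) (io : {rmorphism E -> Om}).
Hypothesis gal : gal_closed io.
Hypothesis alg : forall x, Alg (io x).
Variables (R : fieldExtType E) (j : {rmorphism R -> Om}).
Hypothesis jE : forall x, j (in_alg R x) = io x.
Local Notation n := (\dim {:R}).
Local Notation b := (vbasis {:R}).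

Let M (y : R) : 'M[E]_n := passmx.mxof b b (amull y).
Let MD y y' : M (y + y') = M y + M y'.
Proof. by rewrite -[y in LHS]scale1r /M linearP /= passmx.mxof_linear scale1r. Qed.

Let M1 : M 1 = 1%:M.
Proof. by rewrite /M (_ : amull 1 = \1%VF) ?passmx.mxof1 ?(basis_free (vbasisP _)) //; apply/lfunP => z; rewrite !lfunE /= mul1r. Qed.

Let MZ k y : M (k *: y) = k *: M y.
Proof.
have M0 : M 0 = 0 by apply: (addrI (M 0)); rewrite -MD !addr0.
by rewrite -[k *: y]addr0 /M linearP /= passmx.mxof_linear -/(M 0) M0 addr0.
Qed.

Let MM y y' : M (y * y') = M y *m M y'.
Proof.
rewrite /M -passmx.mxof_comp //; last exact: vbasisP.
by congr passmx.mxof; apply/lfunP => z; rewrite !lfunE /= !lfunE /= mulrCA mulrA.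
Qed.

Lemma norm_scalar (k : E) : ext_norm (k%:A : R) = k ^+ n.
Proof. by rewrite /ext_norm -/(M _) MZ M1 scalemx1 det_scalar. Qed.

(* The eigenvalues of multiplication by x are conjugates of x, and conjugates have the same value. *)
Lemma vl_norm (x : R) : x != 0 -> ext_norm x != 0 /\ vl (io (ext_norm x)) = vl (j x) *+ n.
Proof.
move=> x0; rewrite -(fmorph_eq0 io) /ext_norm -/(M _) -det_map_mx; set A := map_mx io _.
have [rs rsE] := split_Om (char_poly_monic A).
have [m mE] := minPoly1 x.
have conj a : a \in rs -> exists h, a = tw h (j x).
  move=> ars; have : eigenvalue A a by rewrite eigenvalue_root_char rsE root_prod_XsubC.
  case/eigenvalueP => v va v0.
  (* On the eigenvector [v], multiplication by p(x) acts as p(a), so [a] is a root of the minimal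
     polynomial of [x]. *)
  have ev (p : {poly E}) : v *m map_mx io (M (map_poly (in_alg R) p).[x]) = (map_poly io p).[a] *: v.
    elim/poly_ind: p => [|p c IHp].
      by rewrite !rmorph0 !horner0 scale0r -(scale0r 1) MZ scale0r raddf0 mulmx0.
    rewrite !rmorphD !rmorphM /= !map_polyX !map_polyC /= !hornerMXaddC MD map_mxD mulmxDr.
    rewrite MM map_mxM mulmxA IHp -scalemxAl va scalerA scalerDl MZ M1 -[c *: _]/(c *: 1%:M).
    by rewrite map_mxZ map_mx1 -scalemxAr mulmx1.
  have ma : root (map_poly io m) a.
    have := ev m; rewrite -mE (eqP (root_minPoly 1 x)) -(scale0r 1) MZ scale0r raddf0 mulmx0.
    by move/esym/eqP; rewrite scaler_eq0 (negPf v0) orbF.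
  have [O uO OP] := finite_orbit io (alg_ext alg jE x).
  have [P PE] := orbit_poly gal uO OP.
  have : minPoly 1 x %| map_poly (in_alg R) P.
    apply: minPoly_dvdp; first by apply/polyOver1P; exists P.
    rewrite /root -(fmorph_eq0 j) (j_horner jE) PE -/(root _ _) root_prod_XsubC.
    by apply/OP; exists gaut1; [apply: fixE1 | rewrite tw1].
  rewrite mE dvdp_map => /dvdpP[q qE]; have : root (map_poly io P) a.
    by rewrite qE rmorphM rootM ma orbT.
  by rewrite PE root_prod_XsubC => /OP[h _ ->]; exists h.
have srs : size rs = n.
  by apply: succn_inj; rewrite -(size_prod_XsubC rs id) -rsE size_char_poly.
have -> : \det A = \prod_(r <- rs) r.
  have := congr1 (fun p : {poly Om} => p`_0) rsE; rewrite char_poly_det -!horner_coef0 horner_prod.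
  rewrite (eq_bigr (fun r => - r)) => [|r _]; last by rewrite hornerXsubC sub0r.
  have -> : \prod_(r <- rs) - r = (-1) ^+ size rs * \prod_(r <- rs) r.
    elim: (rs) => [|r s IHs]; first by rewrite !big_nil mulr1.
    by rewrite !big_cons IHs exprS; ring.
  by rewrite srs; apply: mulfI; rewrite expf_neq0 // oppr_eq0 oner_eq0.
rewrite -srs.
elim: (rs) conj => [|r s IHs] conj; first by rewrite big_nil oner_eq0 vl1.
have [|s0 sE] := IHs; first by move=> a a_s; apply: conj; rewrite inE a_s orbT.
have [h rE] := conj r (mem_head _ _); have jx0 : j x != 0 by rewrite fmorph_eq0.
have r0 : r != 0 by rewrite rE fmorph_eq0.
by rewrite big_cons mulf_neq0 // vlM // sE rE vl_tw // mulrS.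
Qed.

End Norm.

(** * Degrees of finite extensions *)

Lemma tw_true_swap x f : tw (true, ch1) (tw (false, x) f) = tw (false, chi x) (tw (true, ch1) f).
Proof.
by apply: series_ext => g; rewrite !twE /= rmorphM /= chr_conj !mul1r chrN.
Qed.

Lemma tw_true_factor x f : tw (true, x) f = tw (true, ch1) (tw (false, chi x) f).
Proof.
by apply: series_ext => g; rewrite !twE /= rmorphM /= chr_conj !mul1r chrN invrK.
Qed.

Lemma tw_false_inv x f : tw (false, x) (tw (false, chi x) f) = f.
Proof.
by apply: series_ext => g; rewrite !twE /= mulrA chrN mulfV ?mul1r // chr_neq0.
Qed.

Section OrbitSize.
Variables (z : Om) (O : seq Om).
Hypotheses (Az : Alg z) (uO : uniq O) (OP : forall w, w \in O <-> exists h, w = tw h z).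
Local Notation T := (seq_sub O).

Let valT (w : T) : exists k, val w = tw k z. Proof. exact: (OP _).1 (ssvalP w). Qed.

Let inO h (w : T) : tw h (val w) \in O.
Proof. by have [k ->] := valT w; apply/OP; exists (gautm h k); rewrite twM. Qed.

Let f h (w : T) : T := SeqSub (inO h w).
Let f_inj h : injective (f h).
Proof. by move=> v w /(congr1 val) /= /(can_inj (twK h)) e; apply: val_inj. Qed.
Let p h : {perm T} := perm (@f_inj h).

Let pE h w : val (p h w) = tw h (val w).
Proof. by rewrite permE. Qed.

Let P : {set {perm T}} := [set s | `[< exists x, s = p (false, x) >]].

Let P_group : group_set P.
Proof.
apply/group_setP; split.
  rewrite !inE; exists ch1; apply/permP => w; apply: val_inj.
  by rewrite /= perm1 pE tw1.
move=> s t; rewrite !inE => -[x ->] [y ->].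
exists (chm y x); apply/permP => w; apply: val_inj.
by rewrite /= permM !pE twM.
Qed.
Let PG : {group {perm T}} := Group P_group.

(** An element of prime order is induced by a character, which acts on finitely many algebraic
    elements with 3-power order; Cauchy's theorem concludes. *)
Let PG_3 : (3.-group PG)%g.
Proof.
apply/pgroupP => q pq /Cauchy[//|s sP oq].
have [x sE] : exists x, s = p (false, x) by move: sP; rewrite !inE.
have tor (w : T) : exists n, iter (3 ^ n) (tw (false, x)) (val w) = val w.
  by apply: Alg_torsion; have [h ->] := valT w; case: Az => r r0 rz; exists r => //; apply: root_tw.
pose N := (\max_(w : T) sval (cid (tor w)))%N.
have : (s ^+ (3 ^ N) = 1)%g.
  apply/permP => w; apply: val_inj; rewrite perm1 /=.
  have it n : val ((s ^+ n)%g w) = iter n (tw (false, x)) (val w).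
    elim: n => [|n IHn]; first by rewrite expg0 perm1.
    by rewrite expgSr permM sE pE -sE IHn.
  rewrite it; have : (sval (cid (tor w)) <= N)%N by apply: (leq_bigmax w).
  case: cid => n /= nP /subnKC <-; rewrite expnD mulnC.
  by elim: (3 ^ _)%N => [//|k IHk]; rewrite mulSn iterD IHk.
move/eqP; rewrite -order_dvdn oq Euclid_dvdX // dvdn_prime2 // => /andP[/eqP-> _].
by rewrite inE.
Qed.

Let zO : z \in O. Proof. by apply/OP; exists gaut1; rewrite tw1. Qed.
Let orb : {set T} := orbit 'P PG (SeqSub zO).

Let orbP (w : T) : w \in orb <-> exists x, val w = tw (false, x) z.
Proof.
split=> [/orbitP[s]|[x wE]].
  by rewrite !inE => -[x ->] <-; exists x; rewrite /= apermE pE.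
apply/orbitP; exists (p (false, x)); first by rewrite !inE; exists x.
by apply: val_inj; rewrite /= apermE pE.
Qed.

(* The orbit under the characters is an orbit of a 3-group; the whole orbit is this orbit or its
   disjoint union with its complex conjugate. *)
Lemma orbit_size : exists m, (size O %| 2 * 3 ^ m)%N.
Proof.
have [m mE] : exists m, #|orb| = (3 ^ m)%N.
  have [k kE] : {k | #|orb| = (3 ^ k)%N} by apply: p_natP; apply: pnat_dvd PG_3; rewrite card_orbit dvdn_indexg.
  by exists k.
exists m; rewrite -(card_seq_sub uO) -mE.
pose s := p (true, ch1); have cov : [set: T] = orb :|: s @: orb.
  apply/setP => w; rewrite !inE; apply/esym; have [[c x] wE] := valT w.
  case: c wE => wE; last by rewrite (orbP w).2 //; exists x.
  have yO : tw (false, chi x) z \in O by apply/OP; exists (false, chi x).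
  have -> : w = s (SeqSub yO) by apply: val_inj; rewrite /= pE /= wE tw_true_factor.
  by rewrite imset_f ?orbT //; apply/orbP; exists (chi x).
rewrite -cardsT cov; have [dis|] := boolP [disjoint orb & s @: orb].
  have ci : #|s @: orb| = #|orb| by apply: card_imset; apply: perm_inj.
  by rewrite cardsU disjoint_setI0 // cards0 subn0 ci addnn mul2n.
(* If the orbit meets its conjugate, the conjugate of [z] lies in it, and so does the whole
   conjugate orbit. *)
case/pred0Pn => u /andP[/= /orbP[x ux] /imsetP[v /orbP[y vy] uv]].
have tz : tw (true, ch1) z = tw (false, y) (tw (false, x) z).
  rewrite -ux uv pE vy tw_true_swap tw_false_inv //.
have sub : s @: orb \subset orb.
  apply/fintype.subsetP => _ /imsetP[t /orbP[w tE] ->]; apply/orbP.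
  exists (chm (chi w) (chm y x)); rewrite pE tE tw_true_swap tz.
  by apply: series_ext => g; rewrite !twE /= !mulrA.
by rewrite (finset.setUidPl sub) dvdn_mull.
Qed.

End OrbitSize.

(** * Norm groups *)

(** The leading coefficient of the term of least value cannot be cancelled. *)
Lemma sum_distinct_vl (I : finType) (F : I -> Om) :
  (forall i k, F i != 0 -> F k != 0 -> vl (F i) = vl (F k) -> i = k) ->
  \sum_i F i = 0 -> forall i, F i = 0.
Proof.
move=> inj F0 i0; apply/eqP; apply: contraT => Fi0.
case: (@arg_minP _ _ _ i0 (fun i => F i != 0) (fun i => ht (vl (F i))) Fi0) => i Fi imin.
have /eqP := congr1 (fun f : Om => f (vl (F i))) F0.
rewrite (big_morph (fun f : Om => f (vl (F i))) (id1 := 0) (op1 := +%R)) //.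
rewrite (bigD1 i) //= big1 ?addr0 => [e|k ki]; first by case/negP: (vl_lead Fi).
apply/eqP; apply: contraTT ki => Fk; rewrite negbK.
have Fk0 : F k != 0 by apply: contra_neq Fk => ->.
apply/eqP/inj => //; apply/ht_inj/eqP; by rewrite eq_le vl_min // imin.
Qed.

Lemma gal_kval : gal_closed kval.
Proof. by move=> z hz; apply: fixed_kval => h; apply: hz; apply: tw_kval. Qed.

(** By [vl_norm], the degree times a value of [R] is a value of K, hence in Z_(3)^2; this is the
    bound required by [indep_values]. *)
Lemma ext_PQL (R : fieldExtType baseK) : strictly_PQL R.
Proof.
have [j jE] := embed_Om kval R.
apply: (package_PQL (io := j) (d := \dim {:R})).
- by move=> z; apply: (gal_ext gal_kval Alg_kval jE).
- exact: (alg_ext Alg_kval jE).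
- by move=> g /mono_kval[c cE]; exists (in_alg R c); rewrite jE.
- by rewrite -[1%N](dimv1 R) dimvS ?subvf.
by move=> x x0; have [n0 <-] := vl_norm gal_kval Alg_kval jE x0; apply: kval_loc.
Qed.

Lemma no_i_kval : ~ has_i kval.
Proof.
move=> [x xE]; have := tw_kval (true, ch1) x; rewrite -xE tw_ii => /Om_oppr_id ii0.
by have := ii_sqr; rewrite ii0 mul0r => /esym/eqP; rewrite oppr_eq0 oner_eq0.
Qed.

Lemma nilpotent_dim2 (K : fieldType) (R : fieldExtType K) : has_char0 R -> (\dim {:R} <= 2)%N ->
  in_nilpotent_ext R.
Proof.
move=> c0 dR; have [b gb] := char0_gen c0.
pose p := minPoly 1 b; have pm : p \is monic by apply: monic_minPoly.
have [q pq] := factor_theorem _ _ (root_minPoly 1 b).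
have q0 : q != 0 by apply: contra_neq (monic_neq0 pm) => q0; rewrite /p pq q0 mul0r.
have qm : q \is monic by move: pm; rewrite /p pq monicMr // monicXsubC.
have sq : (size q <= 2)%N.
  have : (size p <= 3)%N by move: dR; rewrite size_minPoly -gb dim_Fadjoin dimv1 muln1.
  by rewrite /p pq size_Mmonic ?monicXsubC // size_XsubC addn2.
have [rs qE] : exists rs, q = \prod_(r <- rs) ('X - r%:P).
  have [q1|q2] := leqP (size q) 1.
    exists [::]; have qc := size1_polyC q1; rewrite big_nil qc.
    by move: qm; rewrite {1}qc monicE lead_coefC => /eqP->.
  have sq2 : size q = 2 by apply/eqP; rewrite eqn_leq sq.
  exists [:: - q`_0]; rewrite big_seq1 rmorphN opprK.
  apply/polyP => [[|[|i]]]; rewrite coefD coefX coefC /= ?add0r ?addr0 //.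
    by move: qm; rewrite monicE lead_coefE sq2 => /eqP.
  by rewrite nth_default // sq2.
have pE : p = \prod_(r <- rcons rs b) ('X - r%:P) by rewrite big_rcons -qE /p pq.
have spl : splittingFieldFor 1 p {:R}.
  exists (rcons rs b); first by rewrite pE eqpxx.
  apply/eqP; rewrite eqEsubv subvf /= -gb -adjoin_seq1; apply: adjoin_seqSr => z.
  by rewrite inE mem_rcons inE => ->.
have ax : splitting_field_axiom R by exists p => //; apply: minPolyOver.
pose M : splittingFieldType K := HB.pack (R : Type) (FieldExt.class R)
  (FieldExt_isSplittingField.Build K R ax).
exists M; have galM : galois 1 {:M}.
  apply/and3P; split; [exact: sub1v | | exact: normalFieldf].
  by apply/separableP => y _; apply: pcharf0_separable.
have cG : (#|'Gal({:M} / 1)%g| <= 2)%N by rewrite -(galois_dim galM) dimv1 divn1.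
split=> //; last exact: (inhabits (id_ahom R)).
have [G1|G1] := leqP #|'Gal({:M} / 1)%g| 1.
  by have -> : 'Gal({:M} / 1)%g = 1%g; [apply: card_le1_trivg | apply: nilpotent1].
apply: abelian_nil; apply: cyclic_abelian; apply: prime_cyclic.
by have -> : #|'Gal({:M} / 1)%g| = 2%N by apply/eqP; rewrite eqn_leq cG.
Qed.

Lemma dim_dvd (R : fieldExtType baseK) : exists m, (\dim {:R} %| 2 * 3 ^ m)%N.
Proof.
have [j jE] := embed_Om kval R; have [b gb] := L_gen j.
have unitR (x : R) : x != 0 -> x \is a GRing.unit by rewrite unitfE.
have [q [iq qb sq _]] := min_poly_ex unitR b; rewrite gb in sq.
have [O uO OP] := finite_orbit kval (alg_ext Alg_kval jE b).
have rb : root (map_poly kval q) (j b) by rewrite /root -(j_horner jE) [X in j X]qb rmorph0.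
have sO : \dim {:R} = size O by apply: succn_inj; rewrite -sq (irreducible_orbit gal_kval iq uO OP rb).
rewrite sO; apply: (orbit_size (alg_ext Alg_kval jE b) uO) => w; split=> [/OP[h _ ->]|[h ->]].
  by exists h.
by apply/OP; exists h => // x; apply: tw_kval.
Qed.

(** [L] has degree 1 or 2, and [c ^+ 2] is the norm of the scalar [c ^+ 2] or [c] respectively. *)
Lemma norm_square (R : fieldExtType baseK) (L : splittingFieldType baseK) :
  galois 1 {:L} -> abelian 'Gal({:L} / 1) -> norm_group R = norm_group L ->
  forall c : baseK, c != 0 -> exists2 z : R, z != 0 & ext_norm z = c ^+ 2.
Proof.
move=> galL abL RL c c0; have [j jE] := embed_Om kval L.
have dL := abelian_dim gal_kval Alg_kval jE galL no_i_kval abL.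
have dL0 : (0 < \dim {:L})%N by rewrite -[X in (X <= _)%N](dimv1 L) dimvS ?subvf.
have : norm_group L (c ^+ 2).
  have [l lE] : exists l, l ^+ \dim {:L} = c ^+ 2 /\ l != 0.
    case: (\dim {:L}) dL dL0 => [|[|[|]]] // _ _; last by exists c.
    by exists (c ^+ 2); rewrite expr1 expf_neq0.
  exists (l%:A) => /=; last by rewrite norm_scalar; case: lE.
  by rewrite scaler_eq0 oner_eq0 orbF; case: lE.
by rewrite -RL => -[z z0 <-]; exists z.
Qed.

Lemma norm_square_dim (R : fieldExtType baseK) :
  (forall c : baseK, c != 0 -> exists2 z : R, z != 0 & ext_norm z = c ^+ 2) -> (\dim {:R} <= 2)%N.
Proof.
move=> sq; have [j jE] := embed_Om kval R; set d := \dim {:R}.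
have d0 : (0 < d)%N by rewrite -[X in (X <= _)%N](dimv1 R) dimvS ?subvf.
have [m0 dm0] := dim_dvd R; have [e c3e dE] := @pfactor_coprime 3 _ isT d0.
set m := logn 3 d in dE; have e2 : (e <= 2)%N.
  apply: dvdn_leq => //; rewrite -(Gauss_dvdl _ (p := 3 ^ m0)) ; last by rewrite coprimeXr // coprime_sym.
  by apply: dvdn_trans dm0; rewrite -/d dE dvdn_mulr.
have [m1|m1] := posnP m; first by rewrite dE m1 muln1.
pose n := (3 ^ m)%N; pose Q := ('I_n * 'I_n)%type.
pose ex (q : Q) : rat * rat := (q.1%:R, q.2%:R).
have zex (q : Q) : exists z : R, z != 0 /\ vl (j z) *+ d = ex q *+ 2.
  have exl : locE (ex q) by split; exact: (loc3_int (_ : nat)%:Z).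
  have [c cE] := mono_kval exl.
  have vc : vl (kval c) = ex q by rewrite cE vl_mono ?oner_eq0.
  have c0 : c != 0.
    rewrite -(fmorph_eq0 kval) /= cE; apply/eqP => /(congr1 (fun f : Om => f (ex q))).
    by rewrite monoE eqxx => /eqP; rewrite oner_eq0.
  have [z z0 zE] := sq c c0; exists z; split=> //.
  have [_ <-] := vl_norm gal_kval Alg_kval jE z0.
  by rewrite zE rmorphXn /= vlX ?fmorph_eq0 // vc.
pose z q := sval (cid (zex q)).
have zP q : z q != 0 /\ vl (j (z q)) *+ d = ex q *+ 2 by rewrite /z; case: cid.
(* The degree is [e * n] with [e <= 2], and [n >= 3] because [m > 0]. *)
have big : (d < #|{: Q}|)%N.
  rewrite card_prod card_ord {1}dE [(e * _)%N]mulnC /n -/m ltn_pmul2l ?expn_gt0 //.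
  by apply: leq_ltn_trans e2 _; rewrite -(prednK m1) expnS; move: (expn_gt0 3 m.-1); lia.
pose X := [tuple z (enum_val i) | i < #|{: Q}|].
have : ~~ free X by rewrite /free size_tuple neq_ltn (leq_ltn_trans _ big) // dimvS ?subvf.
case/negP; apply/freeP => k k0 i0.
pose F (i : 'I_#|{: Q}|) : Om := kval (k i) * j (z (enum_val i)).
have FD i : F i != 0 -> k i != 0 /\ vl (F i) = vl (kval (k i)) + vl (j (z (enum_val i))).
  move=> Fi; have ki : k i != 0 by apply: contra_neq Fi => ki; rewrite /F ki rmorph0 mul0r.
  by rewrite /F vlM // fmorph_eq0 //; have [] := zP (enum_val i).
(* Equal values would put the difference of two values of elements [z] in the value group Z_(3)^2 of
   K; multiplied by [d], it says that [3 ^ m] divides the differences of the indices, which are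
   below [3 ^ m]. *)
have Finj i l : F i != 0 -> F l != 0 -> vl (F i) = vl (F l) -> i = l.
  move=> /FD[ki ->] /FD[kl ->] eqv; apply: enum_val_inj.
  have [_ vi] := zP (enum_val i); have [_ vlq] := zP (enum_val l).
  have loc : locE (vl (j (z (enum_val i))) - vl (j (z (enum_val l)))).
    have -> : vl (j (z (enum_val i))) - vl (j (z (enum_val l))) = vl (kval (k l)) - vl (kval (k i)).
      by apply/eqP; rewrite subr_eq addrAC -eqv [_ + vl (j (z (enum_val i))) - _]addrAC subrr add0r.
    by apply: locED; [|apply: locEN]; apply: kval_loc.
  have dif : (vl (j (z (enum_val i))) - vl (j (z (enum_val l)))) *+ d = (ex (enum_val i) - ex (enum_val l)) *+ 2.
    by rewrite !mulrnBl vi vlq.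
  move: (enum_val i) (enum_val l) (vl (j _) - vl (j _)) loc dif => q r g [l1 l2] dif.
  have key (a b : 'I_n) (s : rat) : loc3 s -> s *+ d = (a%:R - b%:R) *+ 2 -> a = b.
    move=> ls sd; have n0 : 3 ^+ m != 0 :> rat by rewrite expf_neq0.
    have : loc3 ((2 * (a%:Z - b%:Z))%:~R / 3 ^+ m).
      have -> : (2 * (a%:Z - b%:Z))%:~R / 3 ^+ m = e%:Z%:~R * s; last exact: loc3Z.
      apply: (mulIf n0); rewrite divfK // intrM rmorphB /= -mulrA [s * _]mulrC mulrA -natrX -natrM -dE.
      by rewrite mulr_natl sd mulrC mulr_natr.
    move/loc3_pow_int; rewrite Gauss_dvdzr; last by rewrite coprimezE abszX /= coprimeXl.
    rewrite dvdzE abszX /= -/n => dv; apply: val_inj => /=; apply/eqP.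
    have : (`|a%:Z - b%:Z|%N < n)%N by have := ltn_ord a; have := ltn_ord b; rewrite /n; lia.
    have [ab|ab] := posnP `|a%:Z - b%:Z|%N; last by rewrite ltnNge (dvdn_leq ab dv).
    by move=> _; move/eqP: ab; rewrite absz_eq0 subr_eq0.
  have e1 := congr1 fst dif; have e2' := congr1 snd dif.
  rewrite [q]surjective_pairing [r]surjective_pairing; congr pair.
    by apply: (key _ _ g.1) => //; move: e1; rewrite !(raddfMn fst).
  by apply: (key _ _ g.2) => //; move: e2'; rewrite !(raddfMn snd).
have F0 : F i0 = 0.
  apply: (sum_distinct_vl Finj); rewrite -[RHS](rmorph0 j) -k0 rmorph_sum; apply: eq_bigr => i _.
  by rewrite -mulr_algl rmorphM [X in X * _]jE -(tnth_nth 0 X) tnth_mktuple.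
by apply: contraTeq isT => ki; have [zi _] := zP (enum_val i0);
   move/eqP: F0; rewrite mulf_eq0 !fmorph_eq0 (negPf ki) (negPf zi).
Qed.

(** * The absolute Galois group *)

Definition algK (f : Om) : bool := `[< Alg f >].

Fact algK_divring_closed : divring_closed algK.
Proof.
split=> [|f f' /asboolP fP /asboolP fP'|f f' /asboolP fP /asboolP fP']; apply/asboolP.
- exact: algebraic1.
- exact: algebraic_sub.
- exact: algebraic_div.
Qed.
HB.instance Definition _ := GRing.isDivringClosed.Build _ algK algK_divring_closed.

Record closK := ClosK { cval :> Om; cvalP : cval \in algK }.
HB.instance Definition _ := [isSub for cval].
HB.instance Definition _ := [Choice of closK by <:].
HB.instance Definition _ := [SubChoice_isSubIntegralDomain of closK by <:].
HB.instance Definition _ := [SubIntegralDomain_isSubField of closK by <:].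

Fact cval_zmod : zmod_morphism cval. Proof. by []. Qed.
Fact cval_monoid : monoid_morphism cval. Proof. by []. Qed.
HB.instance Definition _ := GRing.isZmodMorphism.Build _ _ cval cval_zmod.
HB.instance Definition _ := GRing.isMonoidMorphism.Build _ _ cval cval_monoid.

Lemma Alg_cval (x : closK) : Alg (cval x).
Proof. by have /asboolP := cvalP x. Qed.

Lemma closK_ex (z : Om) : Alg z -> exists x : closK, cval x = z.
Proof. by move=> Az; have zA : z \in algK by [apply/asboolP]; exists (ClosK zA). Qed.

Definition kin (c : baseK) : closK := ClosK (introT (asboolP _) (Alg_kval c)).
Fact kin_zmod : zmod_morphism kin. Proof. by move=> c c'; apply: val_inj. Qed.
Fact kin_monoid : monoid_morphism kin. Proof. by split=> [|c c']; apply: val_inj. Qed.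
HB.instance Definition _ := GRing.isZmodMorphism.Build _ _ kin kin_zmod.
HB.instance Definition _ := GRing.isMonoidMorphism.Build _ _ kin kin_monoid.

Lemma separable_closure_kin : separable_closure kin.
Proof.
split=> [x|q _ sq].
  have [O uO OP] := finite_orbit kval (Alg_cval x).
  have [p pE] := orbit_poly gal_kval uO OP; exists p.
  split; first by rewrite -(separable_map kval) pE separable_prod_XsubC.
  rewrite -(fmorph_root cval) -map_poly_comp (eq_map_poly (g := kval)) // pE root_prod_XsubC.
  by apply/OP; exists gaut1; [apply: fixE1 | rewrite tw1].
have [|z qz] := @series_root _ (map_poly cval q); first by rewrite size_map_poly.
have [|x xE] := @closK_ex z; last by exists x; rewrite -(fmorph_root cval) /= xE.
apply: (Alg_root _ qz); first by rewrite map_poly_eq0 -size_poly_gt0 ltnW.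
by move=> i; rewrite coef_map; apply: Alg_cval.
Qed.

Lemma Alg_tw h (x : closK) : Alg (tw h (cval x)).
Proof. by have [r r0 rx] := Alg_cval x; exists r => //; apply: root_tw. Qed.

Definition gres h (x : closK) : closK := ClosK (introT (asboolP _) (Alg_tw h x)).

Fact gres_aut h : is_aut kin (gres h).
Proof.
split=> [x y|x y||c]; try apply: val_inj.
- exact: rmorphD.
- exact: rmorphM.
- by exists (gres (gauti h)) => x; apply: val_inj; rewrite /= ?twK ?twVK.
exact: tw_kval.
Qed.

Definition galt h : gal_group kin := GalAut (gres_aut h).

(** [s] inverts [t], so the commutator of [t] and [s] is the inverse square of [t]. As [t] has odd
    order, it is a power of this commutator, and [<[t]>] lies in its own commutator with [N], which
    nilpotency allows only for the trivial group. *)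
Lemma inverted_eq1 (N : finGroupType) (s t : N) n : nilpotent [set: N]%G ->
  (t * s * t = s)%g -> (t ^+ (3 ^ n) = 1)%g -> t = 1%g.
Proof.
move=> nil ts t3; apply/set1gP; move/forall_inP: nil => /(_ <[t]>%G) /=.
have -> : (<[t]> \subset [set: N] :&: [~: <[t]>, [set: N]])%g.
  rewrite finset.setTI cycle_subG.
  have c2 : [~ t, s]%g = (t^-1 * t^-1)%g.
    have cE : (t ^ s = t^-1)%g.
      by rewrite conjgE; apply: (mulIg t); rewrite -!mulgA [(t * (s * t))%g]mulgA ts !mulVg.
    by rewrite commgEl cE.
  (* The exponent is (3^n - 1)/2, so that the power of [t] on the right is 1 - 3^n. *)
  have tE : t = ([~ t, s] ^+ (3 ^ n)./2)%g.
    have odd3 : odd (3 ^ n) by rewrite oddX orbT.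
    have e3 : (3 ^ n = (3 ^ n)./2.*2.+1)%N by rewrite -{1}(odd_double_half (3 ^ n)) odd3.
    rewrite c2 -expg2 -expgM mul2n expgVn; apply: (mulIg (t ^+ (3 ^ n)./2.*2)%g).
    by rewrite mulVg -expgS -e3 t3.
  by rewrite {1}tE groupX // mem_commg ?cycle_id ?inE.
by move=> /(_ isT) /eqP <-; apply: cycle_id.
Qed.

Lemma multiplicative1 (G H : groupType) (f : {multiplicative G -> H}) : f 1%g = 1%g.
Proof. by apply: (mulgI (f 1%g)); rewrite -gmulfM !mulg1. Qed.

Lemma multiplicativeX (G H : groupType) (f : {multiplicative G -> H}) n x :
  f (x ^+ n)%g = (f x ^+ n)%g.
Proof.
by elim: n => [|n IHn]; rewrite ?expg0 ?multiplicative1 // !expgS gmulfM IHn.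
Qed.

(** An element of the separable closure moved by the character [chfst], as 1/3 is not in Z_(3). *)
Lemma third_Alg : Alg (mono 1 (3%:R^-1, 0)).
Proof.
have l1 : locE (1, 0) by split; [exact: (loc3_int 1) | exact: (loc3_int 0)].
have [c cE] := mono_kval l1; exists ('X^3 - c%:P).
  by rewrite -size_poly_gt0 size_XnsubC.
rewrite /root rmorphB /= map_polyXn map_polyC !hornerE /= cE subr_eq0.
rewrite !exprS expr0 mulr1 !monoM !mulr1; apply/eqP; congr (mono 1 _).
Qed.

Lemma not_pronilpotent : ~ pronilpotent (krull_open (i := kin)).
Proof.
move=> [J [le [N [phi [pr [lim nil]]]]]].
pose s := galt (true, ch1); pose t := galt (false, chfst).
have tst : (t * s * t = s)%g.
  by apply: gal_group_inj => x; apply: val_inj; rewrite /= tw_inv.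
have itE n x : cval ((t ^+ n)%g x) = iter n (tw (false, chfst)) (cval x).
  by elim: n => [|n IHn] //=; rewrite expgS /= IHn.
have prt j : pr j t = 1%g.
  (* The kernel of [pr j] is open, so it contains all automorphisms fixing some finite list [X], and
     a 3-power of [t] fixes [X]. *)
  have [n tn] : exists n, (pr j t ^+ (3 ^ n) = 1)%g.
    have : krull_open [set g | pr j g = 1%g]%classic.
      by apply/(il_open lim) => g /= gj; exists j => h; rewrite gj.
    move=> /(_ 1%g) [|X XP]; first exact: multiplicative1.
    have tor (x : closK) : exists n, iter (3 ^ n) (tw (false, chfst)) (cval x) = cval x.
      exact: Alg_torsion (Alg_cval x).
    pose n := (\max_(x <- X) sval (cid (tor x)))%N; exists n.
    have := XP (t ^+ (3 ^ n))%g; rewrite /= multiplicativeX; apply => x xX.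
    apply: val_inj; rewrite /= itE; have : (sval (cid (tor x)) <= n)%N by apply: leq_bigmax_seq.
    case: cid => k /= kP /subnKC <-; rewrite expnD mulnC.
    by elim: (3 ^ _)%N => [//|l IHl]; rewrite mulSn iterD IHl.
  apply: (inverted_eq1 (nil j) _ tn (s := pr j s)).
  by rewrite -!gmulfM tst.
(* Both [t] and 1 lie over the trivial compatible family, so they coincide. *)
have [g [_ guniq]] := il_bij lim (fun j k jk => multiplicative1 (phi j k jk)).
have t1 : t = 1%g by rewrite -(guniq t prt) -(guniq 1%g) // => j; apply: multiplicative1.
have [x xE] := closK_ex third_Alg.
have := congr1 (fun u : gal_group kin => cval (u x) (3%:R^-1, 0)) t1.
rewrite /= xE monoE eqxx mulr1 => /chr0_eq1 l3.
have : loc3 (1%:~R / 3 ^+ 1) by rewrite mul1r expr1.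
by move/loc3_pow_int.
Qed.

Theorem theorem1p3 :
  exists (K Ks : fieldType) (i : {rmorphism K -> Ks}),
    [/\ separable_closure i,
        forall R : fieldExtType K, strictly_PQL R,
        ~ pronilpotent (krull_open (i := i))
      & forall R : fieldExtType K,
          in_nilpotent_ext R \/
          (forall L : splittingFieldType K,
             galois 1 {:L} -> abelian 'Gal({:L} / 1) ->
             norm_group R <> norm_group L)].
Proof.
exists baseK, closK, kin; split.
- exact: separable_closure_kin.
- exact: ext_PQL.
- exact: not_pronilpotent.
move=> R; have [dR|dR] := leqP (\dim {:R}) 2.
  left; apply: nilpotent_dim2 dR; have [j _] := embed_Om kval R; exact: char0_to_Om j.
right=> L galL abL RL; move: dR; rewrite ltnNge => /negP[].
exact: norm_square_dim (norm_square galL abL RL).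
Qed.
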